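(* Let $c\ge 0$, $\alpha\in(0,1)$ and $n^*\in\mathbb{N}$, and set $\gamma_n=c(n-1)$ for $n\ge 1$. Then there exists $N_0=N_0(n^*,\alpha,c)\ge 2$ such that the following holds. Let $N\ge N_0$ and let $F_0^N$ be a symmetric Radon probability measure on $S^{N-1}(\sqrt N)$, used as the initial law of the stochastic Kac process. Denote the joint energy cumulants of order $n$ at time $t\ge 0$ by $\kappa_t^{n}[e_r]$, $r\in\mathscr{C}_n$, and put $\kappa_t^{n,N}=(\kappa_t^n[e_r])_{r\in\mathscr{C}_n'}$. Let $B\ge 1$ be a constant such that $$\max_{1\le n\le n^*}\ \max_{r\in\mathscr{C}_n}\left(\frac{|\kappa_0^n[e_r]|\,N^{\alpha(\mathrm{len}(r)-1)-c(n-1)}}{(n-1)!}\right)^{1/n}\le B .$$ Then there exists a constant $C$, depending only on $B$, such that for all $n\le n^*$ and all $t\ge 0$, $$\|\kappa_t^{n,N}\|_{\alpha}\le C^{n^2}\,n!\,\left(N^{\gamma_n}e^{-\frac{t}{4}}+1\right).$$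
   Context: Stochastic Kac model. For $N\ge 2$ the state space is the sphere $S^{N-1}(\sqrt N)=\{v\in\mathbb{R}^N: |v|^2=N\}$. For $i\ne j$ and $\theta\in(-\pi,\pi]$, let $R_{i,j}(\theta)$ be the rotation of $\mathbb{R}^N$ with $(R_{i,j}(\theta)v)_i=\cos(\theta)v_i+\sin(\theta)v_j$, $(R_{i,j}(\theta)v)_j=-\sin(\theta)v_i+\cos(\theta)v_j$, and all other components unchanged. Define $(Q_N\phi)(v)=\frac{1}{N(N-1)}\sum_{i\ne j}\int_{-\pi}^{\pi}\frac{d\theta}{2\pi}\phi(R_{i,j}(\theta)v)$. The stochastic Kac process is the Markov jump process on $S^{N-1}(\sqrt N)$ with generator $N(Q_N-I)$; if its initial law is $F_0^N$, its law $F_t^N$ at time $t\ge0$ satisfies $\frac{d}{dt}\int\phi\,dF_t^N=\int N(Q_N-I)\phi\,dF_t^N$ for all continuous $\phi$. A measure on the sphere is symmetric if it is invariant under all permutations of the coordinates $v_1,\dots,v_N$; symmetry is preserved by the evolution. Energies: $e_i=v_i^2$. Joint cumulants: for labels $i_1,\dots,i_n\in\{1,\dots,N\}$ (repetitions allowed), $\kappa_t[e_{i_1},\dots,e_{i_n}]$ is the joint cumulant under $F_t^N$, i.e. $\partial_{\xi_{i_1}}\cdots\partial_{\xi_{i_n}}\log\int e^{\sum_i\xi_i v_i^2}F_t^N(dv)$ at $\xi=0$. Partition classifiers: $\mathscr{C}_n$ is the set of $r=(r_1,\dots,r_n)\in\mathbb{N}_0^n$ with $r_1\ge\dots\ge r_n\ge0$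 and $\sum_k r_k=n$. $\mathrm{len}(r)$ is the number of nonzero components of $r$. $1_n=(1,\dots,1)$ and $\mathscr{C}_n'=\mathscr{C}_n\setminus\{1_n\}$. For $r\in\mathscr{C}_n$, $\kappa_t^n[e_r]$ is the order-$n$ joint cumulant under $F_t^N$ in which $e_k$ is repeated $r_k$ times, $k=1,\dots,\mathrm{len}(r)$ (it is understood that $N\ge n$ so that the labels make sense). Norm: for $\kappa=(\kappa_r)_{r\in\mathscr{C}_n'}$, $\|\kappa\|_\alpha=\|\kappa\|_{\alpha,n,N}=\sup_{r\in\mathscr{C}_n'}|\kappa_r|(N-1)^{\alpha(\mathrm{len}(r)-1)}$ (equal to $0$ if $\mathscr{C}_n'=\emptyset$). *)

(* Defs.v *)
From mathcomp Require Import all_boot all_order all_algebra all_fingroup.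
From mathcomp Require Import all_classical all_reals all_analysis.

Set Implicit Arguments.
Unset Strict Implicit.
Unset Printing Implicit Defensive.
Import Order.TTheory GRing.Theory Num.Theory.
Import numFieldNormedType.Exports.
Local Open Scope classical_set_scope.
Local Open Scope ring_scope.

(* R^N with its Borel sigma-algebra.  Measures on the sphere S^{N-1}(sqrt N)
   are represented by Borel measures on R^N that are carried by the sphere. *)
Notation borel_rV R N := (g_sigma_algebraType (@open 'rV[R]_N)).

Section Sphere.
Variables (R : realType) (N : nat).

Definition sphere : set 'rV[R]_N :=
  [set v | \sum_i v 0 i ^+ 2 = N%:R].

Definition radon (mu : set (borel_rV R N) -> \bar R) : Prop :=
  (forall K : set 'rV[R]_N, compact K -> (mu K < +oo)%E) /\
  (forall A : set (borel_rV R N), measurable A ->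
    mu A = ereal_sup [set mu K |
             K in [set K : set 'rV[R]_N | compact K /\ K `<=` A]]).

Definition symmetric_law (mu : set (borel_rV R N) -> \bar R) : Prop :=
  forall (s : 'S_N) (A : set (borel_rV R N)), measurable A ->
    mu ((fun v : 'rV[R]_N => col_perm s v) @^-1` A) = mu A.

End Sphere.

Section Generator.
Variables (R : realType) (N : nat).

Definition rotation (i j : 'I_N) (theta : R) (v : 'rV[R]_N) : 'rV[R]_N :=
  \row_k if k == i then cos theta * v 0 i + sin theta * v 0 j
         else if k == j then - sin theta * v 0 i + cos theta * v 0 j
         else v 0 k.

Definition kac_Q (phi : 'rV[R]_N -> R) (v : 'rV[R]_N) : R :=
  (N%:R * (N%:R - 1))^-1 *
  \sum_(i < N) \sum_(j < N | i != j)
    \int[lebesgue_measure]_(theta in `[- pi, pi])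
      ((2 * pi)^-1 * phi (rotation i j theta v)).

Definition kac_generator (phi : 'rV[R]_N -> R) (v : 'rV[R]_N) : R :=
  N%:R * (kac_Q phi v - phi v).

End Generator.

Section MarkovJumpProcess.
Variables (R : realType) (N : nat) (S : set (borel_rV R N)).

(* Time is indexed by R; only nonnegative times are constrained. *)
Definition transition_semigroup
    (p : R -> R.-pker (borel_rV R N) ~> (borel_rV R N)) : Prop :=
  [/\ forall (t : R) x, 0 <= t -> S x -> p t x S = 1%E,
      forall x A, S x -> measurable A -> p 0 x A = \d_x A
    & forall (s t : R) x A, 0 <= s -> 0 <= t -> S x -> measurable A ->
        p (s + t) x A = (\int[p s x]_(y in S) p t y A)%E].

(* The generator is the strong one on C(S): the convergence is uniform on S. *)
Definition has_generator
    (p : R -> R.-pker (borel_rV R N) ~> (borel_rV R N))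
    (L : ('rV[R]_N -> R) -> 'rV[R]_N -> R) : Prop :=
  forall phi : 'rV[R]_N -> R, {within S, continuous phi} ->
  forall eps : R, 0 < eps ->
  \forall h \near 0^'+, forall x, S x ->
    `|h^-1 * (\int[p h x]_(y in S) phi y - phi x) - L phi x| <= eps.

Section Process.
Variables (d : measure_display) (Omega : measurableType d).
Variables (P : probability Omega R) (X : R -> {RV P >-> borel_rV R N}).

Definition history (s : R) : set (set Omega) :=
  <<s [set H | exists (u : R) A, [/\ 0 <= u <= s, measurable A & H = X u @^-1` A]] >>.

(* The second and third conditions say that the paths are right-continuous step
   functions with finitely many jumps in every bounded time interval; the
   fourth one is the Markov property. *)
Definition markov_jump_process
    (p : R -> R.-pker (borel_rV R N) ~> (borel_rV R N)) : Prop :=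
  [/\ forall (t : R) w, 0 <= t -> S (X t w),
      forall (t : R) w, 0 <= t -> \forall s \near t^'+, X s w = X t w,
      forall (t : R) w, 0 < t -> exists x, \forall s \near t^'-, X s w = x
    & forall (s t : R) H A, 0 <= s -> 0 <= t -> history s H -> measurable A ->
        P (H `&` X (s + t) @^-1` A) = (\int[P]_(w in H) p t (X s w) A)%E].

End Process.
End MarkovJumpProcess.

Definition kac_process (R : realType) (N : nat) (d : measure_display)
    (Omega : measurableType d) (P : probability Omega R)
    (X : R -> {RV P >-> borel_rV R N}) : Prop :=
  exists p : R -> R.-pker (borel_rV R N) ~> (borel_rV R N),
    [/\ transition_semigroup (@sphere R N) p,
        has_generator (@sphere R N) p (@kac_generator R N)
      & markov_jump_process (@sphere R N) X p].

Section Cumulants.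
Variables (R : realType) (N : nat).
Variable F : {measure set (borel_rV R N) -> \bar R}.

Definition energy_cgf (xi : 'rV[R]_N) : R :=
  ln (\int[F]_(v in @sphere R N) expR (\sum_i xi 0 i * v 0 i ^+ 2)).

Definition energy_cumulant (labels : seq 'I_N) : R :=
  foldr (fun i (f : 'rV[R]_N -> R) xi => 'D_(delta_mx 0 i) f xi)
    energy_cgf labels 0.

End Cumulants.

(* The components of r sum to n, so each of them lies in 'I_n.+1. *)
Definition classifiers (n : nat) : {set n.-tuple 'I_n.+1} :=
  [set r : n.-tuple 'I_n.+1 |
    sorted geq [seq val k | k <- r] & sumn [seq val k | k <- r] == n]%SET.

Definition ones (n : nat) : n.-tuple 'I_n.+1 := [tuple inord 1 | i < n].

Definition classifiers' (n : nat) : {set n.-tuple 'I_n.+1} :=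
  (classifiers n :\ ones n)%SET.

Definition len (n : nat) (r : n.-tuple 'I_n.+1) : nat :=
  count (fun k : 'I_n.+1 => k != 0 :> nat) r.

(* The label k (counted from 0) is repeated r_k times; labels beyond the length
   of r do not occur.  Meaningful when n <= N. *)
Definition classifier_labels (N n : nat) (r : n.-tuple 'I_n.+1) : seq 'I_N :=
  flatten [seq nseq (nth 0%N [seq val l | l <- r] k) k | k : 'I_N <- enum 'I_N].

Definition classifier_cumulant (R : realType) (N n : nat)
    (F : {measure set (borel_rV R N) -> \bar R}) (r : n.-tuple 'I_n.+1) : R :=
  energy_cumulant F (classifier_labels N r).

Definition cumulant_norm (R : realType) (alpha : R) (n N : nat)
    (kappa : n.-tuple 'I_n.+1 -> R) : R :=
  \big[Num.max/0]_(r in classifiers' n)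
    (`|kappa r| * (N%:R - 1) `^ (alpha * ((len r)%:R - 1))).

Definition gamma (R : realType) (c : R) (n : nat) : R := c * (n%:R - 1).

(* Main.v *)
(* The energies e_i = v_i^2 form a Markov process by themselves: averaged over the
   angle, a collision replaces (e_i, e_j) by (c (e_i + e_j), s (e_i + e_j)) with
   c = cos^2 and s = sin^2.  Hence the cumulant generating function K satisfies
     d/dt K(xi) = (N-1)^-1 \sum_(i <> j) < exp (K (T_ij xi) - K(xi)) - 1 >,
   where T_ij is the transposed collision map and < > is the angular mean.
   Expanding the exponential, a cumulant with label sequence L has as drift
     - a relaxation term of rate at least about 1/2 if some label is repeated,
       because < cos^(2m) > <= 3/8 for m >= 2;
     - linear terms with one more distinct label, smaller by (N-1)^-alpha;
     - products of lower order cumulants with at least the same decay in N;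
     - collisions inside L, smaller by (N-1)^(alpha-1).
   Cumulants of pairwise distinct labels have no relaxation; they are recovered
   from the others by conservation of energy, \sum_j kappa[e_j, ...] = 0.
   By induction on the order n, C^(n^2) n! (N^gamma_n exp(-t/4) + 1) is a strict
   upper barrier for all normalised cumulants of order n. *)

From HB Require Import structures.
Require Import Defs.
From mathcomp Require Import all_boot all_order all_algebra all_fingroup.
From mathcomp Require Import ring lra zify.
From mathcomp Require Import all_classical all_reals all_analysis measurable_realfun.
Import Order.TTheory GRing.Theory Num.Theory.
Import numFieldNormedType.Exports.
Local Open Scope classical_set_scope.
Local Open Scope ring_scope.

Set Implicit Arguments.
Unset Strict Implicit.
Unset Printing Implicit Defensive.

(** * The shuffle algebra of label sequences *)

(** A power series in [xi] is stored as the function sending a label list to the corresponding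
    iterated derivative at 0. Products, logarithms, linear substitutions and time derivatives of
    generating functions become finite recursions on lists, free of convergence questions; analysis
    enters only through moments of bounded observables.

    The estimate closes order by order because a collision exchanges labels but never changes their
    number. The ansatz for a list [A] is a size factor times [q ^+ (ndist A).-1] with q =
    (N-1)^-alpha.

    The numbers: for large N relaxation has rate at least 7/16, while the barrier falls at relative
    rate at most 1/4. The gap 3/16 has to absorb all errors, which are brought down to 1/16, half of
    it by the choice of N and half by C >= 100.

    A second obstacle is that the Markov property and the generator only give forward increments of
    moments, whereas the barrier argument needs continuity and true derivatives. Uniformity of the
    increments in the starting time bridges this. Symmetry at positive times is likewise derived,
    from uniqueness for the moment equations. *)

Section Splits.
Variable T : eqType.

(** Positions rather than labels are distributed, so a list of length n has 2^n splits, and sums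
    over them carry the multiplicities of the Leibniz rule. *)
Fixpoint splits (L : seq T) : seq (seq T * seq T) :=
  if L is x :: L' then
    [seq (x :: p.1, p.2) | p <- splits L'] ++ [seq (p.1, x :: p.2) | p <- splits L']
  else [:: ([::], [::])].

Lemma splits_perm (L : seq T) p : p \in splits L -> perm_eq (p.1 ++ p.2) L.
Proof.
elim: L p => [|x L IH] p /=; first by rewrite inE => /eqP ->.
rewrite mem_cat => /orP[] /mapP[p' /IH pp ->] /=; first by rewrite perm_cons.
by rewrite (perm_catCA _ [:: x]) /= perm_cons.
Qed.

Lemma splits_size (L : seq T) p : p \in splits L ->
  (size p.1 + size p.2)%N = size L.
Proof. by move/splits_perm/perm_size; rewrite size_cat. Qed.

Lemma splits_size1 (L : seq T) p : p \in splits L -> (size p.1 <= size L)%N.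
Proof. by move/splits_size <-; rewrite leq_addr. Qed.

Lemma splits_size2 (L : seq T) p : p \in splits L -> (size p.2 <= size L)%N.
Proof. by move/splits_size <-; rewrite leq_addl. Qed.

End Splits.

Section Shuffle.
Variables (T : eqType) (R : comRingType).
Implicit Types (f g h k m : seq T -> R) (x y : T) (L : seq T).

(* A function on lists stands for the exponential power series whose iterated
   partial derivatives at 0 are its values: [der x f] is the partial derivative
   of [f] and [shuffle] the product of series. *)
Definition der x f : seq T -> R := fun L => f (x :: L).

Definition shuffle f g L : R := \sum_(p <- splits L) f p.1 * g p.2.

Definition sone L : R := (L == [::])%:R.

Lemma shuffle_nil f g : shuffle f g [::] = f [::] * g [::].
Proof. by rewrite /shuffle big_seq1. Qed.

Lemma shuffle_cons f g x L :
  shuffle f g (x :: L) = shuffle (der x f) g L + shuffle f (der x g) L.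
Proof. by rewrite /shuffle /= big_cat /= !big_map. Qed.

Lemma der_shuffle f g x : der x (shuffle f g) = shuffle (der x f) g \+ shuffle f (der x g).
Proof. by apply/funext => L; rewrite /der shuffle_cons. Qed.

Lemma eq_shuffle_size f f' g g' L :
  (forall A, (size A <= size L)%N -> f A = f' A) ->
  (forall A, (size A <= size L)%N -> g A = g' A) ->
  shuffle f g L = shuffle f' g' L.
Proof.
move=> ff gg; rewrite /shuffle; apply: eq_big_seq => p pL.
by rewrite ff ?gg ?(splits_size1 pL) ?(splits_size2 pL).
Qed.

Lemma shuffleDl f f' g : shuffle (f \+ f') g = shuffle f g \+ shuffle f' g.
Proof.
by apply/funext => L; rewrite /shuffle /= -big_split; apply: eq_bigr => p _; rewrite mulrDl.
Qed.

Lemma shuffleDr f g g' : shuffle f (g \+ g') = shuffle f g \+ shuffle f g'.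
Proof.
by apply/funext => L; rewrite /shuffle /= -big_split; apply: eq_bigr => p _; rewrite mulrDr.
Qed.

Lemma shuffleZl (a : R) f g : shuffle (fun L => a * f L) g = (fun L => a * shuffle f g L).
Proof.
by apply/funext => L; rewrite /shuffle mulr_sumr; apply: eq_bigr => p _; rewrite mulrA.
Qed.

Lemma shuffle_suml (I : Type) (r : seq I) (P : pred I) (F : I -> seq T -> R) g L :
  shuffle (fun A => \sum_(i <- r | P i) F i A) g L = \sum_(i <- r | P i) shuffle (F i) g L.
Proof.
rewrite /shuffle exchange_big /=; apply: eq_bigr => p _.
by rewrite mulr_suml.
Qed.

Lemma shuffleC f g : shuffle f g = shuffle g f.
Proof.
apply/funext => L; elim: L f g => [|x L IH] f g; first by rewrite !shuffle_nil mulrC.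
by rewrite !shuffle_cons addrC (IH f) (IH _ g).
Qed.

Lemma shuffleA f g h : shuffle f (shuffle g h) = shuffle (shuffle f g) h.
Proof.
apply/funext => L; elim: L f g h => [|x L IH] f g h; first by rewrite !shuffle_nil mulrA.
by rewrite !shuffle_cons !der_shuffle shuffleDl shuffleDr /= !IH addrA.
Qed.

Lemma shuffle1f f : shuffle sone f = f.
Proof.
apply/funext => L; elim: L f => [|x L IH] f; first by rewrite shuffle_nil mul1r.
rewrite shuffle_cons IH -[RHS]add0r; congr (_ + _).
by rewrite /shuffle big1 // => p _; rewrite /der /sone mul0r.
Qed.

Lemma sum_splits_remainder f g L :
  \sum_(p <- splits L) f p.1 * g p.2 =
  f L * g [::] + \sum_(p <- splits L | p.2 != [::]) f p.1 * g p.2.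
Proof.
rewrite (bigID (fun p => p.2 == [::])) /=; congr (_ + _).
elim: L f => [|x L IH] f; first by rewrite /= big_cons big_nil /= addr0.
by rewrite /= big_cat /= !big_map (IH (der x f)) [X in _ + X]big_pred0 ?addr0.
Qed.

Lemma shuffle_split f m L : m [::] = 1 ->
  shuffle f m L = f L + \sum_(p <- splits L | p.2 != [::]) f p.1 * m p.2.
Proof. by move=> m1; rewrite /shuffle sum_splits_remainder m1 mulr1. Qed.

(** Multiplication by a series with constant term 1 is triangular in the length: the split with
    empty second part gives [g L], and every other split evaluates [g] on a strictly shorter
    list. *)
Lemma shuffle_cancel_size m g g' n : m [::] = 1 ->
  (forall L, (size L <= n)%N -> shuffle g m L = shuffle g' m L) ->
  forall L, (size L <= n)%N -> g L = g' L.
Proof.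
move=> m1 eqgm L; have [k] := ubnP (size L).
elim: k L => // k IH L Lk Ln.
have := eqgm L Ln; rewrite !shuffle_split //.
suff -> : \sum_(p <- splits L | p.2 != [::]) g p.1 * m p.2 =
    \sum_(p <- splits L | p.2 != [::]) g' p.1 * m p.2 by move/addIr.
rewrite big_seq_cond [RHS]big_seq_cond; apply: eq_bigr => p /andP[pL p2].
congr (_ * _).
have lt : (size p.1 < size L)%N.
  by rewrite -(splits_size pL) -[ltnLHS]addn0 ltn_add2l lt0n size_eq0.
by apply: IH; [exact: leq_trans lt Lk | exact: leq_trans (ltnW lt) Ln].
Qed.

Lemma shuffle_cancel m g g' : m [::] = 1 -> shuffle g m = shuffle g' m -> g = g'.
Proof.
move=> m1 eqgm; apply/funext => L.
by apply: (@shuffle_cancel_size m g g' (size L)) => // A _; rewrite eqgm.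
Qed.

(* [m] is the exponential of [k]: the moments [m] have cumulants [k].  The value
   [k [::]] plays no role. *)
Definition is_exp k m := m [::] = 1 /\ forall x, der x m = shuffle (der x k) m.

Lemma is_exp_uniq k k' m m' : is_exp k m -> is_exp k' m' ->
  (forall x, der x k = der x k') -> m = m'.
Proof.
move=> [m1 dm] [m1' dm'] kk; apply/funext => L.
have [n] := ubnP (size L); elim: n L => // n IH [|x L] Ln; first by rewrite m1 m1'.
rewrite -[LHS]/(der x m L) -[RHS]/(der x m' L) dm dm' kk.
by apply: eq_shuffle_size => // A AL; apply: IH; exact: leq_ltn_trans AL Ln.
Qed.

End Shuffle.

(** * Exponential and logarithm of series *)

Section ExpLog.
Variables (T : eqType) (R : comRingType).
Implicit Types (f g h k m : seq T -> R) (x y : T) (L : seq T).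

Lemma is_exp_cons k m x L : is_exp k m -> m (x :: L) = shuffle (der x k) m L.
Proof. by move=> [_ dm]; rewrite -dm. Qed.

Lemma is_expD k k' m m' : is_exp k m -> is_exp k' m' ->
  is_exp (k \+ k') (shuffle m m').
Proof.
move=> [m1 dm] [m1' dm']; split; first by rewrite shuffle_nil m1 m1' mulr1.
move=> x; rewrite der_shuffle dm dm' (shuffleC m) -!shuffleA (shuffleC m' m) -shuffleDl.
by congr shuffle.
Qed.

(** [n] is fuel, since [p.2] is no subterm of the list; the value 0 is met only when it runs out.
    Unfolded, this is the sum over set partitions of the positions of the products of [f] over
    blocks, the block of the first label being chosen first. *)
Fixpoint expo_rec n f L : R :=
  if L is x :: L' then
    if n is n'.+1 then \sum_(p <- splits L') f (x :: p.1) * expo_rec n' f p.2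
    else 0
  else 1.

Definition expo f L := expo_rec (size L) f L.

Lemma expo_recE n f L : (size L <= n)%N -> expo_rec n f L = expo f L.
Proof.
rewrite /expo.
suff H n1 n2 : (size L <= n1)%N -> (size L <= n2)%N -> expo_rec n1 f L = expo_rec n2 f L.
  by move=> Ln; apply: H.
elim: n1 n2 L => [|n1 IH] [|n2] [|x L] //= L1 L2.
rewrite big_seq [RHS]big_seq; apply: eq_bigr => p pL; congr (_ * _).
by apply: IH; apply: leq_trans (splits_size2 pL) _.
Qed.

Lemma expo_cons f x L : expo f (x :: L) = shuffle (der x f) (expo f) L.
Proof.
rewrite /expo /= /shuffle big_seq [RHS]big_seq; apply: eq_bigr => p pL; congr (_ * _).
by apply: expo_recE; apply: (splits_size2 pL).
Qed.

Lemma expoP f : is_exp f (expo f).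
Proof. by split=> // x; apply/funext => L; rewrite -expo_cons. Qed.

(** The moment recursion, solved for its only cumulant of full order. Again [n] is fuel. The free
    constant term of the logarithm is set to 0, so that its time derivative vanishes as
    [is_exp_derive] requires. *)
Fixpoint log_rec n m L : R :=
  if L is x :: L' then
    if n is n'.+1 then
      m L - \sum_(p <- splits L' | p.2 != [::]) log_rec n' m (x :: p.1) * m p.2
    else 0
  else 0.

Definition logm m L := log_rec (size L) m L.

Lemma splits_size_lt L p : p \in splits L -> p.2 != [::] -> (size p.1 < size L)%N.
Proof.
move=> pL p2; rewrite -(splits_size pL) -[ltnLHS]addn0 ltn_add2l.
by rewrite lt0n size_eq0.
Qed.

Lemma log_recE n m L : (size L <= n)%N -> log_rec n m L = logm m L.
Proof.
rewrite /logm.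
suff H n1 n2 : (size L <= n1)%N -> (size L <= n2)%N -> log_rec n1 m L = log_rec n2 m L.
  by move=> Ln; apply: H.
elim: n1 n2 L => [|n1 IH] [|n2] [|x L] //= L1 L2; congr (_ - _).
rewrite big_seq_cond [RHS]big_seq_cond; apply: eq_bigr => p /andP[pL p2]; congr (_ * _).
by apply: IH; apply: leq_trans (splits_size_lt pL p2) _.
Qed.

Lemma logm_cons m x L : logm m (x :: L) =
  m (x :: L) - \sum_(p <- splits L | p.2 != [::]) logm m (x :: p.1) * m p.2.
Proof.
rewrite {1}/logm /=; congr (_ - _).
rewrite big_seq_cond [RHS]big_seq_cond; apply: eq_bigr => p /andP[pL p2]; congr (_ * _).
by apply: log_recE; apply: (splits_size_lt pL p2).
Qed.

Lemma logmP m : m [::] = 1 -> is_exp (logm m) m.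
Proof.
move=> m1; split=> // x; apply/funext => L.
by rewrite shuffle_split // /der logm_cons subrK.
Qed.

Lemma logm_inj_map (s : T -> T) m L : injective s ->
  logm (fun A => m (map s A)) L = logm m (map s L).
Proof.
move=> si.
have splits_map A : splits (map s A) = [seq (map s p.1, map s p.2) | p <- splits A].
  elim: A => //= x A ->; rewrite map_cat -!map_comp; congr (_ ++ _); exact: eq_map.
have [n] := ubnP (size L); elim: n L => // n IH [|x L] Ln //.
rewrite /= !logm_cons /=; congr (_ - _).
rewrite splits_map big_map big_seq_cond [RHS]big_seq_cond /=.
have nilmap A : (map s A != [::]) = (A != [::]) by case: A.
under [in RHS]eq_bigl do rewrite nilmap.
apply: eq_bigr => p /andP[pL p2].
by rewrite (IH (x :: p.1)) //; apply: leq_ltn_trans (splits_size_lt pL p2) _.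
Qed.

(** The mixed second derivative of exp k is (k_xy + k_x k_y) exp k. The product k_x k_y is
    symmetric, so symmetry of the moments passes to k_xy once exp k is cancelled. *)
Lemma is_exp_swap k m x y L : is_exp k m ->
  (forall A, m (x :: y :: A) = m (y :: x :: A)) -> k (x :: y :: L) = k (y :: x :: L).
Proof.
move=> [m1 dm] sym.
have dd u v : der u (der v m) = shuffle (der u (der v k)) m \+ shuffle (der v k) (shuffle (der u k) m).
  by rewrite dm der_shuffle dm.
have : shuffle (der y (der x k)) m = shuffle (der x (der y k)) m.
  have E : der y (der x m) = der x (der y m) by apply/funext => A; exact: sym.
  apply/funext => A; move/(congr1 (fun f => f A)) : E; rewrite !dd /= shuffleA.
  by rewrite (shuffleC (der x k)) -shuffleA => /addIr.
by move/(shuffle_cancel m1)/(congr1 (fun f => f L)).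
Qed.

End ExpLog.

(** * Collisions as linear substitutions *)

Section Collision.
Variables (T : eqType) (R : comRingType) (i j : T) (c s : R).
Implicit Types (f g h k m : seq T -> R) (x y : T) (L : seq T).

(* The substitution e_i -> c (e_i + e_j), e_j -> s (e_i + e_j), extended to
   products of energies. *)
Fixpoint substs L : seq (seq T) :=
  if L is x :: L' then
    if x \in [:: i; j] then map (cons i) (substs L') ++ map (cons j) (substs L')
    else map (cons x) (substs L')
  else [:: [::]].

Fixpoint weight L : R :=
  if L is x :: L' then (if x == i then c else if x == j then s else 1) * weight L'
  else 1.

Definition coll f L := weight L * \sum_(A <- substs L) f A.

Lemma coll_cons f x L : coll f (x :: L) =
  if x \in [:: i; j] then (if x == i then c else s) * coll (der i f \+ der j f) L
  else coll (der x f) L.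
Proof.
rewrite /coll /= !inE; case: eqVneq => [xi|xi] /=.
  by rewrite big_cat /= !big_map big_split mulrA.
case: eqVneq => [xj|xj] /=; first by rewrite big_cat /= !big_map big_split mulrA.
by rewrite big_map mul1r.
Qed.

Lemma collD f g : coll (f \+ g) = coll f \+ coll g.
Proof. by apply/funext => L; rewrite /coll /= big_split mulrDr. Qed.

(** [coll] composes a series with a linear change of variables, hence respects products. [coll_cons]
    is the chain rule, which the induction plays against the Leibniz rule. *)
Lemma coll_shuffle f g : coll (shuffle f g) = shuffle (coll f) (coll g).
Proof.
apply/funext => L; elim: L f g => [|x L IH] f g.
  by rewrite shuffle_nil /coll /= !big_seq1 !mul1r shuffle_nil.
rewrite shuffle_cons coll_cons.
have dx h : der x (coll h) = if x \in [:: i; j] then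
    (fun L => (if x == i then c else s) * coll (der i h \+ der j h) L) else coll (der x h).
  by apply/funext => A; rewrite /der coll_cons; case: ifP.
rewrite !dx; case: ifP => _; last by rewrite der_shuffle collD /= !IH.
rewrite (shuffleC (coll f)) !(shuffleZl _ (coll (_ \+ _))) -mulrDr (shuffleC _ (coll f)).
congr (_ * _); rewrite !der_shuffle !collD /= !IH !(shuffleDl, shuffleDr) /=.
by rewrite addrACA.
Qed.

Lemma is_exp_coll k m : is_exp k m -> is_exp (coll k) (coll m).
Proof.
move=> [m1 dm]; split; first by rewrite /coll /= big_seq1 mul1r m1.
move=> x; apply/funext => L; rewrite /der coll_cons.
case: (boolP (x \in _)) => xij.
  rewrite !dm -shuffleDl coll_shuffle.
  rewrite -[RHS]/(shuffle _ _ _).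
  have -> : (fun L0 => coll k (x :: L0)) =
      (fun L0 => (if x == i then c else s) * coll (der i k \+ der j k) L0).
    by apply/funext => A; rewrite coll_cons xij.
  by rewrite (shuffleZl _ (coll (_ \+ _))).
rewrite dm coll_shuffle.
by congr shuffle; apply/funext => A; rewrite coll_cons (negbTE xij).
Qed.

(* With [K] the cumulant series, the left side is [exp (K \o T)] for the collision
   substitution [T], and [exp (K \o T) = exp (K \o T - K) * exp K]. *)
Lemma coll_ratio k m : is_exp k m ->
  coll m = shuffle (expo (fun L => coll k L - k L)) m.
Proof.
move=> km; refine (is_exp_uniq (is_exp_coll km) (is_expD (expoP _) km) _). move=> x.
by apply/funext => L; rewrite /der /= subrK.
Qed.

Lemma coll_id f L : i \notin L -> j \notin L -> coll f L = f L.
Proof.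
elim: L f => [|x L IH] f; first by rewrite /coll /= big_seq1 mul1r.
rewrite 2!inE !negb_or => /andP[ix iL] /andP[jx jL].
by rewrite coll_cons !inE ![x == _]eq_sym (negbTE ix) (negbTE jx) /= IH.
Qed.

Lemma substs_size L A : A \in substs L -> size A = size L.
Proof.
elim: L A => [|x L IH] A /=; first by rewrite inE => /eqP ->.
case: ifP => _; last by case/mapP => B /IH <- ->.
by rewrite mem_cat => /orP[] /mapP[B /IH <- ->].
Qed.

Lemma size_substs L : size (substs L) = (2 ^ count (mem [:: i; j]) L)%N.
Proof.
elim: L => //= x L IH; case: ifP => _; last by rewrite size_map.
by rewrite size_cat !size_map IH addnn expnS mul2n.
Qed.

Lemma substs_others L A x : A \in substs L -> x != i -> x != j -> x \in L -> x \in A.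
Proof.
move=> + xi xj; elim: L A => [|y L IH] A //=.
rewrite !inE; case: ifP => [|_] /=.
  move=> yij; have -> : (x == y) = false.
    by apply/eqP => E; move: yij; rewrite -E (negbTE xi) (negbTE xj).
  by rewrite mem_cat => /orP[] /mapP[B BL ->] xL; rewrite inE (IH B) ?orbT.
by case/mapP => B BL -> /orP[/eqP ->|xL]; rewrite inE ?eqxx ?(IH B) ?orbT.
Qed.

Lemma substs_touch L A : A \in substs L -> (i \in L) || (j \in L) -> (i \in A) || (j \in A).
Proof.
elim: L A => [|y L IH] A //=; case: ifP => [|/negbT].
  by rewrite mem_cat => _ /orP[] /mapP[B BL ->] _; rewrite !inE eqxx ?orbT.
rewrite !inE negb_or => /andP[yi yj] /mapP[B BL ->].
rewrite !inE (eq_sym i) (eq_sym j) (negbTE yi) (negbTE yj) /= => /(IH _ BL).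
by [].
Qed.

End Collision.

(** * Time derivatives of exponentials *)

Section Derivation.
Variables (T : eqType) (R : realType).

Lemma is_derive_shuffle (f g : R -> seq T -> R) (f' g' : seq T -> R) (t : R) L :
  (forall A, is_derive t 1 (fun u => f u A) (f' A)) ->
  (forall A, is_derive t 1 (fun u => g u A) (g' A)) ->
  is_derive t 1 (fun u => shuffle (f u) (g u) L) (shuffle f' (g t) L + shuffle (f t) g' L).
Proof.
elim: L f g f' g' => [|x L IH] f g f' g' df dg.
  rewrite !shuffle_nil.
  under eq_fun do rewrite shuffle_nil.
  have := is_deriveM (df [::]) (dg [::]).
  by rewrite addrC /GRing.scale /= [g t [::] * _]mulrC.
under eq_fun do rewrite shuffle_cons.
rewrite !shuffle_cons addrACA.
have dd (h : R -> seq T -> R) h' : (forall A, is_derive t 1 (fun u => h u A) (h' A)) ->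
  forall A, is_derive t 1 (fun u => der x (h u) A) (der x h' A) by move=> H A; exact: H.
exact: is_deriveD (IH _ _ _ _ (dd _ _ df) dg) (IH _ _ _ _ df (dd _ _ dg)).
Qed.

Lemma derivable_bigsum (I : Type) (r : seq I) (P : pred I) (F : R -> I -> R) (t : R) :
  (forall i, P i -> derivable (fun u => F u i) t 1) ->
  derivable (fun u => \sum_(i <- r | P i) F u i) t 1.
Proof.
move=> dF; elim: r => [|i r IH].
  by under eq_fun do rewrite big_nil; exact: derivable_cst.
under eq_fun do rewrite big_cons.
case: ifP => // Pi; apply: derivableD => //; exact: dF.
Qed.

Lemma derivable_logm (m : R -> seq T -> R) (t : R) L :
  (forall A, derivable (fun u => m u A) t 1) ->
  derivable (fun u => logm (m u) L) t 1.
Proof.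
move=> dm; have [n] := ubnP (size L); elim: n L => // n IH [|x L] Ln.
  exact: derivable_cst.
under eq_fun do rewrite logm_cons.
apply: derivableB => //.
under eq_fun do rewrite big_seq_cond.
apply: derivable_bigsum => p /andP[pL p2].
apply: derivableM => //; apply: IH.
exact: leq_ltn_trans (splits_size_lt pL p2) _.
Qed.

Lemma is_derive_uniq (f : R -> R) (t a b : R) :
  is_derive t 1 f a -> is_derive t 1 f b -> a = b.
Proof. by move=> [_ <-] [_ <-]. Qed.

(** This is (exp k)' = k' exp k, obtained by differentiating in time the recursion that
    characterises exponentials. The constant term of [k'] must be 0 because [m u [::]] is constantly
    1. *)
Lemma is_exp_derive (k m : R -> seq T -> R) (k' m' : seq T -> R) (t : R) :
  (forall u, is_exp (k u) (m u)) ->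
  (forall A, is_derive t 1 (fun u => m u A) (m' A)) ->
  (forall A, is_derive t 1 (fun u => k u A) (k' A)) -> k' [::] = 0 ->
  m' = shuffle k' (m t).
Proof.
move=> km dm dk k0; apply/funext => L.
have [n] := ubnP (size L); elim: n L => // n IH [|x L] Ln.
  rewrite shuffle_nil k0 mul0r; apply: is_derive_uniq (dm [::]) _.
  by under eq_fun do rewrite (km _).1; exact: is_derive_cst.
have dd A : is_derive t 1 (fun u => der x (k u) A) (der x k' A) by exact: dk.
apply: is_derive_uniq (dm (x :: L)) _.
under eq_fun do rewrite (is_exp_cons _ _ (km _)).
apply: is_derive_eq (is_derive_shuffle _ dd dm) _.
rewrite shuffle_cons; congr (_ + _).
rewrite (eq_shuffle_size (f' := der x (k t)) (g' := shuffle k' (m t))) //; last first.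
  by move=> A AL; apply: IH; exact: leq_ltn_trans AL Ln.
by rewrite (km t).2 !shuffleA (shuffleC (der x _)).
Qed.

End Derivation.

(** * Bounds on partition sums of cumulants *)

Section SumBound.
Variables (R : realType) (I : eqType).

Lemma norm_sum_le (r : seq I) (P : pred I) (F : I -> R) (M : R) : 0 <= M ->
  (forall i, i \in r -> P i -> `|F i| <= M) ->
  `|\sum_(i <- r | P i) F i| <= (size r)%:R * M.
Proof.
move=> M0 FM; apply: le_trans (ler_norm_sum _ _ _) _.
apply: (@le_trans _ _ (\sum_(i <- r) M)).
  rewrite big_mkcond big_seq [leRHS]big_seq; apply: ler_sum => i ir.
  by case: ifP => // Pi; exact: FM.
by rewrite big_const_seq iter_addr_0 count_predT mulr_natl.
Qed.

End SumBound.

Section Distinct.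
Variable T : eqType.
Implicit Types (L A B : seq T) (i j : T).

Definition ndist L := size (undup L).

(* A collision of [i] and [j] affects a block of labels only if the block contains
   [i] or [j], so a block contributes at least [nrest i j] further labels. *)
Definition nrest i j L := ndist [seq x <- L | x \notin [:: i; j]].

Lemma ndist_perm L A : perm_eq L A -> ndist L = ndist A.
Proof. by move/perm_mem/perm_undup/perm_size. Qed.

Lemma ndist_cat A B : (ndist (A ++ B) <= ndist A + ndist B)%N.
Proof.
rewrite -size_cat; apply: uniq_leq_size (undup_uniq _) _ => x.
by rewrite mem_undup !mem_cat !mem_undup.
Qed.

Lemma nrest_cat i j L A B : perm_eq (A ++ B) L ->
  (nrest i j L <= nrest i j A + nrest i j B)%N.
Proof.
move=> p; rewrite /nrest (ndist_perm (A := [seq x <- A ++ B | x \notin [:: i; j]])).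
  by rewrite filter_cat ndist_cat.
by apply: perm_filter; rewrite perm_sym.
Qed.

Lemma nrest_touch i j L A : {subset [seq x <- L | x \notin [:: i; j]] <= A} ->
  (i \in A) || (j \in A) -> (nrest i j L < ndist A)%N.
Proof.
move=> LA ij.
suff [x xA xij] : exists2 x, x \in A & x \in [:: i; j].
  apply: (@uniq_leq_size _ (x :: undup [seq x <- L | x \notin [:: i; j]])).
    by rewrite /= mem_undup mem_filter xij undup_uniq.
  move=> y; rewrite inE !mem_undup => /orP[/eqP -> //|]; exact: LA.
by case/orP: ij => H; [exists i|exists j] => //; rewrite !inE eqxx ?orbT.
Qed.

Lemma nrest_touch2 i j L A : {subset [seq x <- L | x \notin [:: i; j]] <= A} ->
  i != j -> i \in A -> j \in A -> ((nrest i j L).+1 < ndist A)%N.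
Proof.
move=> LA ij iA jA.
apply: (@uniq_leq_size _ (j :: i :: undup [seq x <- L | x \notin [:: i; j]])).
  rewrite /= !inE !mem_undup !mem_filter !inE !eqxx ?orbT /= orbF.
  by rewrite eq_sym ij undup_uniq.
by move=> y; rewrite !inE !mem_undup => /or3P[/eqP -> //|/eqP -> //|]; exact: LA.
Qed.

Lemma ndist_nrest i j L (S : seq T) : {subset [seq x <- L | x \in [:: i; j]] <= S} ->
  (ndist L <= size S + nrest i j L)%N.
Proof.
move=> LS; rewrite (ndist_perm (A := [seq x <- L | x \in [:: i; j]] ++
    [seq x <- L | x \notin [:: i; j]])); last by rewrite perm_sym perm_filterC.
apply: leq_trans (ndist_cat _ _) _; rewrite leq_add2r.
apply: uniq_leq_size (undup_uniq _) _ => x; rewrite mem_undup; exact: LS.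
Qed.

Lemma ndist_nrest1 i j L : j \notin L -> (ndist L <= (nrest i j L).+1)%N.
Proof.
move=> jL; apply: (@ndist_nrest i j L [:: i]) => x.
by rewrite mem_filter !inE => /andP[/orP[|/eqP ->]]; rewrite ?(negbTE jL).
Qed.

Lemma ndist_nrest2 i j L : (ndist L <= (nrest i j L).+2)%N.
Proof.
by apply: (@ndist_nrest i j L [:: i; j]) => x; rewrite mem_filter => /andP[].
Qed.

Lemma ndist_gt0 L : L != [::] -> (0 < ndist L)%N.
Proof.
case: L => // x L _; rewrite /ndist lt0n size_eq0; apply/eqP => E.
by have := mem_undup (x :: L) x; rewrite E inE eqxx.
Qed.

End Distinct.

Section Bounds.
Variables (T : eqType) (R : realType).
Implicit Types (f g h k m : seq T -> R) (x y : T) (L A B : seq T).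

(** Bound for the change of one block under a collision: at most [2 ^+ size A] substituted lists,
    plus the original one that is subtracted. *)
Definition jump_size (a : nat -> R) A : R := (2 ^+ size A + 1) * a (size A).

Lemma expo_ge0 f L : (forall A, 0 <= f A) -> 0 <= expo f L.
Proof.
move=> f0; have [n] := ubnP (size L); elim: n L => // n IH [|x L] Ln.
  exact: ler01.
rewrite expo_cons; rewrite /shuffle big_seq sumr_ge0 // => p pL.
by rewrite mulr_ge0 ?IH //; [exact: f0|exact: leq_ltn_trans (splits_size2 pL) _].
Qed.

(** A weight with [w A * w B <= w L] for every splitting can be pulled out of each product over
    blocks, which leaves the partition sum of [F]. In the second bound the partition into a single
    block is removed on both sides. *)
Lemma expo_bound (D F w : seq T -> R) n :
  (forall A, 0 <= F A) -> (forall A, 0 <= w A) -> w [::] = 1 ->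
  (forall A B L, perm_eq (A ++ B) L -> w A * w B <= w L) ->
  (forall A, (0 < size A <= n)%N -> `|D A| <= F A * w A) ->
  forall L, (size L <= n)%N ->
    `|expo D L| <= expo F L * w L /\
    (L != [::] -> `|expo D L - D L| <= (expo F L - F L) * w L).
Proof.
move=> F0 w0 w1 ww DF L; have [N] := ubnP (size L).
elim: N L => // N IH [|x L] LN Ln.
  by split=> //; rewrite w1 mulr1 normr1.
have Ebound (P : pred (seq T * seq T)) :
    \sum_(p <- splits L | P p) `|D (x :: p.1) * expo D p.2| <=
    (\sum_(p <- splits L | P p) F (x :: p.1) * expo F p.2) * w (x :: L).
  rewrite mulr_suml big_seq_cond [leRHS]big_seq_cond.
  apply: ler_sum => p /andP[pL _]; rewrite normrM.
  have s1 := splits_size1 pL; have s2 := splits_size2 pL.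
  have [IH1 _] := IH p.2 (leq_ltn_trans s2 LN) (leq_trans s2 (ltnW Ln)).
  have D1 : `|D (x :: p.1)| <= F (x :: p.1) * w (x :: p.1).
    by apply: DF => /=; exact: leq_ltn_trans s1 Ln.
  apply: le_trans (ler_pM _ _ D1 IH1) _ => //.
  rewrite mulrACA ler_wpM2l ?mulr_ge0 ?expo_ge0 //.
  by apply: ww; rewrite /= perm_cons splits_perm.
split=> [|_].
  by rewrite !expo_cons; apply: le_trans (ler_norm_sum _ _ _) (Ebound xpredT).
rewrite !expo_cons /shuffle !sum_splits_remainder /= /der !mulr1.
rewrite ![_ + _ - _]addrAC !subrr !add0r.
exact: le_trans (ler_norm_sum _ _ _) (Ebound _).
Qed.

Lemma expo0 (D : seq T -> R) (P : pred T) :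
  (forall A, A != [::] -> all P A -> D A = 0) ->
  forall L, L != [::] -> all P L -> expo D L = 0.
Proof.
move=> D0 [//|x L] _ /= /andP[Px PL]; rewrite expo_cons /shuffle big_seq big1 // => p pL.
rewrite /der D0 ?mul0r //= Px /=; apply/allP => y yp.
by move/allP: PL; apply; rewrite -(perm_mem (splits_perm pL)) mem_cat yp.
Qed.

(** Each occurrence of [i] becomes [i] or [j], so the only substituted list avoiding [j] is the one
    where nothing changes. In [substs_notin1] it is the one where every [i] changes. *)
Lemma substs_notin2 (i j : T) (f : seq T -> R) L : i != j -> j \notin L ->
  \sum_(A <- substs i j L | j \notin A) f A = f L.
Proof.
move=> ij; elim: L f => [|x L IH] f; first by rewrite /= big_cons big_nil /= addr0.
rewrite inE negb_or => /andP[jx jL] /=; rewrite !inE (eq_sym x j) (negbTE jx) orbF.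
have cons_sum y : j != y ->
    \sum_(A <- map (cons y) (substs i j L) | j \notin A) f A = f (y :: L).
  move=> jy; rewrite big_map -[RHS]/(der y f L) -(IH (der y f)) //.
  by apply: eq_bigl => A; rewrite inE (negbTE jy).
case: eqVneq => [->|_]; last exact: cons_sum.
rewrite big_cat /= cons_sum 1?eq_sym // big_map big_pred0 ?addr0 // => A.
by rewrite inE eqxx.
Qed.

Lemma substs_notin1 (i j : T) (f : seq T -> R) L : i != j -> j \notin L ->
  \sum_(A <- substs i j L | i \notin A) f A = f [seq if x == i then j else x | x <- L].
Proof.
move=> ij; elim: L f => [|x L IH] f; first by rewrite /= big_cons big_nil /= addr0.
rewrite inE negb_or => /andP[jx jL] /=; rewrite !inE (eq_sym x j) (negbTE jx) orbF.
have cons_sum y : i != y -> \sum_(A <- map (cons y) (substs i j L) | i \notin A) f A =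
    f (y :: [seq if x == i then j else x | x <- L]).
  move=> iy; rewrite big_map -[RHS]/(der y f _) -(IH (der y f)) //.
  by apply: eq_bigl => A; rewrite inE (negbTE iy).
case: (eqVneq x i) => [_|xi]; last by rewrite cons_sum // eq_sym.
rewrite big_cat /= (cons_sum j) // big_map big_pred0 ?add0r // => A.
by rewrite inE eqxx.
Qed.

Lemma coll_swap (i j : T) (c s : R) f L : i != j -> coll i j c s f L = coll j i s c f L.
Proof.
move=> ij; elim: L f => // x L IH f.
rewrite !coll_cons !inE (orbC (x == j)); case: ifP => // xij; rewrite IH.
congr (_ * _); last by congr coll; apply/funext => A; rewrite /= addrC.
case: (eqVneq x i) => [->|xi]; first by rewrite (negbTE ij).
by move: xij; rewrite (negbTE xi) /= => ->.
Qed.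

Lemma weight1 (i j : T) (c s : R) L : j \notin L ->
  weight i j c s L = c ^+ count_mem i L.
Proof.
elim: L => //= x L IH; rewrite inE negb_or => /andP[jx jL].
rewrite IH // (eq_sym x j) (negbTE jx); case: eqVneq => _; last by rewrite mul1r.
by rewrite exprS.
Qed.

Variables (i j : T) (c s : R) (k : seq T -> R) (a : nat -> R) (q : R) (n : nat).
Hypothesis c01 : 0 <= c <= 1.
Hypothesis s01 : 0 <= s <= 1.
Hypothesis q01 : 0 <= q <= 1.
Hypothesis a0 : forall l, 0 <= a l.
Hypothesis ka : forall A, (0 < size A <= n)%N -> `|k A| <= a (size A) * q ^+ (ndist A).-1.

Lemma weight_itv L : 0 <= weight i j c s L <= 1.
Proof.
elim: L => [|x L IH] /=; first by rewrite ler01 lexx.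
have /andP[w0 w1] := IH.
have /andP[v0 v1] : 0 <= (if x == i then c else if x == j then s else 1) <= 1.
  by do 2 case: ifP => // _; rewrite ler01 lexx.
by rewrite mulr_ge0 //= mulr_ile1.
Qed.

Definition jump A := coll i j c s k A - k A.

Lemma touch_bound L A : (i \in A) || (j \in A) -> (0 < size L <= n)%N ->
  {subset [seq x <- L | x \notin [:: i; j]] <= A} -> size A = size L ->
  `|k A| <= a (size L) * q ^+ nrest i j L.
Proof.
move=> ijA nL sub sAL; have /andP[q0 q1] := q01.
apply: le_trans (ka _) _; first by rewrite sAL.
rewrite sAL ler_wpM2l // ler_wiXn2l //.
by have := nrest_touch sub ijA; case: (ndist A).
Qed.

(** Every list in the jump keeps the labels of [L] other than [i] and [j] and contains [i] or [j],
    so it has more than [nrest i j L] distinct labels. If [L] misses both particles, the jump is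
    0. *)
Lemma jump_bound L : (0 < size L <= n)%N ->
  `|jump L| <= (2 ^+ size L + 1) * a (size L) * q ^+ nrest i j L.
Proof.
move=> nL; have /andP[q0 q1] := q01; rewrite /jump.
have rhs0 : 0 <= (2 ^+ size L + 1) * a (size L) * q ^+ nrest i j L.
  by rewrite !mulr_ge0 ?exprn_ge0 ?addr_ge0 ?exprn_ge0.
case ijL: ((i \in L) || (j \in L)); last first.
  move/negbT: ijL; rewrite negb_or => /andP[iL jL].
  by rewrite coll_id // subrr normr0.
rewrite mulrDl mul1r mulrDl; apply: le_trans (ler_normB _ _) _; apply: lerD; last first.
  by apply: touch_bound => // x; rewrite mem_filter => /andP[].
rewrite /coll normrM; have /andP[w0 w1] := weight_itv L.
rewrite (ger0_norm w0) -[leRHS]mul1r; apply: ler_pM => //.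
apply: le_trans (norm_sum_le (M := a (size L) * q ^+ nrest i j L) _ _) _.
- by rewrite mulr_ge0 ?exprn_ge0.
- move=> A AL _; apply: touch_bound => //; first exact: substs_touch AL ijL.
    move=> x; rewrite mem_filter !inE negb_or => /andP[/andP[xi xj] xL].
    exact: substs_others AL xi xj xL.
  exact: substs_size AL.
rewrite -!mulrA ler_wpM2r ?mulr_ge0 ?exprn_ge0 // size_substs natrX.
by rewrite ler_weXn2l ?ler1n // count_size.
Qed.

(** All substituted lists but two contain both [i] and [j], hence more distinct labels than [L],
    which is worth a further factor [q]. The two exceptions are the terms subtracted. *)
Lemma mixed_bound L : i != j -> i \in L -> j \notin L -> (0 < size L <= n)%N ->
  `|\sum_(A <- substs i j L) k A - k L - k [seq if x == i then j else x | x <- L]| <=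
  2 ^+ size L * a (size L) * q ^+ ndist L.
Proof.
move=> ij iL jL nL; have /andP[q0 q1] := q01.
rewrite (bigID (fun A => j \notin A)) /= substs_notin2 // [k L + _]addrC addrK.
rewrite (bigID (fun A => i \notin A)) /=.
have -> : \sum_(A <- substs i j L | ~~ (j \notin A) && (i \notin A)) k A =
    k [seq if x == i then j else x | x <- L].
  rewrite -(substs_notin1 k ij jL) big_seq_cond [RHS]big_seq_cond; apply: eq_bigl => A.
  apply/andP/andP=> -[AL]; first by case/andP.
  move=> iA; split=> //; rewrite iA andbT negbK.
  by have := substs_touch AL; rewrite iL (negbTE iA) => /(_ isT).
rewrite [_ + \sum_(_ <- _ | _) _]addrC addrK -mulrA.
apply: le_trans (norm_sum_le (M := a (size L) * q ^+ ndist L) _ _) _.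
- by rewrite mulr_ge0 ?exprn_ge0.
- move=> A AL; rewrite !negbK => /andP[jA iA].
  have sA := substs_size AL; rewrite -sA.
  apply: le_trans (ka _) _; first by rewrite sA.
  rewrite ler_wpM2l // ler_wiXn2l //.
  suff : (ndist L < ndist A)%N by case: (ndist A).
  apply: leq_ltn_trans (ndist_nrest1 i jL) _.
  apply: nrest_touch2 => // x; rewrite mem_filter !inE negb_or => /andP[/andP[xi xj] xL].
  exact: substs_others AL xi xj xL.
rewrite ler_wpM2r ?mulr_ge0 ?exprn_ge0 // size_substs natrX.
by rewrite ler_weXn2l ?ler1n // count_size.
Qed.

End Bounds.

(** * Analysis on the real line *)

Section Continuity.
Variables (T : topologicalType) (R : realType).
Implicit Types f g : T -> R.

Lemma continuousX f n : continuous f -> continuous (fun x => f x ^+ n).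
Proof.
move=> cf; elim: n => [|n IH] x; first by under eq_fun do rewrite expr0; exact: cvg_cst.
by under eq_fun do rewrite exprS; apply: cvgM; [exact: cf|exact: IH].
Qed.

Lemma continuous_scale (a : R) f : continuous f -> continuous (fun x => a * f x).
Proof. by move=> cf x; apply: cvgM; [exact: cvg_cst|exact: cf]. Qed.

Lemma continuous_const (a : R) : continuous (fun _ : T => a).
Proof. by move=> x; exact: cvg_cst. Qed.

Lemma continuous_bigsum (I : Type) (r : seq I) (P : pred I) (F : I -> T -> R) :
  (forall i, P i -> continuous (F i)) -> continuous (fun x => \sum_(i <- r | P i) F i x).
Proof.
move=> cF; elim: r => [|i r IH] x; first by under eq_fun do rewrite big_nil; exact: cvg_cst.
under eq_fun do rewrite big_cons.
by case: ifP => Pi; [apply: cvgD; [exact: cF|exact: IH]|exact: IH].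
Qed.

Lemma continuous_bigprod (I : Type) (r : seq I) (F : I -> T -> R) :
  (forall i, continuous (F i)) -> continuous (fun x => \prod_(i <- r) F i x).
Proof.
move=> cF; elim: r => [|i r IH] x; first by under eq_fun do rewrite big_nil; exact: cvg_cst.
under eq_fun do rewrite big_cons.
by apply: cvgM; [exact: cF|exact: IH].
Qed.

Lemma continuous_mul f g :
  continuous f -> continuous g -> continuous (fun x => f x * g x).
Proof. by move=> cf cg x; apply: cvgM; [exact: cf|exact: cg]. Qed.

End Continuity.

(** * A first-contact argument for finite families *)

Section Barrier.
Variables (R : realType) (I : finType).

(* At the first time one of the functions vanishes its derivative would be
   nonpositive. *)
Lemma barrier (w dw : I -> R -> R) :
  (forall i, continuous (w i)) -> (forall i, 0 < w i 0) ->
  (forall i (t : R), 0 < t -> is_derive t 1 (w i) (dw i t)) ->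
  (forall i (t : R), 0 < t -> w i t = 0 -> (forall j, 0 <= w j t) -> 0 < dw i t) ->
  forall i (t : R), 0 <= t -> 0 < w i t.
Proof.
move=> wc w0 wd wpos i0 t1 t10; rewrite ltNge; apply/negP => w1.
pose S := [set t : R | 0 <= t /\ exists i, w i t <= 0].
have S1 : S t1 by split => //; exists i0.
have Sinf : has_inf S by split; [exists t1|exists 0 => t []].
pose T := inf S.
have T0 : 0 <= T by apply: lb_le_inf; [exists t1|move=> t []].
have ST s : 0 <= s < T -> forall i, 0 < w i s.
  move=> /andP[s0 sT] i; rewrite ltNge; apply/negP => wis.
  have : S s by split => //; exists i.
  by move/(ge_inf Sinf.2); rewrite leNgt sT.
have [i wiT] : exists i, w i T <= 0.
  apply: contrapT => H.
  have wT i : 0 < w i T by rewrite ltNge; apply/negP => wi; apply: H; exists i.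
  have : \forall s \near T, forall i, 0 < w i s.
    have Hn i : \forall s \near T, 0 < w i s by exact: (cvgr_gt (w i T) (wc i T)).
    exact: (@filter_forall _ _ _ (nbhs T) _ Hn).
  case/nbhs_ballP => e /= e0 He.
  have [s [s0 [i wis]] sTe] := inf_adherent e0 Sinf.
  have Ts : T <= s by apply: (ge_inf Sinf.2); split => //; exists i.
  have : 0 < w i s.
    by apply: He; rewrite /ball /= distrC ger0_norm ?subr_ge0 // ltrBlDl.
  by rewrite ltNge wis.
have Tp : 0 < T.
  rewrite lt_neqAle T0 andbT; apply/eqP => T00.
  by move: wiT; rewrite -T00 leNgt w0.
have wjT j : 0 <= w j T.
  rewrite leNgt; apply/negP => wj.
  have : \forall s \near T, w j s < 0 by exact: (cvgr_lt (w j T) (wc j T)).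
  case/nbhs_ballP => e /= e0 He.
  pose h := Num.min (e / 2) (T / 2).
  have h0 : 0 < h by rewrite lt_min !divr_gt0.
  have hT : h <= T / 2 by rewrite ge_min lexx orbT.
  have he : h <= e / 2 by rewrite ge_min lexx.
  have : w j (T - h) < 0 by apply: He; rewrite /ball /= opprB addrC subrK gtr0_norm //; lra.
  have /(_ j) : forall i, 0 < w i (T - h) by apply: ST; lra.
  by move=> /ltW; rewrite leNgt => /negP.
have wT0 : w i T = 0 by apply/eqP; rewrite eq_le wiT wjT.
have dpos := wpos i T Tp wT0 wjT.
have [/= dT vT] := wd i T Tp.
have : (h^-1 *: (w i (h *: 1 + T) - w i T)) @[h --> 0^'] --> dw i T.
  by rewrite -vT; exact: dT.
move=> /cvgr_gt/(_ _ dpos); rewrite near_withinE => /nbhs_ballP[e /= e0 He].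
pose h := Num.min (e / 2) (T / 2).
have h0 : 0 < h by rewrite lt_min !divr_gt0.
have hT : h <= T / 2 by rewrite ge_min lexx orbT.
have he : h <= e / 2 by rewrite ge_min lexx.
have /(_ i) wp : forall i, 0 < w i (- h + T) by apply: ST; lra.
(* Looking backwards, [w i] is positive at [T - h] and zero at [T], so this quotient is in fact
   negative. *)
have : 0 < (- h)^-1 *: (w i ((- h) *: 1 + T) - w i T).
  apply: He; first by rewrite /ball /= sub0r opprK gtr0_norm //; lra.
  by rewrite oppr_eq0 gt_eqF.
rewrite wT0 subr0 /GRing.scale /= mulr1 nmulr_rgt0 ?invr_lt0 ?oppr_lt0 //.
by move=> /ltW; rewrite leNgt wp.
Qed.

End Barrier.

(** * Angular averages *)

Section AngularMean.
Variable R : realType.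
Notation mu := (@lebesgue_measure R).
Implicit Types f g : R -> R.

(** The normalising constant stands inside the integral, as in [kac_Q]. *)
Definition angmean f : R :=
  \int[mu]_(theta in `[- pi, pi]) ((2 * pi)^-1 * f theta).

Lemma continuous_integrable_itv f (a b : R) : continuous f ->
  mu.-integrable `[a, b] (EFin \o f).
Proof.
move=> cf; apply: continuous_compact_integrable; first exact: segment_compact.
exact: continuous_subspaceT.
Qed.

Lemma Rintegral_shift f (a b h : R) : a <= b -> continuous f ->
  \int[mu]_(x in `[a + h, b + h]) f x = \int[mu]_(x in `[a, b]) f (x + h).
Proof.
move=> ab cf; congr fine.
have dF (x : R) : is_derive x 1 (fun x : R => x + h) 1.
  apply: is_derive_eq (is_deriveD (is_derive_id x 1) (is_derive_cst h x 1)) _.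
  by rewrite addr0.
have F' : derive1 (fun x : R => x + h) = cst 1.
  by apply/funext => x; rewrite derive1E derive_val.
rewrite (@integration_by_substitution_increasing R (fun x => x + h) f a b ab).
- by apply: eq_integral => x _; rewrite F' /= mulr1.
- by move=> x y _ _; rewrite ltrD2r.
- by rewrite F' => x _; exact: cvg_cst.
- by rewrite F'; exact: is_cvg_cst.
- by rewrite F'; exact: is_cvg_cst.
- split => [x _||]; first exact: ex_derive.
  + by apply: cvg_at_right_filter; apply: cvgD; [exact: cvg_id|exact: cvg_cst].
  + by apply: cvg_at_left_filter; apply: cvgD; [exact: cvg_id|exact: cvg_cst].
- exact: continuous_subspaceT.
Qed.

Lemma Rintegral_split f (a b c : R) : a <= b <= c -> continuous f ->
  \int[mu]_(x in `[a, c]) f x = \int[mu]_(x in `[a, b]) f x + \int[mu]_(x in `[b, c]) f x.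
Proof.
move=> /andP[ab bc] cf.
have := @Rintegral_itvB R f (BLeft a) (BRight c) b (continuous_integrable_itv a c cf).
rewrite !bnd_simp ab bc => /(_ isT isT) /eqP; rewrite subr_eq addrC => /eqP ->.
congr (_ + _); apply: Rintegral_itv_obnd_cbnd.
apply: integrableS (continuous_integrable_itv b c cf) => //.
exact: subset_itv_oc_cc.
Qed.

(** Split the integral over [[- pi, pi + h]] once at [- pi + h] and once at [pi]; the two end pieces
    agree by periodicity and cancel. *)
Lemma angmean_shift f (h : R) : 0 <= h <= 2 * pi -> continuous f ->
  (forall x, f (x + 2 * pi) = f x) -> angmean (fun x => f (x + h)) = angmean f.
Proof.
move=> /andP[h0 h2] cf per; have p0 := pi_gt0 R.
rewrite /angmean.
have c2 : continuous (fun x => (2 * pi)^-1 * f x).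
  by move=> x; apply: cvgM; [exact: cvg_cst|exact: cf].
set g := fun x => (2 * pi)^-1 * f x.
rewrite -[LHS](@Rintegral_shift g (- pi) pi h) //; last by lra.
have E1 := @Rintegral_split g (- pi) (- pi + h) (pi + h) _ c2.
have E2 := @Rintegral_split g (- pi) pi (pi + h) _ c2.
have E3 : \int[mu]_(x in `[pi, pi + h]) g x = \int[mu]_(x in `[- pi, - pi + h]) g x.
  have -> : `[pi, pi + h] = `[- pi + 2 * pi, - pi + h + 2 * pi]%R :> interval R.
    by congr Interval; congr BSide; lra.
  rewrite Rintegral_shift //; last by lra.
  by apply: eq_Rintegral => x _; rewrite /g per.
rewrite E3 in E2.
have : \int[mu]_(x in `[- pi, - pi + h]) g x + \int[mu]_(x in `[- pi + h, pi + h]) g x =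
  \int[mu]_(x in `[- pi, pi]) g x + \int[mu]_(x in `[- pi, - pi + h]) g x.
  by rewrite -E1 ?E2 //; lra.
by move=> /eqP; rewrite [X in _ == X]addrC => /eqP /addrI ->.
Qed.

Lemma angmeanD f g : continuous f -> continuous g ->
  angmean (fun x => f x + g x) = angmean f + angmean g.
Proof.
move=> cf cg; rewrite /angmean -RintegralD //.
- by apply: eq_Rintegral => x _; rewrite mulrDr.
- by apply: continuous_integrable_itv => x; apply: cvgM; [exact: cvg_cst|exact: cf].
- by apply: continuous_integrable_itv => x; apply: cvgM; [exact: cvg_cst|exact: cg].
Qed.

Lemma angmeanZ (a : R) f : continuous f ->
  angmean (fun x => a * f x) = a * angmean f.
Proof.
move=> cf; rewrite /angmean -RintegralZl //.
- by apply: eq_Rintegral => x _; rewrite mulrCA.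
- by apply: continuous_integrable_itv => x; apply: cvgM; [exact: cvg_cst|exact: cf].
Qed.

Lemma angmean_cst (a : R) : angmean (fun=> a) = a.
Proof.
have p0 := pi_gt0 R.
rewrite /angmean Rintegral_cst //.
rewrite [X in fine X](_ : _ = (pi - - pi)%:E); last first.
  by rewrite [LHS](lebesgue_measure_itv `[- pi, pi]) /= lte_fin ifT //; lra.
rewrite /= opprK; move: (@pi R) p0 => p p0; field; exact: lt0r_neq0.
Qed.

Lemma angmean_sum (I : Type) (r : seq I) (P : pred I) (F : I -> R -> R) :
  (forall i, continuous (F i)) ->
  angmean (fun x => \sum_(i <- r | P i) F i x) = \sum_(i <- r | P i) angmean (F i).
Proof.
move=> cF; have cS s : continuous (fun x => \sum_(i <- s | P i) F i x).
  elim: s => [|i s IH] x; first by under eq_fun do rewrite big_nil; exact: cvg_cst.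
  under eq_fun do rewrite big_cons.
  by case: ifP => _; [apply: cvgD; [exact: cF|exact: IH]|exact: IH].
elim: r => [|i r IH].
  by under eq_fun do rewrite big_nil; rewrite angmean_cst big_nil.
under eq_fun do rewrite big_cons.
rewrite big_cons; case: ifP => Pi //.
by rewrite angmeanD // IH.
Qed.

Lemma angmean_le f g : continuous f -> continuous g -> (forall x, f x <= g x) ->
  angmean f <= angmean g.
Proof.
move=> cf cg fg; apply: le_Rintegral => //.
- by apply: continuous_integrable_itv => x; apply: cvgM; [exact: cvg_cst|exact: cf].
- by apply: continuous_integrable_itv => x; apply: cvgM; [exact: cvg_cst|exact: cg].
- by move=> x _; rewrite ler_wpM2l // invr_ge0 mulr_ge0 // pi_ge0.
Qed.

Lemma angmean_bound f (M : R) : continuous f -> (forall x, `|f x| <= M) ->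
  `|angmean f| <= M.
Proof.
move=> cf fM; rewrite ler_norml; apply/andP; split.
  rewrite -(angmean_cst (- M)); apply: angmean_le => // [x|x]; first exact: cvg_cst.
  by have := fM x; rewrite ler_norml => /andP[].
rewrite -[leRHS](angmean_cst M); apply: angmean_le => // [x|x]; first exact: cvg_cst.
by have := fM x; rewrite ler_norml => /andP[].
Qed.

End AngularMean.

Section AngularWeights.
Variable R : realType.

Lemma cos_add2pi (x : R) : cos (x + 2 * pi) = cos x.
Proof. by rewrite mulr_natl cosD2pi. Qed.

Lemma sin_add2pi (x : R) : sin (x + 2 * pi) = sin x.
Proof. by rewrite mulr_natl sinD2pi. Qed.

Lemma cos2_itv (x : R) : 0 <= cos x ^+ 2 <= 1.
Proof. by rewrite sqr_ge0 cos2sin2 lerBlDr lerDl sqr_ge0. Qed.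

Lemma sin2_itv (x : R) : 0 <= sin x ^+ 2 <= 1.
Proof. by rewrite sqr_ge0 sin2cos2 lerBlDr lerDl sqr_ge0. Qed.

Lemma angmean_anti (f : R -> R) (h : R) : 0 <= h <= 2 * pi -> continuous f ->
  (forall x, f (x + 2 * pi) = f x) -> (forall x, f (x + h) = - f x) -> angmean f = 0.
Proof.
move=> hh cf per anti; have := angmean_shift hh cf per.
under [in LHS]eq_fun do rewrite anti -mulN1r.
by rewrite angmeanZ // mulN1r => H; lra.
Qed.

Definition wmean n : R := angmean (fun x : R => (cos x ^+ 2) ^+ n).

Let ccos2 n : continuous (fun x : R => (cos x ^+ 2) ^+ n).
Proof. by apply: continuousX; apply: continuousX; exact: continuous_cos. Qed.

Let ccos1 : continuous (fun x : R => cos x ^+ 2).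
Proof. by apply: continuousX; exact: continuous_cos. Qed.

Lemma angmean_sin n : angmean (fun x : R => (sin x ^+ 2) ^+ n) = wmean n.
Proof.
have p0 := pi_gt0 R.
rewrite /wmean -(@angmean_shift R (fun x => (sin x ^+ 2) ^+ n) (pi / 2)).
- by congr angmean; apply/funext => x; rewrite sinDpihalf.
- by lra.
- by apply: continuousX; apply: continuousX; exact: continuous_sin.
- by move=> x; rewrite sin_add2pi.
Qed.

Lemma angmean_cos2x : angmean (fun x : R => 2 * cos x ^+ 2 - 1) = 0.
Proof.
have p0 := pi_gt0 R.
apply: (@angmean_anti _ (pi / 2)); first by lra.
- move=> x; apply: cvgB; last exact: cvg_cst.
  by apply: cvgM; [exact: cvg_cst|exact: ccos1].
- by move=> x; rewrite cos_add2pi.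
- by move=> x; rewrite cosDpihalf sqrrN sin2cos2; lra.
Qed.

Lemma wmean1 : wmean 1 = 1 / 2.
Proof.
have -> : wmean 1 = angmean (fun x : R => (1 / 2) * (2 * cos x ^+ 2 - 1) + 1 / 2).
  by congr angmean; apply/funext => x; rewrite expr1; lra.
have cc : continuous (fun x : R => 2 * cos x ^+ 2 - 1).
  move=> x; apply: cvgB; last exact: cvg_cst.
  by apply: cvgM; [exact: cvg_cst|exact: ccos1].
rewrite angmeanD ?(angmean_cst (1 / 2)) ?(angmeanZ _ cc) ?angmean_cos2x ?mulr0 ?add0r //.
  exact: continuous_scale.
exact: continuous_const.
Qed.

Lemma wmean2 : wmean 2 = 3 / 8.
Proof.
have p0 := pi_gt0 R.
(* [f2] is cos 2x and [f4] is cos 4x, written as polynomials in cos x so that continuity and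
   periodicity are immediate. Then cos^4 x = f4/8 + f2/2 + 3/8, and both cosines have mean 0. *)
pose f2 := fun x : R => 2 * cos x ^+ 2 - 1.
pose f4 := fun x : R => 2 * (f2 x) ^+ 2 - 1.
have c2 : continuous f2.
  move=> x; apply: cvgB; last exact: cvg_cst.
  by apply: cvgM; [exact: cvg_cst|exact: ccos1].
have c4 : continuous f4.
  move=> x; apply: cvgB; last exact: cvg_cst.
  by apply: (@continuous_scale R R 2 (fun x => f2 x ^+ 2)); exact: continuousX.
have f4E x : f4 x = cos (x *+ 4).
  by rewrite (mulrnA x 2 2) !cos_mulr2n /f4 /f2 !mulr_natl.
have m4 : angmean f4 = 0.
  apply: (@angmean_anti _ (pi / 4)); [by lra|by []|by move=> x; rewrite /f4 /f2 cos_add2pi|].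
  by move=> x; rewrite !f4E mulrnDl -[_ / _ *+ 4]mulr_natr divfK ?pnatr_eq0 // cosDpi.
have -> : wmean 2 = angmean (fun x : R => ((1 / 8) * f4 x + (1 / 2) * f2 x) + 3 / 8).
  by congr angmean; apply/funext => x; rewrite /f4 /f2; field.
have c24 : continuous (fun x : R => (1 / 8) * f4 x + (1 / 2) * f2 x).
  by move=> x; apply: cvgD; exact: continuous_scale.
rewrite angmeanD ?(angmean_cst (3 / 8)) //; last exact: continuous_const.
rewrite angmeanD; [|exact: continuous_scale|exact: continuous_scale].
by rewrite (angmeanZ _ c4) (angmeanZ _ c2) m4 angmean_cos2x !mulr0 !add0r.
Qed.

Lemma wmean_le n : (2 <= n)%N -> wmean n <= 3 / 8.
Proof.
move=> n2; rewrite -wmean2; apply: angmean_le => // x.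
apply: ler_wiXn2l => //; first exact: sqr_ge0.
Qed.

Lemma polar (a b : R) : exists h : R, [/\ 0 <= h <= 2 * pi,
  a = Num.sqrt (a ^+ 2 + b ^+ 2) * cos h & b = Num.sqrt (a ^+ 2 + b ^+ 2) * sin h].
Proof.
have p0 := pi_gt0 R; set r := Num.sqrt _.
have r2 : r ^+ 2 = a ^+ 2 + b ^+ 2 by rewrite sqr_sqrtr // addr_ge0 ?sqr_ge0.
have r0 : 0 <= r by exact: sqrtr_ge0.
case: (eqVneq r 0) => [rz|rn].
  have : a ^+ 2 + b ^+ 2 == 0 by rewrite -r2 rz expr0n.
  rewrite paddr_eq0 ?sqr_ge0 // !sqrf_eq0 => /andP[/eqP a0 /eqP b0].
  by exists 0; rewrite rz !mul0r; split => //; lra.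
have rp : 0 < r by rewrite lt_neqAle eq_sym rn.
have ab : (a / r) ^+ 2 + (b / r) ^+ 2 = 1.
  by rewrite !expr_div_n -mulrDl -r2 divff // expf_neq0.
have i1 : -1 <= a / r <= 1.
  rewrite -ler_norml -(@ler_pXn2r _ 2) ?nnegrE // expr1n real_normK ?num_real //.
  by rewrite -ab lerDl sqr_ge0.
have ca : cos (acos (a / r)) = a / r by apply: acosK; rewrite in_itv.
have sa : sin (acos (a / r)) = `|b / r|.
  by rewrite sin_acos // -ab addrAC subrr add0r sqrtr_sqr.
have h0 := acos_ge0 i1; have h1 := acos_lepi i1.
(* [acos] covers only the upper half circle; for negative [b] the angle is reflected. *)
case: (lerP 0 b) => b0.
  exists (acos (a / r)); split; first by lra.
    by rewrite ca mulrC divfK.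
  by rewrite sa ger0_norm ?divr_ge0 // mulrC divfK.
exists (2 * pi - acos (a / r)); split; first by lra.
  by rewrite addrC cos_add2pi cosN ca mulrC divfK.
rewrite addrC sin_add2pi sinN sa normrM (ltr0_norm b0) gtr0_norm ?invr_gt0 //.
by rewrite mulNr opprK mulrC divfK.
Qed.

(** If [(a, b)] has polar angle [h], the rotated pair is [r cos (t - h)] and [- r sin (t - h)].
    Averaging over [t] forgets [h], so only the total energy of the pair survives; this closes the
    dynamics on energies. *)
Lemma angmean_rot (Phi : R -> R -> R) (a b : R) :
  let r := Num.sqrt (a ^+ 2 + b ^+ 2) in
  continuous (fun t => Phi (r * cos t) (- r * sin t)) ->
  angmean (fun t => Phi (cos t * a + sin t * b) (- sin t * a + cos t * b)) =
  angmean (fun t => Phi (r * cos t) (- r * sin t)).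
Proof.
move=> r cPhi; have p0 := pi_gt0 R.
have [h [hh]] := polar a b; rewrite -/r => aE bE.
rewrite -(@angmean_shift _ (fun t => Phi (r * cos t) (- r * sin t)) (2 * pi - h)) //.
- congr angmean; apply/funext => t.
  rewrite (_ : t + (2 * pi - h) = (t - h) + 2 * pi); last by ring.
  by rewrite cos_add2pi sin_add2pi cosB sinB aE bE; congr Phi; ring.
- by lra.
- by move=> x; rewrite cos_add2pi sin_add2pi.
Qed.

End AngularWeights.

(** * The cumulant hierarchy *)

Section EnergyMonomials.
Variables (R : realType) (N : nat).
Implicit Types (v : 'rV[R]_N) (L : seq 'I_N) (i j : 'I_N) (f g : seq 'I_N -> R).

Definition emon v L : R := \prod_(l <- L) v 0 l ^+ 2.

Definition collision i j (theta : R) f L : R :=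
  coll i j (cos theta ^+ 2) (sin theta ^+ 2) f L.

(** The action of [kac_generator] on energy monomials: the jump rate [N] cancels the factor [N] in
    the normalisation of [kac_Q]. *)
Definition energy_gen f L : R :=
  (N%:R - 1)^-1 * \sum_(i < N) \sum_(j < N | i != j)
    (angmean (fun theta => collision i j theta f L) - f L).

Definition mean_weight i j L : R :=
  angmean (fun theta : R => weight i j (cos theta ^+ 2) (sin theta ^+ 2) L).

Lemma continuous_weight i j L :
  continuous (fun theta : R => weight i j (cos theta ^+ 2) (sin theta ^+ 2) L).
Proof.
elim: L => [|x L IH] /=; first exact: continuous_const.
move=> t; apply: cvgM; last exact: IH.
case: ifP => _; first by apply: (continuousX (n := 2) (@continuous_cos R)).
case: ifP => _; first by apply: (continuousX (n := 2) (@continuous_sin R)).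
exact: cvg_cst.
Qed.

Lemma continuous_collision i j f L : continuous (fun theta => collision i j theta f L).
Proof.
rewrite /collision /coll => t; apply: cvgM; last exact: cvg_cst.
exact: continuous_weight.
Qed.

Lemma angmean_collision i j f L :
  angmean (fun theta => collision i j theta f L) =
  mean_weight i j L * \sum_(A <- substs i j L) f A.
Proof.
rewrite mulrC -angmeanZ; last exact: continuous_weight.
by congr angmean; apply/funext => t; rewrite mulrC.
Qed.

Lemma coll_emon i j (c s : R) v L : coll i j c s (emon v) L =
  \prod_(l <- L) (if l == i then c * (v 0 i ^+ 2 + v 0 j ^+ 2)
                  else if l == j then s * (v 0 i ^+ 2 + v 0 j ^+ 2) else v 0 l ^+ 2).
Proof.
have collZ (a : R) f A : coll i j c s (fun B => a * f B) A = a * coll i j c s f A.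
  by rewrite /coll -mulr_sumr mulrCA.
elim: L => [|x L IH]; first by rewrite /coll /= big_seq1 mul1r /emon !big_nil.
rewrite big_cons -IH coll_cons !inE.
have dE y : der y (emon v) = (fun A => v 0 y ^+ 2 * emon v A).
  by apply/funext => A; rewrite /der /emon big_cons.
have sumE : der i (emon v) \+ der j (emon v) =
    (fun A => (v 0 i ^+ 2 + v 0 j ^+ 2) * emon v A).
  by apply/funext => A; rewrite !dE /= mulrDl.
rewrite sumE dE !collZ.
case: (eqVneq x i) => _ /=; first by rewrite mulrA.
by case: (eqVneq x j) => _ /=; rewrite ?mulrA.
Qed.

(** Only the means agree: at a fixed angle the rotated energies also involve the cross term
    [v 0 i * v 0 j], which [angmean_rot] removes. *)
Lemma angmean_emon_rotation i j v L : i != j ->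
  angmean (fun theta => emon (rotation i j theta v) L) =
  angmean (fun theta => collision i j theta (emon v) L).
Proof.
move=> ij; have ji : j != i by rewrite eq_sym.
pose Phi (a b : R) := \prod_(l <- L) (if l == i then a ^+ 2
                  else if l == j then b ^+ 2 else v 0 l ^+ 2).
transitivity (angmean (fun t => Phi (cos t * v 0 i + sin t * v 0 j)
                                    (- sin t * v 0 i + cos t * v 0 j))).
  congr angmean; apply/funext => t; apply: eq_bigr => l _; rewrite mxE.
  by case: (eqVneq l i) => // _; case: (eqVneq l j).
rewrite angmean_rot.
  congr angmean; apply/funext => t; rewrite /collision coll_emon.
  apply: eq_bigr => l _.
  rewrite !exprMn sqrrN sqr_sqrtr ?addr_ge0 ?sqr_ge0 //.
  by case: ifP => _; [rewrite mulrC|case: ifP => // _; rewrite mulrC].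
apply: continuous_bigprod => l.
case: (l == i); last case: (l == j).
- apply: continuousX; apply: continuous_scale; exact: continuous_cos.
- apply: continuousX; apply: continuous_scale; exact: continuous_sin.
- exact: continuous_const.
Qed.

Lemma sum_pairs_const (a : R) :
  \sum_(i < N) \sum_(j < N | i != j) a = N%:R * (N%:R - 1) * a.
Proof.
case: N => [|n]; first by rewrite big_ord0 !mul0r.
transitivity (\sum_(i < n.+1) n%:R * a).
  apply: eq_bigr => i _; rewrite sumr_const mulr_natl; congr (_ *+ _).
  transitivity #|predC1 i|; first by apply: eq_card => j; rewrite !inE eq_sym.
  by rewrite cardC1 card_ord.
by rewrite sumr_const card_ord -[LHS]mulr_natl mulrA -[in X in _ = _ * X * _]natr1 addrK.
Qed.

Lemma kac_generator_emon v L : (1 < N)%N ->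
  kac_generator (fun w => emon w L) v = energy_gen (emon v) L.
Proof.
move=> N1; rewrite /kac_generator /kac_Q /energy_gen.
have N0 : N%:R != 0 :> R by rewrite pnatr_eq0 -lt0n (ltn_trans _ N1).
have N10 : N%:R - 1 != 0 :> R by rewrite subr_eq0 pnatr_eq1; case: eqP N1 => // ->.
transitivity ((N%:R - 1)^-1 * (\sum_(i < N) \sum_(j < N | i != j)
    angmean (fun theta => collision i j theta (emon v) L)
    - \sum_(i < N) \sum_(j < N | i != j) emon v L)); last first.
  by rewrite -sumrB; congr (_ * _); apply: eq_bigr => i _; rewrite -sumrB.
rewrite sum_pairs_const (eq_bigr (fun i => \sum_(j < N | i != j)
    angmean (fun theta => collision i j theta (emon v) L))); last first.
  by move=> i _; apply: eq_bigr => j ij; rewrite -angmean_emon_rotation.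
move: (\sum_(i < N) _) => S; move: (emon v L) => e.
by field; rewrite N0 N10.
Qed.

Lemma energy_genE f L : energy_gen f L =
  (N%:R - 1)^-1 * \sum_(i < N) \sum_(j < N | i != j)
    (mean_weight i j L * \sum_(A <- substs i j L) f A - f L).
Proof.
congr (_ * _); apply: eq_bigr => i _; apply: eq_bigr => j _.
by rewrite angmean_collision.
Qed.

Lemma mean_weight_itv i j L : 0 <= mean_weight i j L <= 1.
Proof.
have w01 (t : R) : 0 <= weight i j (cos t ^+ 2) (sin t ^+ 2) L <= 1.
  by apply: weight_itv; [exact: cos2_itv|exact: sin2_itv].
apply/andP; split.
  rewrite -(angmean_cst 0); apply: angmean_le; first exact: continuous_const.
    exact: continuous_weight.
  by move=> t; case/andP: (w01 t).
rewrite -[leRHS](angmean_cst 1); apply: angmean_le; first exact: continuous_weight.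
  exact: continuous_const.
by move=> t; case/andP: (w01 t).
Qed.

End EnergyMonomials.

Section CumulantGenerator.
Variables (R : realType) (N : nat).
Implicit Types (L A : seq 'I_N) (i j : 'I_N) (f g k m : seq 'I_N -> R).

Definition angle_jump i j (k : seq 'I_N -> R) (theta : R) : seq 'I_N -> R :=
  jump i j (cos theta ^+ 2) (sin theta ^+ 2) k.

(* If the moments [m] evolve by [energy_gen], then their cumulants evolve by
   [cumulant_gen]: this is [d/dt K = exp(-K) d/dt exp K] coefficientwise. *)
Definition cumulant_gen k L : R :=
  (N%:R - 1)^-1 * \sum_(i < N) \sum_(j < N | i != j)
    (angmean (fun theta => expo (angle_jump i j k theta) L) - sone R L).

Lemma continuous_angle_jump i j k L : continuous (fun theta => angle_jump i j k theta L).
Proof.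
by move=> t; apply: cvgB; [exact: continuous_collision|exact: cvg_cst].
Qed.

Lemma continuous_expo (D : R -> seq 'I_N -> R) :
  (forall A, continuous (fun t => D t A)) -> forall L, continuous (fun t => expo (D t) L).
Proof.
move=> cD L; have [n] := ubnP (size L); elim: n L => // n IH [|x L] Ln.
  exact: continuous_const.
under eq_fun do rewrite expo_cons /shuffle big_seq_cond.
apply: (@continuous_bigsum R R) => p; rewrite andbT => pL t.
apply: cvgM; first exact: cD.
by apply: IH; exact: leq_ltn_trans (splits_size2 pL) _.
Qed.

(** At each angle [coll_ratio] writes the collided moments as a multiple of [m]; the mean over
    angles and the sum over pairs are linear. *)
Lemma cumulant_gen_shuffle k m : is_exp k m -> shuffle (cumulant_gen k) m = energy_gen m.
Proof.
move=> km; apply/funext => L.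
rewrite /cumulant_gen shuffleZl /energy_gen; congr (_ * _).
rewrite shuffle_suml; apply: eq_bigr => i _; rewrite shuffle_suml; apply: eq_bigr => j _.
have cE A : continuous (fun t => expo (angle_jump i j k t) A).
  by apply: continuous_expo => B; exact: continuous_angle_jump.
transitivity (shuffle (fun A => angmean (fun t => expo (angle_jump i j k t) A)) m L
   - shuffle (sone R) m L).
  by rewrite /shuffle -sumrB; apply: eq_bigr => p _; rewrite mulrBl.
rewrite shuffle1f; congr (_ - _).
transitivity (angmean (fun t => \sum_(p <- splits L) m p.2 * expo (angle_jump i j k t) p.1)).
  rewrite angmean_sum; last by move=> p; exact: continuous_scale.
  by apply: eq_bigr => p _; rewrite angmeanZ // mulrC.
congr angmean; apply/funext => t; rewrite /collision (coll_ratio _ _ _ _ km).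
by apply: eq_bigr => p _; rewrite mulrC.
Qed.

(** By [is_exp_derive] and [cumulant_gen_shuffle] the time derivative of the cumulants and
    [cumulant_gen] have the same product with [m t], and a series with constant term 1 cancels. *)
Lemma cumulant_derive (m : R -> seq 'I_N -> R) (t : R) :
  (forall u, m u [::] = 1) ->
  (forall A, is_derive t 1 (fun u => m u A) (energy_gen (m t) A)) ->
  forall L, L != [::] ->
    is_derive t 1 (fun u => logm (m u) L) (cumulant_gen (logm (m t)) L).
Proof.
move=> m1 dm L L0.
have km u : is_exp (logm (m u)) (m u) by exact: logmP.
pose k' := fun A => 'D_1 (fun u => logm (m u) A) t.
have dk A : is_derive t 1 (fun u => logm (m u) A) (k' A).
  by apply: DeriveDef => //; apply: derivable_logm => B; exact: ex_derive.
have k0 : k' [::] = 0 by rewrite /k' derive_cst.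
have := is_exp_derive km dm dk k0; rewrite -(cumulant_gen_shuffle (km t)).
move/(shuffle_cancel (m1 t)) => ->; exact: dk.
Qed.

End CumulantGenerator.

(** * Drift of a single cumulant *)

Section Drift.
Variables (R : realType) (N n : nat) (k : seq 'I_N -> R) (a : nat -> R) (q : R).
Variable L : seq 'I_N.
Implicit Types (A : seq 'I_N) (i j : 'I_N).
Hypothesis N2 : (1 < N)%N.
Hypothesis q01 : 0 < q <= 1.
Hypothesis a0 : forall l, 0 <= a l.
Hypothesis ka : forall A, (0 < size A <= n)%N -> `|k A| <= a (size A) * q ^+ (ndist A).-1.
Hypothesis ksym : forall i j, i \in L -> j \notin L ->
  k [seq if x == i then j else x | x <- L] = k L.
Hypothesis Ln : size L = n.
Hypothesis L0 : L != [::].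


Notation jump_size := (jump_size a).
(** The partitions of [L] into at least two blocks, which account for the products of lower order
    cumulants in the drift. *)
Definition jump_rest : R := expo jump_size L - jump_size L.

Let q0 : 0 <= q. Proof. by case/andP: q01 => /ltW. Qed.
Let q1 : q <= 1. Proof. by case/andP: q01. Qed.
Let q01' : 0 <= q <= 1. Proof. by rewrite q0 q1. Qed.
Let js0 A : 0 <= jump_size A.
Proof. by rewrite mulr_ge0 // addr_ge0 // exprn_ge0. Qed.
Let nL : (0 < size L <= n)%N.
Proof. by rewrite Ln leqnn andbT -Ln lt0n size_eq0. Qed.

Lemma expo_jump_bound i j (c s : R) : 0 <= c <= 1 -> 0 <= s <= 1 ->
  `|expo (jump i j c s k) L| <= expo jump_size L * q ^+ nrest i j L /\
  `|expo (jump i j c s k) L - jump i j c s k L| <= jump_rest * q ^+ nrest i j L.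
Proof.
move=> c01 s01.
have [] := @expo_bound _ R (jump i j c s k) jump_size (fun A => q ^+ nrest i j A) n _ _ _ _ _ L.
- exact: js0.
- by move=> A; rewrite exprn_ge0.
- by rewrite /nrest.
- by move=> A B M AB; rewrite -exprD ler_wiXn2l // nrest_cat.
- by move=> A An; apply: (jump_bound i j c01 s01 q01' a0 ka An).
- by rewrite Ln.
- by move=> H1 /(_ L0) H2.
Qed.

Let rest0 : 0 <= jump_rest.
Proof.
have [i _] : exists i, i \in L.
  by case: L L0 => // i M _; exists i; rewrite inE eqxx.
(* Nonnegativity is read off the bound just proved, for an arbitrary label and zero weights. *)
have z01 : (0 : R) <= 0 <= (1 : R) by rewrite lexx ler01.
have [_] := expo_jump_bound i i z01 z01.
move=> /(le_trans (normr_ge0 _)); rewrite pmulr_lge0 // exprn_gt0 //.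
by case/andP: q01.
Qed.

(** Collision of [i] in [L] with a fresh [j]. The two unmixed lists have equal cumulants by [ksym],
    so with [w] the mean weight they leave [w * (k L + k L) - k L] as main term. The weights [c] and
    [s] stay general so that exchanging cos and sin covers the pair in the opposite order. *)
Lemma pair_bound1 i j (c s : R -> R) : continuous c -> continuous s ->
  (forall t, 0 <= c t <= 1) -> (forall t, 0 <= s t <= 1) ->
  (forall l, angmean (fun t => c t ^+ l) = wmean R l) -> i \in L -> j \notin L ->
  `|angmean (fun t => expo (jump i j (c t) (s t) k) L)
    - (2 * wmean R (count_mem i L) - 1) * k L| <=
  (2 ^+ n * a n * q + jump_rest) * q ^+ (ndist L).-1.
Proof.
move=> cc cs c01 s01 cw iL jL.
have ij : i != j by apply: contraNneq jL => <-.
have cw' A : continuous (fun t => weight i j (c t) (s t) A).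
  elim: A => [|x A IH] /=; first exact: continuous_const.
  move=> t; apply: cvgM; last exact: IH.
  by case: ifP => _; [exact: cc|case: ifP => _; [exact: cs|exact: cvg_cst]].
have cj A : continuous (fun t => jump i j (c t) (s t) k A).
  move=> t; apply: cvgB; last exact: cvg_cst.
  by rewrite /coll; apply: cvgM; [exact: cw'|exact: cvg_cst].
have ce A : continuous (fun t => expo (jump i j (c t) (s t) k) A) by exact: continuous_expo.
have u0 : (0 < ndist L)%N by exact: ndist_gt0.
have nr : ((ndist L).-1 <= nrest i j L)%N by rewrite -ltnS prednK // ndist_nrest1.
have E : angmean (fun t => expo (jump i j (c t) (s t) k) L) =
    angmean (fun t => expo (jump i j (c t) (s t) k) L - jump i j (c t) (s t) k L) +
    angmean (fun t => jump i j (c t) (s t) k L).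
  rewrite -angmeanD //; first by congr angmean; apply/funext => t; rewrite subrK.
  by move=> t; apply: cvgB; [exact: ce|exact: cj].
have Ew : angmean (fun t => weight i j (c t) (s t) L) = wmean R (count_mem i L).
  by rewrite -cw; congr angmean; apply/funext => t; rewrite weight1.
set w := wmean _ _ in Ew *.
have Ej : angmean (fun t => jump i j (c t) (s t) k L) =
    w * \sum_(A <- substs i j L) k A - k L.
  transitivity (angmean (fun t => (\sum_(A <- substs i j L) k A) * weight i j (c t) (s t) L
     + (- k L))).
    by congr angmean; apply/funext => t; rewrite mulrC.
  rewrite angmeanD ?angmean_cst ?angmeanZ ?Ew 1?mulrC //.
    exact: continuous_scale.
  exact: continuous_const.
have mix := mixed_bound q01' a0 ka ij iL jL nL.
rewrite ksym // Ln in mix.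
have w01 : 0 <= w <= 1.
  rewrite -Ew; have W t := weight_itv i j (c01 t) (s01 t) L.
  apply/andP; split.
    rewrite -(angmean_cst 0); apply: angmean_le => // [|t]; first exact: continuous_const.
    by case/andP: (W t).
  rewrite -[leRHS](angmean_cst 1); apply: angmean_le => // [|t]; first exact: continuous_const.
  by case/andP: (W t).
rewrite E Ej.
have -> : angmean (fun t => expo (jump i j (c t) (s t) k) L - jump i j (c t) (s t) k L) +
   (w * \sum_(A <- substs i j L) k A - k L) - (2 * w - 1) * k L =
   w * (\sum_(A <- substs i j L) k A - k L - k L) +
   angmean (fun t => expo (jump i j (c t) (s t) k) L - jump i j (c t) (s t) k L) by ring.
rewrite mulrDl; apply: le_trans (ler_normD _ _) _; apply: lerD.
  case/andP: w01 => w0 w1; rewrite normrM (ger0_norm w0) -[leRHS]mul1r.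
  apply: ler_pM => //; apply: le_trans mix _.
  by rewrite -!mulrA -exprS prednK.
apply: angmean_bound => [|t].
  by move=> t; apply: cvgB; [exact: ce|exact: cj].
have [_ H] := expo_jump_bound i j (c01 t) (s01 t).
by apply: le_trans H _; rewrite ler_wpM2l // ler_wiXn2l.
Qed.

(** With both particles in [L] a collision may merge two distinct labels, which costs a factor [q].
    This is affordable because at most [n ^ 2] pairs are of this kind. *)
Lemma pair_bound2 i j :
  `|angmean (fun t => expo (angle_jump i j k t) L)| <=
  expo jump_size L * (q ^+ (ndist L).-1 / q).
Proof.
have qp : 0 < q by case/andP: q01.
apply: angmean_bound => [|t].
  by apply: continuous_expo => A; exact: continuous_angle_jump.
have [H _] := expo_jump_bound i j (cos2_itv t) (sin2_itv t).
apply: le_trans H _; rewrite ler_wpM2l ?expo_ge0 //.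
rewrite ler_pdivlMr // -exprSr ler_wiXn2l //.
by have := ndist_nrest2 i j L; case: (ndist L).
Qed.

Lemma pair_zero i j : i \notin L -> j \notin L ->
  angmean (fun t => expo (angle_jump i j k t) L) = 0.
Proof.
move=> iL jL; rewrite -[RHS](angmean_cst 0); congr angmean; apply/funext => t.
apply: (@expo0 _ _ _ (fun x => (x != i) && (x != j))) => //.
  move=> A _ /allP Aij; rewrite /angle_jump /jump coll_id ?subrr //.
    by apply/negP => /Aij; rewrite eqxx.
  by apply/negP => /Aij; rewrite eqxx andbF.
apply/allP => x xL; apply/andP; split; first by apply: contraNneq iL => <-.
by apply: contraNneq jL => <-.
Qed.

Lemma sum_mem : \sum_(j < N) (j \in L)%:R = (ndist L)%:R :> R.
Proof.
rewrite -natr_sum; congr (_%:R).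
transitivity #|undup L|; last by rewrite (card_uniqP (undup_uniq L)).
rewrite -sum1_card [RHS]big_mkcond; apply: eq_bigr => j _.
by rewrite mem_undup; case: (j \in L).
Qed.

Lemma sum_notmem : \sum_(j < N) (j \notin L)%:R = N%:R - (ndist L)%:R :> R.
Proof.
rewrite -sum_mem; apply/eqP; rewrite eq_sym subr_eq -big_split /=; apply/eqP.
rewrite (eq_bigr (fun=> 1)); first by rewrite sumr_const card_ord.
by move=> i _; case: (i \in L); rewrite ?add0r ?addr0.
Qed.

(** Each label of [L] has [N - ndist L] fresh partners, and the factor 2 counts both orders of a
    pair. By [pair_bound1] each such pair contributes [2 * wmean - 1] to the linear drift. *)
Definition relax_rate : R :=
  2 * (N%:R - (ndist L)%:R) / (N%:R - 1) *
  \sum_(i < N) (i \in L)%:R * (1 - 2 * wmean R (count_mem i L)).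

Let p0 : 0 < N%:R - 1 :> R. Proof. by rewrite subr_gt0 ltr1n. Qed.

(* The three error terms come from splitting the labels between a particle and a
   fresh collision partner, from products of lower order cumulants, and from
   collisions of two particles that both occur in [L]. *)
Lemma drift_bound : `|cumulant_gen k L + relax_rate * k L| <=
  q ^+ (ndist L).-1 * (2 * n%:R * (2 ^+ n * a n * q + jump_rest) +
    n%:R ^+ 2 / ((N%:R - 1) * q) * expo jump_size L).
Proof.
have qp : 0 < q by case/andP: q01.
pose b i := (2 * wmean R (count_mem i L) - 1) * k L.
pose E1 := (2 ^+ n * a n * q + jump_rest) * q ^+ (ndist L).-1.
pose E2 := expo jump_size L * (q ^+ (ndist L).-1 / q).
have E10 : 0 <= E1.
  by rewrite mulr_ge0 ?exprn_ge0 // addr_ge0 // !mulr_ge0 ?exprn_ge0.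
have E20 : 0 <= E2 by rewrite mulr_ge0 ?expo_ge0 ?divr_ge0 ?exprn_ge0.
pose h i j := angmean (fun t => expo (angle_jump i j k t) L).
(* [T] is the linear main term of a pair, present when exactly one of its particles is in [L]; [X]
   bounds the error. *)
pose T i j := (i \in L)%:R * (j \notin L)%:R * b i + (j \in L)%:R * (i \notin L)%:R * b j.
pose X i j := ((i \in L)%:R * (j \notin L)%:R + (j \in L)%:R * (i \notin L)%:R) * E1
  + (i \in L)%:R * (j \in L)%:R * E2.
have cc : continuous (fun t : R => cos t ^+ 2) by apply: continuousX; exact: continuous_cos.
have cs : continuous (fun t : R => sin t ^+ 2) by apply: continuousX; exact: continuous_sin.
have hT i j : i != j -> `|h i j - T i j| <= X i j.
  move=> ij; rewrite /T /X; case iL: (i \in L); case jL: (j \in L);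
    rewrite /= ?(mul0r, mul1r, mulr0, mulr1, add0r, addr0, subr0).
  - exact: pair_bound2.
  - by apply: pair_bound1; rewrite ?iL ?jL // => t; [exact: cos2_itv|exact: sin2_itv].
  - have -> : h i j = angmean (fun t => expo (jump j i (sin t ^+ 2) (cos t ^+ 2) k) L).
      congr angmean; apply/funext => t; congr expo; apply/funext => A.
      by rewrite /angle_jump /jump coll_swap.
    apply: (@pair_bound1 j i (fun t => sin t ^+ 2) (fun t => cos t ^+ 2)); rewrite ?iL ?jL //.
    + exact: sin2_itv.
    + exact: cos2_itv.
    + exact: angmean_sin.
  - by rewrite /h pair_zero ?iL ?jL // normr0.
have X0 i j : 0 <= X i j by rewrite /X addr_ge0 // mulr_ge0 // ?addr_ge0 // mulr_ge0.
have sumX : \sum_(i < N) \sum_(j < N) X i j =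
    2 * (ndist L)%:R * (N%:R - (ndist L)%:R) * E1 + (ndist L)%:R ^+ 2 * E2.
  have S2 (A B : 'I_N -> R) Y : \sum_(i < N) \sum_(j < N) A i * B j * Y =
      (\sum_(i < N) A i) * (\sum_(j < N) B j) * Y.
    rewrite mulr_suml mulr_suml; apply: eq_bigr => i _.
    by rewrite mulr_sumr mulr_suml.
  transitivity (\sum_(i < N) \sum_(j < N) (i \in L)%:R * (j \notin L)%:R * E1 +
     \sum_(i < N) \sum_(j < N) (i \notin L)%:R * (j \in L)%:R * E1 +
     \sum_(i < N) \sum_(j < N) (i \in L)%:R * (j \in L)%:R * E2).
    rewrite -!big_split /=; apply: eq_bigr => i _; rewrite -!big_split /=.
    by apply: eq_bigr => j _; rewrite /X; ring.
  by rewrite !S2 sum_mem sum_notmem; ring.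
have sumT : \sum_(i < N) \sum_(j < N | i != j) T i j = - ((N%:R - 1) * relax_rate * k L).
  transitivity (\sum_(i < N) \sum_(j < N) T i j).
    apply: eq_bigr => i _; rewrite big_mkcond; apply: eq_bigr => j _.
    case: eqVneq => // <-; rewrite /T.
    by case: (i \in L); rewrite /= ?(mul0r, mulr0) addr0.
  transitivity (\sum_(i < N) \sum_(j < N) (i \in L)%:R * (j \notin L)%:R * b i +
    \sum_(i < N) \sum_(j < N) (i \in L)%:R * (j \notin L)%:R * b i).
    rewrite [X in _ + X]exchange_big -big_split /=; apply: eq_bigr => i _.
    by rewrite -big_split.
  have -> : \sum_(i < N) \sum_(j < N) (i \in L)%:R * (j \notin L)%:R * b i =
     (N%:R - (ndist L)%:R) * \sum_(i < N) (i \in L)%:R * b i.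
    rewrite mulr_sumr; apply: eq_bigr => i _; rewrite -sum_notmem mulr_suml.
    by apply: eq_bigr => j _; ring.
  rewrite /relax_rate.
  have -> : \sum_(i < N) (i \in L)%:R * b i =
     - ((\sum_(i < N) (i \in L)%:R * (1 - 2 * wmean R (count_mem i L))) * k L).
    rewrite mulr_suml -sumrN; apply: eq_bigr => i _; rewrite /b; ring.
  by field; rewrite gt_eqF.
have -> : cumulant_gen k L + relax_rate * k L =
  (N%:R - 1)^-1 * \sum_(i < N) \sum_(j < N | i != j) (h i j - T i j).
  have s0 : sone R L = 0 by rewrite /sone (negbTE L0).
  rewrite /cumulant_gen s0.
  transitivity ((N%:R - 1)^-1 * (\sum_(i < N) \sum_(j < N | i != j) h i j
      - \sum_(i < N) \sum_(j < N | i != j) T i j)).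
    rewrite sumT mulrDr opprK mulrA mulrA mulVf ?gt_eqF // mul1r; congr (_ * _ + _).
    by apply: eq_bigr => i _; apply: eq_bigr => j _; rewrite subr0.
  by rewrite -sumrB; congr (_ * _); apply: eq_bigr => i _; rewrite -sumrB.
rewrite normrM gtr0_norm ?invr_gt0 // mulrC ler_pdivrMr //.
apply: (@le_trans _ _ (\sum_(i < N) \sum_(j < N) X i j)).
  apply: le_trans (ler_norm_sum _ _ _) _; apply: ler_sum => i _.
  apply: le_trans (ler_norm_sum _ _ _) _; rewrite big_mkcond; apply: ler_sum => j _.
  by case: ifP => // ij; exact: hT.
rewrite sumX.
have u1 : 1 <= (ndist L)%:R :> R by rewrite ler1n ndist_gt0.
have un : (ndist L)%:R <= n%:R :> R by rewrite ler_nat -Ln size_undup.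
have -> : q ^+ (ndist L).-1 * (2 * n%:R * (2 ^+ n * a n * q + jump_rest) +
    n%:R ^+ 2 / ((N%:R - 1) * q) * expo jump_size L) * (N%:R - 1) =
  2 * n%:R * (N%:R - 1) * E1 + n%:R ^+ 2 * E2.
  by rewrite /E1 /E2; field; rewrite !gt_eqF.
have uN : (ndist L)%:R <= N%:R :> R.
  by rewrite -sum_mem -[leRHS]mulr1 -[N in N%:R]card_ord mulr_natl -sumr_const ler_sum // => i _; rewrite lern1 leq_b1.
apply: lerD; last first.
  by apply: ler_wpM2r => //; rewrite lerXn2r ?nnegrE.
apply: ler_wpM2r => //; rewrite -!mulrA ler_wpM2l //.
by apply: ler_pM => //; [rewrite subr_ge0|rewrite lerD2l lerN2].
Qed.

(** A label of multiplicity one contributes [1 - 2 * (1 / 2) = 0], a repeated one at least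
    [1 - 2 * (3 / 8) = 1 / 4], and there is a repeated one. *)
Lemma relax_rate_ge : ~~ uniq L -> (n <= N)%N ->
  (N%:R - n%:R) / (2 * (N%:R - 1)) <= relax_rate.
Proof.
move=> nu nN.
have un : (ndist L)%:R <= n%:R :> R by rewrite ler_nat -Ln size_undup.
have nNR : n%:R <= N%:R :> R by rewrite ler_nat.
have [i ci] : exists i, (1 < count_mem i L)%N.
  apply: contrapT => H; move/negP: nu; apply; apply: count_mem_uniq => x.
  case xL: (x \in L); last by apply/count_memPn; rewrite xL.
  apply/eqP; rewrite eqn_leq -has_count has_pred1 xL andbT leqNgt; apply/negP => cx.
  by apply: H; exists x.
have big w : (2 <= w)%N -> 1 / 4 <= 1 - 2 * wmean R w by move=> /(wmean_le R); lra.
have term x : 0 <= (x \in L)%:R * (1 - 2 * wmean R (count_mem x L)).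
  case xL: (x \in L); last by rewrite mul0r.
  rewrite mul1r; have : (0 < count_mem x L)%N by rewrite -has_count has_pred1.
  case: (count_mem x L) => [//|[|c]] _; first by rewrite wmean1; lra.
  by apply: le_trans (big _ _); [lra|].
have iL : i \in L by rewrite -has_pred1 has_count (ltn_trans _ ci).
have S : 1 / 4 <= \sum_(x < N) (x \in L)%:R * (1 - 2 * wmean R (count_mem x L)).
  rewrite (bigD1 i) //= iL -[leLHS]addr0; apply: lerD; first by rewrite [leRHS]mul1r big.
  by apply: sumr_ge0 => x _; exact: term.
rewrite /relax_rate.
have c0 : 0 <= 2 * (N%:R - (ndist L)%:R) / (N%:R - 1) :> R.
  have uN : (ndist L)%:R <= N%:R :> R by exact: le_trans un nNR.
  by rewrite divr_ge0 ?mulr_ge0 ?(ltW p0) // subr_ge0.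
apply: le_trans (ler_wpM2l c0 S).
have -> : 2 * (N%:R - (ndist L)%:R) / (N%:R - 1) * (1 / 4) =
   (N%:R - (ndist L)%:R) / (2 * (N%:R - 1)) :> R by field; rewrite gt_eqF.
by apply: ler_wpM2r; rewrite ?invr_ge0 ?mulr_ge0 ?(ltW p0) // lerD2l lerN2.
Qed.

End Drift.

(** * Growth of partition sums *)

Section PartitionSums.
Variables (R : realType) (T : eqType) (C : R) (G : nat -> R).
Implicit Types L A : seq T.
Hypothesis C100 : 100 <= C.
Hypothesis G0 : forall l, 0 <= G l.
Hypothesis GM : forall l m, (0 < l)%N -> (0 < m)%N -> G l * G m <= 2 * G (l + m)%N.

(* The exponent gains [2 l m >= 2 (l + m - 1)] powers of [C] when [l + m] labels
   are split into blocks of sizes [l] and [m]; this beats the number of splits. *)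
Definition growth n : R := C ^+ (n ^ 2) * n`!%:R * G n.

Let C1 : 1 <= C. Proof. by apply: le_trans C100; rewrite ler1n. Qed.
Let C0 : 0 <= C. Proof. exact: le_trans ler01 C1. Qed.

Lemma growth_ge0 n : 0 <= growth n.
Proof. by rewrite !mulr_ge0 ?exprn_ge0. Qed.

Lemma growthM l m : (0 < l)%N -> (0 < m)%N ->
  growth l * growth m * C ^+ (2 * (l + m).-1) <= 2 * growth (l + m).
Proof.
move=> l0 m0.
have -> : growth l * growth m * C ^+ (2 * (l + m).-1) =
    (C ^+ (l ^ 2 + m ^ 2 + 2 * (l + m).-1) * (l`! * m`!)%:R) * (G l * G m).
  by rewrite /growth !exprD natrM; ring.
have -> : 2 * growth (l + m) = (C ^+ ((l + m) ^ 2) * (l + m)`!%:R) * (2 * G (l + m)%N).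
  by rewrite /growth; ring.
apply: ler_pM; rewrite ?mulr_ge0 ?exprn_ge0 ?GM //.
apply: ler_pM; rewrite ?exprn_ge0 //.
  apply: ler_weXn2l => //; rewrite sqrnD leq_add2l leq_mul2l /=.
  (* The inequality is [l + m - 1 <= l * m], that is, [(l - 1) * (m - 1) >= 0]. *)
  by nia.
rewrite ler_nat -(bin_fact (leq_addr m l)) addKn leq_pmull //.
by rewrite bin_gt0 leq_addr.
Qed.

Lemma size_splits L : size (splits L) = (2 ^ size L)%N.
Proof. by elim: L => //= x L IH; rewrite size_cat !size_map IH expnS mul2n addnn. Qed.

(** Origin of 100: for n = 2 the left side is 128 * 2 * 36 = 9216, just below 100^2, and then it
    grows by less than 100^2 per step. The 6 is 2 from the splits times 3 from [jump_growth_le], and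
    128 produces the margin 1/32 in [jump_rest_small]. *)
Lemma C_pow n : (1 < n)%N -> 128 * n%:R * 6 ^+ n <= C ^+ (2 * n.-1).
Proof.
case: n => [//|[//|n]] _; elim: n => [|n IH].
  apply: (@le_trans _ _ (100 ^+ 2)); first by lra.
  by apply: lerXn2r; rewrite ?nnegrE.
apply: (@le_trans _ _ (C ^+ (2 * n.+1) * C ^+ 2)); last first.
  by rewrite -exprD; apply: ler_weXn2l => //; lia.
apply: le_trans (ler_wpM2r _ IH); last by rewrite exprn_ge0.
apply: (@le_trans _ _ (128 * n.+2%:R * 6 ^+ n.+2 * 100 ^+ 2)); last first.
  apply: ler_wpM2l; first by apply: mulr_ge0; [exact: mulr_ge0|exact: exprn_ge0].
  by apply: lerXn2r; rewrite ?nnegrE.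
have -> : 128 * n.+3%:R * 6 ^+ n.+3 = (n.+3%:R * 6) * (128 * 6 ^+ n.+2) :> R.
  by rewrite [6 ^+ n.+3]exprS; ring.
have -> : 128 * n.+2%:R * 6 ^+ n.+2 * 100 ^+ 2 =
  (n.+2%:R * 100 ^+ 2) * (128 * 6 ^+ n.+2) :> R by ring.
apply: ler_wpM2r; first by apply: mulr_ge0 => //; exact: exprn_ge0.
have -> : n.+3%:R = n.+2%:R + 1 :> R by rewrite -natr1.
have n2 : 1 <= n.+2%:R :> R by rewrite ler1n.
lra.
Qed.

Lemma jump_growth_le A : A != [::] ->
  jump_size growth A <= 3 ^+ size A * growth (size A).
Proof.
move=> A0; rewrite /jump_size ler_wpM2r ?growth_ge0 //.
case: A A0 => // x A _ /=; elim: (size A) => [|l IH]; first by lra.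
rewrite exprS [leRHS]exprS.
have : 1 <= 2 ^+ l.+1 :> R by rewrite exprn_ege1 // ler1n.
by move: IH; set u := 2 ^+ _; set v := 3 ^+ _; lra.
Qed.

(** For n labels there are [2 ^ (n - 1)] choices of the first block, and [growthM] gains
    [C ^+ (2 * n.-1)] on each product of a block with its remainder. The assumption on shorter lists
    is supplied by [expo_growth], whose induction uses this lemma. *)
Lemma jump_rest_growth L : (1 < size L)%N ->
  (forall A, A != [::] -> (size A < size L)%N ->
     expo (jump_size growth) A <= 2 * (3 ^+ size A * growth (size A))) ->
  expo (jump_size growth) L - jump_size growth L <=
    2 * 6 ^+ size L / C ^+ (2 * (size L).-1) * growth (size L).
Proof.
case: L => // x L L1 IH.
rewrite expo_cons /shuffle sum_splits_remainder /der mulr1 addrAC subrr add0r.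
set n := size (x :: L) in L1 IH *.
have Cp : 0 < C ^+ (2 * n.-1) by rewrite exprn_gt0 // (lt_le_trans ltr01).
pose M := 2 * 3 ^+ n * (2 * growth n / C ^+ (2 * n.-1)).
have M0 : 0 <= M by rewrite !mulr_ge0 ?exprn_ge0 ?growth_ge0 ?invr_ge0 ?(ltW Cp).
apply: le_trans (ler_norm _) _.
apply: le_trans (norm_sum_le (M := M) _ _) _ => //.
  move=> p pL p2; have s := splits_size pL.
  have p2s : (0 < size p.2)%N by rewrite lt0n size_eq0.
  have sn : n = ((size p.1).+1 + size p.2)%N by rewrite /n /= -s.
  have js0 A : 0 <= jump_size growth A.
    by rewrite mulr_ge0 ?growth_ge0 ?addr_ge0 ?exprn_ge0.
  rewrite ger0_norm; last by rewrite mulr_ge0 ?expo_ge0.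
  have J := jump_growth_le (A := x :: p.1) isT.
  have E : expo (jump_size growth) p.2 <= 2 * (3 ^+ size p.2 * growth (size p.2)).
    by apply: IH => //; rewrite sn addSn ltnS leq_addl.
  apply: le_trans (ler_pM (js0 _) (expo_ge0 _ js0) J E) _.
  rewrite /M {1}sn exprD.
  have -> : 3 ^+ size (x :: p.1) * growth (size (x :: p.1)) *
     (2 * (3 ^+ size p.2 * growth (size p.2))) =
     2 * (3 ^+ (size p.1).+1 * 3 ^+ size p.2) * (growth (size p.1).+1 * growth (size p.2)).
    by rewrite /=; ring.
  rewrite ler_wpM2l ?mulr_ge0 ?exprn_ge0 // ler_pdivlMr // sn.
  exact: growthM.
rewrite size_splits /M natrX.
have -> : 6 ^+ n = 2 * (2 ^+ size L * 3 ^+ n) :> R.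
  by rewrite (_ : 6 = 2 * 3) ?exprMn ?[2 ^+ n]exprS ?mulrA //; lra.
by rewrite le_eqVlt; apply/orP; left; apply/eqP; field; rewrite gt_eqF.
Qed.

(** The partition into one block uses up one of the two copies on the right; all other partitions
    together fit into the second copy by [C_pow]. *)
Lemma expo_growth L : L != [::] ->
  expo (jump_size growth) L <= 2 * (3 ^+ size L * growth (size L)).
Proof.
have [N] := ubnP (size L); elim: N L => // N IH L LN L0.
have J := jump_growth_le L0.
have g0 := growth_ge0 (size L).
have t0 : 0 <= 3 ^+ size L :> R by rewrite exprn_ge0.
case: (ltnP 1 (size L)) => L1; last first.
  have -> : expo (jump_size growth) L = jump_size growth L.
    by case: L L0 L1 {IH LN J g0 t0} => // x [|//] _ _; rewrite expo_cons /shuffle big_seq1 /der mulr1.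
  by apply: le_trans J _; have := mulr_ge0 t0 g0; lra.
have Rb : expo (jump_size growth) L - jump_size growth L <=
    2 * 6 ^+ size L / C ^+ (2 * (size L).-1) * growth (size L).
  by apply: jump_rest_growth => // A A0 AL; apply: IH => //; exact: leq_trans AL LN.
rewrite mulr2n mulrDl mul1r -[leLHS](subrK (jump_size growth L)) lerD //.
apply: le_trans Rb _; rewrite ler_wpM2r //.
have Cp : 0 < C ^+ (2 * (size L).-1) by rewrite exprn_gt0 // (lt_le_trans ltr01).
rewrite ler_pdivrMr //.
have := C_pow L1; set n := size L.
have n1 : 1 <= n%:R :> R by rewrite ler1n ltnW.
have s0 : 0 <= 6 ^+ n :> R by rewrite exprn_ge0.
have t1 : 1 <= 3 ^+ n :> R by rewrite exprn_ege1 // ler1n.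
set c := C ^+ _ in Cp *; move=> H.
apply: (@le_trans _ _ c); first by apply: le_trans H; nra.
by rewrite ler_peMl // ltW.
Qed.

Lemma jump_rest_small L : (1 < size L)%N ->
  2 * (size L)%:R * (expo (jump_size growth) L - jump_size growth L) <=
  growth (size L) / 32.
Proof.
move=> L1.
have Rb : expo (jump_size growth) L - jump_size growth L <=
    2 * 6 ^+ size L / C ^+ (2 * (size L).-1) * growth (size L).
  by apply: jump_rest_growth => // A A0 _; exact: expo_growth.
have g0 := growth_ge0 (size L).
have Cp : 0 < C ^+ (2 * (size L).-1) by rewrite exprn_gt0 // (lt_le_trans ltr01).
apply: le_trans (ler_wpM2l _ Rb) _; first by rewrite mulr_ge0.
have := C_pow L1; set c := C ^+ _ in Cp *; set s := 6 ^+ size L; set n := (size L)%:R => H.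
have -> : 2 * n * (2 * s / c * growth (size L)) = (128 * n * s) / c * (growth (size L) / 32).
  by field; rewrite gt_eqF.
by rewrite ler_piMl ?divr_ge0 // ler_pdivrMr // mul1r.
Qed.

End PartitionSums.

(** * Consequences of exchangeability and energy conservation *)

Section ExchangeableCumulants.
Variables (R : realType) (N : nat) (m : seq 'I_N -> R).
Implicit Types (L A : seq 'I_N).
Hypothesis m1 : m [::] = 1.
Hypothesis msym : forall (s : 'S_N) L, m (map s L) = m L.
Hypothesis mcons : forall L, \sum_(i < N) m (i :: L) = N%:R * m L.

Notation k := (logm m).

Lemma logm_relabel (s : 'S_N) L : k (map s L) = k L.
Proof.
rewrite -logm_inj_map; last exact: perm_inj.
by congr logm; apply/funext => A; rewrite msym.
Qed.

Lemma logm_replace i j L : j \notin L ->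
  k [seq if x == i then j else x | x <- L] = k L.
Proof.
move=> jL; rewrite -[RHS](logm_relabel (tperm i j)); congr k; apply/eq_in_map => x xL.
have jx : j != x by apply: contraNneq jL => ->.
by rewrite permE /= eq_sym; case: eqVneq => // _; rewrite eq_sym (negbTE jx).
Qed.

(** By [mcons] the derivatives of the moment series in all directions add up to [N] times the
    series. Dividing by the series leaves the constant [N] for the cumulants. *)
Lemma sum_logm L : \sum_(i < N) k (i :: L) = N%:R * sone R L.
Proof.
have km := logmP m1.
suff /(shuffle_cancel m1)/(congr1 (fun f => f L)) :
  shuffle (fun A => \sum_(i < N) k (i :: A)) m = shuffle (fun A => N%:R * sone R A) m by [].
apply/funext => A; rewrite shuffleZl shuffle1f -mcons shuffle_suml.
by apply: eq_bigr => i _; rewrite (is_exp_cons _ _ km).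
Qed.

Lemma logm_order1 i : k [:: i] = 1.
Proof.
have N0 : N%:R != 0 :> R by rewrite pnatr_eq0; case: N i => // -[].
apply: (mulfI N0); rewrite mulr1 -[RHS]mulr1 -(_ : sone R (T := 'I_N) [::] = 1) // -sum_logm.
rewrite (eq_bigr (fun=> k [:: i])) ?sumr_const ?card_ord ?mulr_natl // => j _.
by rewrite -(logm_relabel (tperm j i)) /= tpermL.
Qed.

(** In [sum_logm] the [N - n + 1] labels outside the tail give equal cumulants by exchangeability,
    while the other [n - 1] labels create a repetition. The latter lists have one distinct label
    fewer, hence one factor [q] too few, which [(n - 1) / (N - n + 1) <= q] restores. *)
Lemma logm_uniq_bound n (y q : R) L : 0 <= y -> 0 < q ->
  (forall A, size A = n -> ~~ uniq A -> `|k A| <= y * q ^+ (ndist A).-1) ->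
  (1 < n)%N -> (n <= N)%N -> (n%:R - 1) / (N%:R - n%:R + 1) <= q ->
  size L = n -> uniq L -> `|k L| <= y * q ^+ n.-1.
Proof.
move=> y0 q0 ky n1 nN qn; case: L => [|x L] Ln; first by move: n1; rewrite -Ln.
rewrite cons_uniq => /andP[xL uL].
have L0 : L != [::] by case: L Ln {xL uL} n1 => // <-.
have := sum_logm L; rewrite /sone (negbTE L0) mulr0 (bigID (mem L)) /=.
rewrite [X in _ + X](eq_bigr (fun=> k (x :: L))); last first.
  move=> j jL; have [<- //|jx] := eqVneq x j.
  rewrite -(@logm_replace x j (x :: L)); last by rewrite inE negb_or eq_sym jx.
  rewrite /= eqxx; congr (k (j :: _)); rewrite -[LHS]map_id; apply/eq_in_map => z zL.
  by case: eqVneq => // zx; move: xL; rewrite -zx zL.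
have cL : #|mem L| = n.-1 by rewrite (card_uniqP uL) -Ln.
have sL' : \sum_(i < N | i \notin L) k (x :: L) = (N%:R - n%:R + 1) * k (x :: L).
  rewrite sumr_const -[LHS]mulr_natl; congr (_ * _).
  have := cardC (mem L); rewrite cL card_ord => E.
  have -> : #|[pred i | i \notin L]| = #|[predC mem L]| by apply: eq_card => z; rewrite !inE.
  have : (n.-1)%:R + #|[predC mem L]|%:R = N%:R :> R by rewrite -natrD E.
  have : (n.-1)%:R + 1 = n%:R :> R by rewrite natr1 prednK // ltnW.
  by move: (#|_|%:R : R) => a; lra.
rewrite sL' => E.
have cN : 0 < N%:R - n%:R + 1 :> R by rewrite ltr_wpDl // subr_ge0 ler_nat.
have bd : `|\sum_(i < N | i \in L) k (i :: L)| <= (n%:R - 1) * (y * q ^+ n.-2).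
  apply: le_trans (ler_norm_sum _ _ _) _.
  apply: (@le_trans _ _ (\sum_(i < N | i \in L) y * q ^+ n.-2)).
    apply: ler_sum => i iL.
    have -> : n.-2 = (ndist (i :: L)).-1 by rewrite /ndist /= iL undup_id // -Ln.
    by apply: ky; [rewrite /= -Ln|rewrite /= iL].
  rewrite sumr_const -[leLHS]mulr_natl ler_wpM2r ?mulr_ge0 ?exprn_ge0 ?(ltW q0) //.
  by rewrite cL -subn1 natrB // ltnW.
have -> : `|k (x :: L)| = `|\sum_(i < N | i \in L) k (i :: L)| / (N%:R - n%:R + 1).
  have -> : \sum_(i < N | i \in L) k (i :: L) = - ((N%:R - n%:R + 1) * k (x :: L)).
    by apply/eqP; rewrite -addr_eq0 E.
  by rewrite normrN normrM (gtr0_norm cN) mulrC mulKf ?gt_eqF.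
rewrite ler_pdivrMr //; apply: le_trans bd _.
have -> : q ^+ n.-1 = q * q ^+ n.-2 by rewrite -exprS; case: (n) n1 => [|[]].
have : n%:R - 1 <= q * (N%:R - n%:R + 1) by rewrite -ler_pdivrMr.
move=> /(ler_wpM2r (_ : 0 <= y * q ^+ n.-2)) H.
apply: le_trans (H _) _; first by rewrite mulr_ge0 ?exprn_ge0 ?(ltW q0).
by rewrite le_eqVlt; apply/orP; left; apply/eqP; ring.
Qed.

End ExchangeableCumulants.

(** * Propagation of the barrier in time *)

Section CumulantDecay.
Variables (R : realType) (N nstar : nat) (m : R -> seq 'I_N -> R).
Variables (C q : R) (Gam : nat -> R).
Implicit Types (L A : seq 'I_N) (t : R).
Hypothesis m1 : forall t, m t [::] = 1.
Hypothesis mc : forall L, continuous (fun t => m t L).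
Hypothesis md : forall t, 0 < t -> forall L,
  is_derive t 1 (fun u => m u L) (energy_gen (m t) L).
Hypothesis msym : forall t, 0 <= t -> forall (s : 'S_N) L, m t (map s L) = m t L.
Hypothesis mcons : forall t, 0 <= t -> forall L, \sum_(i < N) m t (i :: L) = N%:R * m t L.

Hypothesis C100 : 100 <= C.
Hypothesis q01 : 0 < q <= 1.
Hypothesis Gam1 : forall n, 1 <= Gam n.
Hypothesis GamM : forall l n, (0 < l)%N -> (0 < n)%N -> Gam l * Gam n <= Gam (l + n)%N.

Hypothesis N2 : (1 < N)%N.
Hypothesis nN : (nstar <= N)%N.
Hypothesis Nuniq : forall n, (1 < n <= nstar)%N -> (n%:R - 1) / (N%:R - n%:R + 1) <= q.
Hypothesis Nsmall : forall n, (1 < n <= nstar)%N ->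
  2 * n%:R * 2 ^+ n * q + 2 * n%:R ^+ 2 * 3 ^+ n / ((N%:R - 1) * q) <= 1 / 32.
Hypothesis Nrate : forall n, (1 < n <= nstar)%N ->
  7 / 16 <= (N%:R - n%:R) / (2 * (N%:R - 1)) :> R.

Notation k t := (logm (m t)).

Definition decay t n : R := Gam n * expR (- t / 4) + 1.

Hypothesis k0 : forall L, (1 < size L <= nstar)%N ->
  `|k 0 L| < growth C (decay 0) (size L) * q ^+ (ndist L).-1.

Let C1 : 1 <= C. Proof. by apply: le_trans C100; rewrite ler1n. Qed.

Let E01 t : 0 <= t -> 0 < expR (- t / 4) <= 1.
Proof.
by move=> t0; rewrite expR_gt0 -[leRHS]expR0 ler_expR; lra.
Qed.

Lemma decay_ge1 t n : 1 <= decay t n.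
Proof. by rewrite /decay lerDr mulr_ge0 ?expR_ge0 // (le_trans ler01). Qed.

Let decay_ge0 t n : 0 <= decay t n. Proof. exact: le_trans ler01 (decay_ge1 t n). Qed.

(** With e the exponential and a, b >= 1 the two values of [Gam], one has e^2 <= e and a + b <= a b
    + 1, so (a e + 1)(b e + 1) <= 2 a b e + e + 1, and e <= 1. *)
Lemma decayM t l n : 0 <= t -> (0 < l)%N -> (0 < n)%N ->
  decay t l * decay t n <= 2 * decay t (l + n)%N.
Proof.
move=> t0 l0 n0; rewrite /decay; have /andP[] := E01 t0.
set e := expR _ => e0 e1.
have := GamM l0 n0; have := Gam1 l; have := Gam1 n.
move: (Gam l) (Gam n) (Gam (l + n)%N) => a b c b1 a1 ab.
have H1 : a + b <= a * b + 1.
  have : 0 <= (a - 1) * (b - 1) by rewrite mulr_ge0 ?subr_ge0.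
  by lra.
have H2 : a * b * e ^+ 2 <= c * e.
  rewrite expr2 mulrA ler_wpM2r ?(ltW e0) //; apply: le_trans ab.
  by rewrite ler_piMr //; apply: mulr_ge0; lra.
have H3 : (a + b) * e <= (c + 1) * e by rewrite ler_wpM2r ?(ltW e0) //; lra.
have -> : (a * e + 1) * (b * e + 1) = a * b * e ^+ 2 + (a + b) * e + 1 by ring.
by move: H2 H3; rewrite !mulrDl; lra.
Qed.

Let y n t : R := growth C (decay t) n.

Let y_gt0 n t : 0 < y n t.
Proof.
rewrite /y /growth !mulr_gt0 ?exprn_gt0 ?ltr0n ?fact_gt0 ?(lt_le_trans ltr01) //.
exact: decay_ge1.
Qed.

Let dy n t : R := C ^+ (n ^ 2) * n`!%:R * (Gam n * (- 1 / 4 * expR (- t / 4))).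

Let y_derive n t : is_derive t 1 (y n) (dy n t).
Proof.
rewrite /y /growth /decay.
have H1 : is_derive t 1 (fun u : R => - u / 4) (- 1 / 4).
  have -> : (fun u : R => - u / 4) = (fun u => - 4^-1 * u).
    by apply/funext => u; rewrite mulNr mulrC mulNr.
  apply: is_derive_eq (is_deriveZ (- 4^-1) (is_derive_id t 1)) _.
  by rewrite /GRing.scale /=; lra.
have H2 : is_derive t 1 (fun u : R => expR (- u / 4)) (- 1 / 4 * expR (- t / 4)).
  apply: is_derive_eq (is_derive1_comp (f := expR) (g := fun u => - u / 4) (is_derive_expR (- t / 4)) H1) _.
  by rewrite mulrC.
have H3 := is_deriveD (is_deriveZ (Gam n) H2) (is_derive_cst (1 : R) t 1).
apply: is_derive_eq (is_deriveZ (C ^+ (n ^ 2) * n`!%:R) H3) _.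
by rewrite /dy /GRing.scale /= addr0.
Qed.

Let y_cont n : continuous (y n).
Proof. by move=> t; apply/differentiable_continuous/derivable1_diffP; exact: ex_derive. Qed.

(** Only the exponential part of [decay] decreases, so the barrier falls at relative rate at most
    1/4. *)
Let dy_ge n t : - (y n t) / 4 <= dy n t.
Proof.
have : 0 <= C ^+ (n ^ 2) * n`!%:R by rewrite mulr_ge0 ?exprn_ge0 // (le_trans ler01).
rewrite /y /dy /growth /decay; move: (C ^+ _ * _) => a a0.
set g := Gam n * _; have -> : Gam n * (- 1 / 4 * expR (- t / 4)) = - g / 4 by rewrite /g; field.
have -> : a * (- g / 4) = - (a * g) / 4 by field.
by rewrite mulrDr mulr1; lra.
Qed.

Lemma logm_continuous L : continuous (fun t => k t L).
Proof.
have [n] := ubnP (size L); elim: n L => // n IH [|x L] Ln; first exact: continuous_const.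
under eq_fun do rewrite logm_cons big_seq_cond.
move=> t; apply: cvgB; first exact: mc.
apply: (@continuous_bigsum R R) => p /andP[pL p2] u.
apply: cvgM; last exact: mc.
by apply: IH; exact: leq_ltn_trans (splits_size_lt pL p2) _.
Qed.

(** At contact with the barrier Q Y, relaxation contributes at most -7/16 Q Y to the drift and the
    errors at most 1/16 Q Y: 1/32 from [Nsmall] and 1/32 from [jump_rest_small]. The total -6/16 Q Y
    is below -4/16 Q Y, the steepest possible slope of the barrier. The sign [e] treats upper and
    lower barrier at once. *)
Lemma drift_strict t L (e : R) : (1 < size L <= nstar)%N -> 0 <= t -> (e == 1) || (e == -1) ->
  (forall A, (0 < size A <= size L)%N ->
    `|k t A| <= growth C (decay t) (size A) * q ^+ (ndist A).-1) ->
  ~~ uniq L ->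
  e * k t L = q ^+ (ndist L).-1 * y (size L) t ->
  e * cumulant_gen (k t) L < q ^+ (ndist L).-1 * dy (size L) t.
Proof.
move=> Ls t0 e1 ka nu kL; set n := size L in Ls ka kL *.
have /andP[L1 Ln] := Ls.
have qp : 0 < q by case/andP: q01.
have L0 : L != [::] by apply: contraTneq L1; rewrite /n => ->.
have g0 l : 0 <= growth C (decay t) l by apply: growth_ge0.
have ksym i j : i \in L -> j \notin L ->
    k t [seq if x == i then j else x | x <- L] = k t L.
  by move=> _ jL; apply: logm_replace => //; exact: msym.
have D := drift_bound N2 q01 g0 ka ksym (erefl n) L0.
have rr := relax_rate_ge R N2 (erefl n) nu (leq_trans Ln nN).
have rest := jump_rest_small C100 (decay_ge0 t) (fun l n => @decayM t l n t0) L1.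
have ex := expo_growth C100 (decay_ge0 t) (fun l n => @decayM t l n t0) L0.
set Y := y n t in kL *; have Y0 : 0 < Y by exact: y_gt0.
set Q := q ^+ _ in kL D *; have Q0 : 0 < Q by rewrite exprn_gt0.
set lam := relax_rate _ _ in rr D.
have lam7 : 7 / 16 <= lam by apply: le_trans rr; exact: Nrate.
rewrite /jump_rest -/n in rest ex D.
rewrite -/(y n t) -/Y in rest ex D.
have Derr : 2 * n%:R * (2 ^+ n * Y * q + (expo (jump_size (growth C (decay t))) L
       - jump_size (growth C (decay t)) L))
    + n%:R ^+ 2 / ((N%:R - 1) * q) * expo (jump_size (growth C (decay t))) L <= Y / 16.
  have := Nsmall Ls; rewrite -/n => sm.
  have p0 : 0 < (N%:R - 1) * q by rewrite mulr_gt0 // subr_gt0 ltr1n.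
  have ex2 := ler_wpM2l (_ : 0 <= n%:R ^+ 2 / ((N%:R - 1) * q)) ex.
  have := ex2 (divr_ge0 (exprn_ge0 _ (ler0n _ _)) (ltW p0)) => {}ex2.
  have sm2 := ler_wpM2r (ltW Y0) sm.
  have eq1 : (2 * n%:R * 2 ^+ n * q + 2 * n%:R ^+ 2 * 3 ^+ n / ((N%:R - 1) * q)) * Y =
    2 * n%:R * (2 ^+ n * Y * q) + n%:R ^+ 2 / ((N%:R - 1) * q) * (2 * (3 ^+ n * Y)).
    have pN : (0 : R) < N%:R - 1 by rewrite subr_gt0 ltr1n.
    by field; rewrite !gt_eqF.
  rewrite eq1 in sm2.
  rewrite mulrDr; lra.
have {}D := le_trans D (ler_wpM2l (ltW Q0) Derr).
have eE : e * cumulant_gen (k t) L = e * (cumulant_gen (k t) L + lam * k t L) - lam * (Q * Y).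
  by rewrite -kL; ring.
have enorm : `|e * (cumulant_gen (k t) L + lam * k t L)| <= Q * (Y / 16).
  by rewrite normrM; case/orP: e1 => /eqP ->; rewrite ?normrN normr1 mul1r.
have H1 : e * (cumulant_gen (k t) L + lam * k t L) <= Q * (Y / 16).
  exact: le_trans (ler_norm _) enorm.
have QY0 : 0 < Q * Y by exact: mulr_gt0.
have H2 : 7 / 16 * (Q * Y) <= lam * (Q * Y) by rewrite ler_wpM2r // ltW.
have H3 : Q * (- Y / 4) <= Q * dy n t by rewrite ler_wpM2l ?(ltW Q0) // dy_ge.
rewrite eE; apply: lt_le_trans H3.
have -> : Q * (- Y / 4) = - (Q * Y) / 4 by ring.
have E16 : Q * (Y / 16) = (Q * Y) / 16 by ring.
rewrite E16 in H1; lra.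
Qed.

(** Induction on the order, as the drift at order [n] involves only orders up to [n]. The barrier
    argument runs over all lists with a repetition and both signs simultaneously; at every instant
    [logm_uniq_bound] supplies the lists without repetition, which also occur in the drift. *)
Lemma cumulant_decay_order n : (0 < n <= nstar)%N -> forall t, 0 <= t ->
  forall A, size A = n -> `|k t A| <= growth C (decay t) n * q ^+ (ndist A).-1.
Proof.
have qp : 0 < q by case/andP: q01.
elim/ltn_ind: n => n IH /andP[n0 nn] t t0 A An.
case: (ltnP 1 n) => n1; last first.
  have n1' : n = 1%N by apply/eqP; rewrite eqn_leq n1.
  case: A An => [|i [|j A]]; rewrite n1' // => _.
  rewrite (logm_order1 (m1 t) (msym t0) (mcons t0)) normr1 /= expr0 mulr1.
  by rewrite /growth exp1n expr1 mulr1 mulr_ege1 // decay_ge1.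
have nonuniq : forall t, 0 <= t -> forall A, size A = n -> ~~ uniq A ->
   `|k t A| <= growth C (decay t) n * q ^+ (ndist A).-1.
  move=> {t t0 A An} t t0 A An Au.
  pose sg (b : bool) : R := if b then 1 else - 1.
  (* Tuples without repetition get the constant 1, so that they can never be the first to touch
     zero. *)
  pose w (Lb : n.-tuple 'I_N * bool) (u : R) : R :=
    if uniq Lb.1 then 1 else q ^+ (ndist Lb.1).-1 * y n u - sg Lb.2 * k u Lb.1.
  pose dw (Lb : n.-tuple 'I_N * bool) (u : R) : R :=
    if uniq Lb.1 then 0 else q ^+ (ndist Lb.1).-1 * dy n u - sg Lb.2 * cumulant_gen (k u) Lb.1.
  have wc Lb : continuous (w Lb).
    rewrite /w; case: (uniq Lb.1); first exact: continuous_const.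
    move=> u; apply: cvgB; apply: (@continuous_scale R R) => {}u.
      exact: y_cont.
    exact: logm_continuous.
  have w0 Lb : 0 < w Lb 0.
    rewrite /w; case: ifP => // _.
    have := k0 (L := Lb.1); rewrite size_tuple n1 nn => /(_ isT).
    rewrite -/(y n 0) mulrC ltr_norml => /andP[H1 H2].
    by rewrite /sg; case: Lb.2; rewrite ?mul1r ?mulN1r; lra.
  have wd Lb (u : R) : 0 < u -> is_derive u 1 (w Lb) (dw Lb u).
    move=> u0; rewrite /w /dw; case: ifP => _; first exact: is_derive_cst.
    have L0 : tval Lb.1 != [::] by rewrite -size_eq0 size_tuple -lt0n.
    have H1 := is_deriveZ (q ^+ (ndist Lb.1).-1) (y_derive n u).
    have H2 := is_deriveZ (sg Lb.2) (cumulant_derive m1 (md u0) L0).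
    exact: is_deriveB H1 H2.
  have wpos Lb (u : R) : 0 < u -> w Lb u = 0 -> (forall M, 0 <= w M u) -> 0 < dw Lb u.
    move=> u0 wz wge; move: wz; rewrite /w /dw; case: ifPn => [_ /eqP|nu].
      by rewrite oner_eq0.
    move=> /eqP; rewrite subr_eq0 => /eqP wz; rewrite subr_gt0.
    have un := ltW u0.
    have kn M : size M = n -> ~~ uniq M -> `|k u M| <= growth C (decay u) n * q ^+ (ndist M).-1.
      move=> Mn Mu; rewrite ler_norml.
      have := wge (Tuple (introT eqP Mn), true); have := wge (Tuple (introT eqP Mn), false).
      rewrite /w /= (negbTE Mu) /sg /= -/(y n u) mul1r mulN1r [y n u * _]mulrC; lra.
    have := @drift_strict u Lb.1 (sg Lb.2).
    rewrite size_tuple; apply => //; first by rewrite n1.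
      by rewrite /sg; case: Lb.2; rewrite !eqxx ?orbT.
    move=> M /andP[M0 Mn]; move: Mn; rewrite leq_eqVlt => /orP[/eqP Mn|Mn].
      case Mu: (uniq M); last by rewrite Mn; apply: kn; rewrite ?Mu.
      have -> : (ndist M).-1 = n.-1 by rewrite /ndist undup_id // Mn.
      rewrite Mn; apply: (logm_uniq_bound (m1 u) (msym un) (mcons un) _ qp kn) => //.
      - exact: ltW (y_gt0 n u).
      - exact: leq_trans nn nN.
      - by apply: Nuniq; rewrite n1.
    by apply: IH => //; rewrite M0 (leq_trans (ltnW Mn)).
  have pos := barrier wc w0 wd wpos.
  have A1 := pos (Tuple (introT eqP An), true) t t0.
  have A2 := pos (Tuple (introT eqP An), false) t t0.
  rewrite ler_norml; move: A1 A2.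
  rewrite /w /= (negbTE Au) /sg /= -/(y n t) mul1r mulN1r [y n t * _]mulrC; lra.
case Au: (uniq A); last by apply: nonuniq; rewrite ?Au.
have -> : (ndist A).-1 = n.-1 by rewrite /ndist undup_id // An.
apply: (logm_uniq_bound (m1 t) (msym t0) (mcons t0) _ qp (nonuniq t t0)) => //.
- exact: ltW (y_gt0 n t).
- exact: leq_trans nn nN.
- by apply: Nuniq; rewrite n1.
Qed.

End CumulantDecay.

(** * Energy moments of the Kac process *)

Section KernelAlong.
Context d1 d2 d3 (X : measurableType d1) (Y : measurableType d2)
  (Z : measurableType d3) (R : realType).
Variables (p : R.-pker Y ~> Z) (g : X -> Y).

(** The dummy factor [unit] gives the domain that [kcomp] asks for, so that a mixture of the
    measures [p (g w)] becomes a composition of kernels. *)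
Definition kernel_along (mg : measurable_fun [set: X] g) (u : unit * X) :
  {measure set Z -> \bar R} := p (g u.2).

Hypothesis mg : measurable_fun [set: X] g.

Let measurable_kernel_along U : measurable U ->
  measurable_fun [set: unit * X] (fun u => kernel_along mg u U : \bar R).
Proof.
move=> mU; apply: (measurableT_comp (measurable_kernel p U mU)).
exact: (measurableT_comp mg measurable_snd).
Qed.

HB.instance Definition _ :=
  @isKernel.Build _ _ _ _ R (kernel_along mg) measurable_kernel_along.

Let kernel_along_prob u : kernel_along mg u [set: Z] = 1%E.
Proof. exact: prob_kernel. Qed.

HB.instance Definition _ :=
  @Kernel_isProbability.Build _ _ _ _ R (kernel_along mg) kernel_along_prob.

End KernelAlong.

(** [nu] is the composition of the constant kernel [P] with [kernel_along], so the identity is an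
    instance of [integral_kcomp]. *)
Lemma integral_mixture d1 d2 d3 (X : measurableType d1) (Y : measurableType d2)
    (Z : measurableType d3) (R : realType) (P : probability X R)
    (p : R.-pker Y ~> Z) (g : X -> Y) (nu : {measure set Z -> \bar R}) (f : Z -> \bar R) :
  measurable_fun [set: X] g ->
  (forall A, measurable A -> nu A = \int[P]_w p (g w) A)%E ->
  (forall z, 0 <= f z)%E -> measurable_fun [set: Z] f ->
  (\int[nu]_z f z = \int[P]_w \int[p (g w)]_z f z)%E.
Proof.
move=> mg nuE f0 mf.
pose l := kprobability (measurable_cst (P : pprobability X R) : measurable_fun [set: unit] _).
have -> : (\int[nu]_z f z = \int[kcomp l (kernel_along p mg) tt]_z f z)%E.
  by apply: eq_measure_integral => A mA _; rewrite nuE.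
by rewrite integral_kcomp.
Qed.

Section BoundedExpectation.
Context d (T : measurableType d) (R : realType) (P : probability T R).

Definition bounded_mfun (f : T -> R) : Prop :=
  measurable_fun [set: T] f /\ exists M, forall w, `|f w| <= M.

Lemma bounded_mfun_integrable f : bounded_mfun f ->
  P.-integrable [set: T] (EFin \o f).
Proof.
move=> [mf [M fM]]; apply: measurable_bounded_integrable => //.
  by rewrite [ltLHS](probability_setT P) ltry.
exists M; split; first exact: num_real.
by move=> x Mx w _; exact: le_trans (fM w) (ltW Mx).
Qed.

Lemma bounded_mfunD f g : bounded_mfun f -> bounded_mfun g ->
  bounded_mfun (fun w => f w + g w).
Proof.
move=> [mf [M fM]] [mg [M' gM]]; split; first exact: measurable_funD.
by exists (M + M') => w; apply: le_trans (ler_normD _ _) _; exact: lerD.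
Qed.

Lemma bounded_mfunZ (a : R) f : bounded_mfun f -> bounded_mfun (fun w => a * f w).
Proof.
move=> [mf [M fM]]; split; first exact: measurable_funM.
by exists (`|a| * M) => w; rewrite normrM ler_wpM2l.
Qed.

Lemma bounded_mfun_cst (a : R) : bounded_mfun (fun=> a).
Proof. by split => //; exists `|a|. Qed.

Lemma bounded_mfun_sum (I : Type) (r : seq I) (Q : pred I) (F : I -> T -> R) :
  (forall i, bounded_mfun (F i)) -> bounded_mfun (fun w => \sum_(i <- r | Q i) F i w).
Proof.
move=> bF; elim: r => [|i r IH].
  by under eq_fun do rewrite big_nil; exact: bounded_mfun_cst.
under eq_fun do rewrite big_cons.
by case: (Q i) => //; exact: bounded_mfunD.
Qed.

Lemma meanD f g : bounded_mfun f -> bounded_mfun g ->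
  \int[P]_w (f w + g w) = \int[P]_w f w + \int[P]_w g w.
Proof. by move=> bf bg; rewrite RintegralD //; exact: bounded_mfun_integrable. Qed.

Lemma meanZ (a : R) f : bounded_mfun f -> \int[P]_w (a * f w) = a * \int[P]_w f w.
Proof. by move=> bf; rewrite RintegralZl //; exact: bounded_mfun_integrable. Qed.

Lemma mean_cst (a : R) : \int[P]_w a = a.
Proof. by rewrite Rintegral_cst // [X in fine X](probability_setT P) mulr1. Qed.

Lemma mean_sum (I : Type) (r : seq I) (Q : pred I) (F : I -> T -> R) :
  (forall i, bounded_mfun (F i)) ->
  \int[P]_w (\sum_(i <- r | Q i) F i w) = \sum_(i <- r | Q i) \int[P]_w F i w.
Proof.
move=> bF; elim: r => [|i r IH].
  by under eq_Rintegral do rewrite big_nil; rewrite mean_cst big_nil.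
under eq_Rintegral do rewrite big_cons.
rewrite big_cons; case: ifP => Qi //; rewrite meanD ?IH //; exact: bounded_mfun_sum.
Qed.

Lemma mean_bound f (M : R) : bounded_mfun f -> (forall w, `|f w| <= M) ->
  `|\int[P]_w f w| <= M.
Proof.
move=> bf fM; apply: le_trans (le_normr_Rintegral _ _) _ => //.
  exact: bounded_mfun_integrable.
rewrite -[leRHS]mean_cst; apply: le_Rintegral => //.
- apply: bounded_mfun_integrable; split; last first.
    by exists M => w; rewrite normr_id.
  by apply: measurableT_comp => //; case: bf.
- exact: bounded_mfun_integrable (bounded_mfun_cst M).
Qed.

End BoundedExpectation.

Section EnergyMoments.
Variables (R : realType) (N : nat).
Notation Y := (borel_rV R N).
Implicit Types (L : seq 'I_N).

Lemma continuous_measurable_rV (g : 'rV[R]_N -> R) : continuous g ->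
  measurable_fun [set: Y] (g : Y -> R).
Proof.
move=> /continuousP cg; apply: (measurability _ (RGenOpens.measurableE R)).
move=> _ [_ [a [b ->] <-]]; rewrite setTI; apply: sub_sigma_algebra.
exact/cg/interval_open.
Qed.

Lemma continuous_energy (i : 'I_N) : continuous (fun v : 'rV[R]_N => v 0 i ^+ 2).
Proof. by apply: continuousX; exact: coord_continuous. Qed.

Lemma continuous_emon L : continuous (fun v : 'rV[R]_N => emon v L).
Proof. by apply: continuous_bigprod => i; exact: continuous_energy. Qed.

Lemma measurable_emon L : measurable_fun [set: Y] (fun v : Y => emon (v : 'rV[R]_N) L).
Proof. by apply: (@continuous_measurable_rV (fun v => emon v L)); exact: continuous_emon. Qed.

Lemma emon_ge0 (v : 'rV[R]_N) L : 0 <= emon v L.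
Proof. by apply: prodr_ge0 => i _; exact: sqr_ge0. Qed.

Lemma energy_le (v : 'rV[R]_N) i : @sphere R N v -> v 0 i ^+ 2 <= N%:R.
Proof.
move=> <-; rewrite (bigD1 i) //= lerDl.
by apply: sumr_ge0 => j _; exact: sqr_ge0.
Qed.

Lemma emon_le (v : 'rV[R]_N) L : @sphere R N v -> emon v L <= N%:R ^+ size L.
Proof.
move=> Sv; rewrite /emon; elim: L => [|i L IH]; first by rewrite big_nil.
rewrite big_cons [leRHS]exprS; apply: ler_pM => //; [exact: sqr_ge0|exact: emon_ge0|exact: energy_le].
Qed.

Lemma measurable_sphere : measurable (@sphere R N : set Y).
Proof.
have c : continuous (fun v : 'rV[R]_N => \sum_i v 0 i ^+ 2).
  by apply: continuous_bigsum => i _; exact: continuous_energy.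
have := continuous_measurable_rV c measurableT (measurable_set1 N%:R).
by rewrite setTI.
Qed.

Lemma integral_sphere (nu : {measure set Y -> \bar R}) (f : Y -> \bar R) :
  nu (~` @sphere R N) = 0%E -> (forall v, 0 <= f v)%E -> measurable_fun [set: Y] f ->
  (\int[nu]_v f v = \int[nu]_(v in @sphere R N) f v)%E.
Proof.
move=> nu0 f0 mf; rewrite (ge0_negligible_integral (N := ~` @sphere R N : set (borel_rV R N))) //.
  by rewrite setTD setCK.
by apply: measurableC; exact: measurable_sphere.
Qed.

End EnergyMoments.

(** * Forward increments of moments *)

Section MomentEvolution.
Variables (R : realType) (N : nat).
Notation Y := (borel_rV R N).
Notation S := (@sphere R N).
Variables (d : measure_display) (Omega : measurableType d).
Variables (P : probability Omega R) (X : R -> {RV P >-> borel_rV R N}).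
Variable p : R -> R.-pker Y ~> Y.
Hypothesis N2 : (1 < N)%N.
Hypothesis pS : forall (t : R) x, 0 <= t -> S x -> p t x S = 1%E.
Hypothesis pgen : has_generator S p (@kac_generator R N).
Hypothesis XS : forall (t : R) w, 0 <= t -> S (X t w).
Hypothesis Markov : forall (s t : R) A, 0 <= s -> 0 <= t -> measurable A ->
  (P (X (s + t) @^-1` A) = \int[P]_w p t (X s w) A)%E.
Implicit Types (L : seq 'I_N) (t h : R).

Definition moment t L : R := \int[P]_w emon (X t w : 'rV[R]_N) L.

Lemma bounded_emon t L : 0 <= t -> bounded_mfun (fun w => emon (X t w : 'rV[R]_N) L).
Proof.
move=> t0; split; first exact: (measurableT_comp (measurable_emon L) (measurable_funPT (X t))).
exists (N%:R ^+ size L) => w; rewrite ger0_norm ?emon_ge0 //.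
by apply: emon_le; exact: XS.
Qed.

Lemma bounded_energy_gen t L : 0 <= t ->
  bounded_mfun (fun w => energy_gen (emon (X t w : 'rV[R]_N)) L).
Proof.
move=> t0; under eq_fun do rewrite energy_genE.
apply: bounded_mfunZ; apply: bounded_mfun_sum => i; apply: bounded_mfun_sum => j.
apply: bounded_mfunD; last first.
  by under eq_fun do rewrite -mulN1r; apply: bounded_mfunZ; exact: bounded_emon.
by apply: bounded_mfunZ; apply: bounded_mfun_sum => A; exact: bounded_emon.
Qed.

Lemma mean_energy_gen t L : 0 <= t ->
  \int[P]_w energy_gen (emon (X t w : 'rV[R]_N)) L = energy_gen (moment t) L.
Proof.
move=> t0; have be A := bounded_emon A t0.
under eq_Rintegral do rewrite energy_genE.
have b1 i j : bounded_mfun (fun w => mean_weight R i j L * \sum_(A <- substs i j L)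
     emon (X t w : 'rV[R]_N) A).
  by apply: bounded_mfunZ; apply: bounded_mfun_sum.
have b2 : bounded_mfun (fun w => - emon (X t w : 'rV[R]_N) L).
  by under eq_fun do rewrite -mulN1r; exact: bounded_mfunZ.
rewrite energy_genE meanZ; last first.
  by apply: bounded_mfun_sum => i; apply: bounded_mfun_sum => j; exact: bounded_mfunD.
congr (_ * _); rewrite mean_sum; last first.
  by move=> i; apply: bounded_mfun_sum => j; exact: bounded_mfunD.
apply: eq_bigr => i _; rewrite mean_sum; last by move=> j; exact: bounded_mfunD.
apply: eq_bigr => j _; rewrite meanD // meanZ; last exact: bounded_mfun_sum.
rewrite mean_sum //; congr (_ + _).
by under eq_Rintegral do rewrite -mulN1r; rewrite meanZ // mulN1r.
Qed.

Let emonE L : Y -> \bar R := fun v => (emon (v : 'rV[R]_N) L)%:E.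

Let emonE_ge0 L v : (0 <= emonE L v)%E. Proof. by rewrite lee_fin emon_ge0. Qed.

Let measurable_emonE L : measurable_fun [set: Y] (emonE L).
Proof. by apply/measurable_EFinP; exact: measurable_emon. Qed.

Let kernel_int t L (x : Y) : R := \int[p t x]_(y in S) emon (y : 'rV[R]_N) L.

Let kernel_sphereC t (x : Y) : 0 <= t -> S x -> p t x (~` S) = 0%E.
Proof.
move=> t0 Sx; have mS := @measurable_sphere R N.
have := measureU (p t x) mS (measurableC mS) (setICr _).
have pT : p t x [set: Y] = 1%E by exact: prob_kernel.
rewrite setUCr [X in _ = (X + _)%E -> _](pS t0 Sx) [X in X = _ -> _]pT.
move=> e1; apply/eqP; rewrite eq_le measure_ge0 andbT.
by rewrite -(@leeD2lE _ 1%E) // adde0 -[leLHS]e1.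
Qed.

Let kernel_integrable t L (x : Y) : 0 <= t -> S x ->
  (p t x).-integrable S (EFin \o (fun y : Y => emon (y : 'rV[R]_N) L)).
Proof.
move=> t0 Sx; apply: measurable_bounded_integrable.
- exact: measurable_sphere.
- by rewrite [ltLHS](pS t0 Sx) ltry.
- by apply: measurable_funTS; exact: measurable_emon.
exists (N%:R ^+ size L); split; first exact: num_real.
move=> M NM y Sy; rewrite /= ger0_norm ?emon_ge0 //.
exact: le_trans (emon_le L Sy) (ltW NM).
Qed.

Let kernel_intE t L (x : Y) : 0 <= t -> S x ->
  (\int[p t x]_y emonE L y)%E = (kernel_int t L x)%:E.
Proof.
move=> t0 Sx.
rewrite (integral_sphere (N := N)) //; last exact: kernel_sphereC.
rewrite /kernel_int /Rintegral fineK //; apply: integrable_fin_num.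
  exact: measurable_sphere.
exact: kernel_integrable.
Qed.

Let kernel_int_le t L (x : Y) : 0 <= t -> S x -> kernel_int t L x <= N%:R ^+ size L.
Proof.
move=> t0 Sx; apply: (@le_trans _ _ (\int[p t x]_(y in S) (N%:R ^+ size L))).
  apply: le_Rintegral.
  - exact: measurable_sphere.
  - exact: kernel_integrable.
  - apply: measurable_bounded_integrable; [exact: measurable_sphere| |by []|exact: bounded_cst].
    by rewrite [ltLHS](pS t0 Sx) ltry.
  - by move=> y Sy; exact: emon_le.
rewrite Rintegral_cst; last exact: measurable_sphere.
by rewrite [X in fine X](pS t0 Sx) mulr1.
Qed.

(** The Markov property makes the law at time [t + h] a mixture of the kernels [p h (X t w)], to
    which [integral_mixture] applies. *)
Lemma moment_step t h L : 0 <= t -> 0 <= h ->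
  moment (t + h) L = \int[P]_w kernel_int h L (X t w) /\
  bounded_mfun (fun w => kernel_int h L (X t w)).
Proof.
move=> t0 h0.
have mX u := measurable_funPT (X u).
have mk : measurable_fun [set: Omega] (fun w => (kernel_int h L (X t w))%:E).
  have := measurable_fun_integral_kernel (fun U mU => measurable_kernel (p h) U mU)
     (emonE_ge0 L) (measurable_emonE L).
  move/measurableT_comp/(_ (mX t)); congr measurable_fun.
  by apply/funext => w /=; rewrite kernel_intE //; exact: XS.
have E : (\int[P]_w (emon (X (t + h) w : 'rV[R]_N) L)%:E =
    \int[P]_w (kernel_int h L (X t w))%:E)%E.
  have := ge0_integral_pushforward (mX (t + h)) P measurableT (measurable_emonE L) (fun y _ => emonE_ge0 L y).
  rewrite /= => <- //.
  rewrite (integral_mixture (P := P) (p := p h) (g := X t)) //.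
    by apply: eq_integral => w _; rewrite kernel_intE //; exact: XS.
  by move=> A mA; rewrite -Markov.
split; first by rewrite /moment /Rintegral E.
split; first exact/measurable_EFinP.
exists (N%:R ^+ size L) => w.
have Sw := XS w t0.
have k0 : 0 <= kernel_int h L (X t w) by apply: Rintegral_ge0 => y _; exact: emon_ge0.
by rewrite ger0_norm // kernel_int_le.
Qed.

(** The threshold for [h] is common to all [t]: the generator limit is uniform on the sphere, which
    the process never leaves. This uniformity is what later yields derivatives from both sides. *)
Lemma moment_increment L (e : R) : 0 < e -> \forall h \near 0^'+, forall t, 0 <= t ->
  `|moment (t + h) L - moment t L - h * energy_gen (moment t) L| <= h * e.
Proof.
move=> e0.
have ce : {within S, continuous (fun v : 'rV[R]_N => emon v L)}.
  by apply: continuous_subspaceT => v; exact: continuous_emon.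
have H := pgen ce e0.
near=> h => t t0.
have h0 : 0 < h by near: h; exact: nbhs_right_gt.
have Hh : forall x, S x -> `|h^-1 * (kernel_int h L x - emon x L)
    - energy_gen (emon x) L| <= e.
  move=> x Sx; rewrite -kac_generator_emon //; move: x Sx; near: h; exact: H.
have [-> bk] := moment_step L t0 (ltW h0).
have be := bounded_emon L t0; have bg := bounded_energy_gen L t0.
rewrite -mean_energy_gen //.
have b1 := bounded_mfunZ (- 1) be; have b2 := bounded_mfunZ (- h) bg.
have b12 := bounded_mfunD b1 b2.
have -> : \int[P]_w kernel_int h L (X t w) - moment t L -
    h * (\int[P]_w energy_gen (emon (X t w : 'rV[R]_N)) L) =
  \int[P]_w (kernel_int h L (X t w) + (-1 * emon (X t w : 'rV[R]_N) L +
    (- h) * energy_gen (emon (X t w : 'rV[R]_N)) L)).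
  by rewrite (meanD P bk b12) (meanD P b1 b2) (meanZ P _ be) (meanZ P _ bg) /moment; ring.
apply: mean_bound; first exact: bounded_mfunD.
move=> w; have := Hh _ (XS w t0).
set K := kernel_int _ _ _; set f := emon _ _; set g := energy_gen _ _ => Hw.
have -> : K + (-1 * f + - h * g) = h * (h^-1 * (K - f) - g) by field; rewrite gt_eqF.
by rewrite normrM gtr0_norm // ler_wpM2l // ltW.
Unshelve. all: by end_near. Qed.

End MomentEvolution.

(** * From uniform forward increments to derivatives *)

Section RightIncrements.
Variables (R : realType) (f D : R -> R).
Hypothesis fD : forall e : R, 0 < e -> \forall h \near 0^'+, forall s : R, 0 <= s ->
  `|f (s + h) - f s - h * D s| <= h * e.

Let incr (e : R) : 0 < e -> exists2 r : R, 0 < r & forall h s : R, 0 < h < r -> 0 <= s ->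
  `|f (s + h) - f s - h * D s| <= h * e.
Proof.
move=> /fD; rewrite near_withinE => /nbhs_ballP[r /= r0 H]; exists r => // h s /andP[h0 hr] s0.
by apply: H => //; rewrite /ball /= sub0r normrN gtr0_norm.
Qed.

(** Error 1 in [fD] already makes [f] Lipschitz at short distances, with constant [1 + K]. *)
Lemma continuous_clamp (K : R) : (forall s, 0 <= s -> `|D s| <= K) ->
  continuous (fun u : R => f (Num.max u 0)).
Proof.
move=> DK u; have [r r0 H] := incr ltr01.
have K0 : 0 <= K by apply: le_trans (DK 0 (lexx _)).
have lip a b : 0 <= a -> a <= b -> b - a < r -> `|f b - f a| <= (b - a) * (1 + K).
  move=> a0; rewrite le_eqVlt => /orP[/eqP -> _|ab br]; first by rewrite !subrr normr0 mul0r.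
  have := H (b - a) a _ a0; rewrite subr_gt0 ab br => /(_ isT).
  rewrite (addrC a) subrK => H1; have := DK a a0 => H2.
  have -> : f b - f a = (f b - f a - (b - a) * D a) + (b - a) * D a by rewrite subrK.
  apply: le_trans (ler_normD _ _) _; rewrite mulrDr; apply: lerD => //.
  by rewrite normrM gtr0_norm ?subr_gt0 // ler_wpM2l // subr_ge0 ltW.
apply/cvgrPdist_lt => e e0.
have near1 : \forall v \near u, `|u - v| < Num.min r (e / (1 + K)).
  apply/nbhs_ballP; exists (Num.min r (e / (1 + K))) => //=.
  by rewrite lt_min r0 divr_gt0 // ltr_wpDr.
near=> v.
have : `|u - v| < Num.min r (e / (1 + K)) by near: v.
rewrite lt_min => /andP[vr ve].
have K1 : 0 < 1 + K by rewrite ltr_wpDr.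
rewrite ltr_pdivlMr // in ve.
have mx a b : `|Num.max a 0 - Num.max b 0| <= `|a - b| :> R.
  rewrite ler_norml /Num.max; case: ltP => ha; case: ltP => hb; case: (ler0P (a - b)) => hab;
  by apply/andP; split; lra.
have m0 a : 0 <= Num.max a 0 :> R by rewrite le_max lexx orbT.
have muv := mx u v.
case: (leP (Num.max u 0) (Num.max v 0)) => uv.
  rewrite distrC; apply: le_lt_trans (lip _ _ (m0 u) uv _) _.
    by apply: le_lt_trans vr; apply: le_trans muv; rewrite distrC ler_norm.
  apply: le_lt_trans ve; rewrite ler_wpM2r // ?(ltW K1) //.
  by apply: le_trans muv; rewrite distrC ler_norm.
apply: le_lt_trans (lip _ _ (m0 v) (ltW uv) _) _.
  by apply: le_lt_trans vr; apply: le_trans muv; rewrite ler_norm.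
apply: le_lt_trans ve; rewrite ler_wpM2r // ?(ltW K1) //.
by apply: le_trans muv; rewrite ler_norm.
Unshelve. all: by end_near. Qed.

(** For h < 0 the increment is a forward step from [t + h] to [t], to which [fD] applies because its
    threshold does not depend on the starting point. Continuity of [D] then replaces [D (t + h)] by
    [D t]. *)
Lemma is_derive_clamp (t : R) : 0 < t -> continuous (fun u : R => D (Num.max u 0)) ->
  is_derive t 1 (fun u : R => f (Num.max u 0)) (D t).
Proof.
move=> t0 cD; have mt : Num.max t 0 = t by apply/max_idPl; exact: ltW.
have cv : (fun h => h^-1 *: (f (Num.max (h *: 1 + t) 0) - f (Num.max t 0))) @ 0^' --> D t.
  apply/cvgrPdist_le => e e0.
  have [r r0 H] := incr (divr_gt0 e0 (ltr0n R 2)).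
  have := cD t; rewrite /continuous_at mt => /cvgrPdist_lt /(_ _ (divr_gt0 e0 (ltr0n R 2))).
  move=> /nbhs_ballP[r2 /= r20 H2].
  rewrite near_withinE; apply/nbhs_ballP.
  exists (Num.min r (Num.min r2 t)) => /=; first by rewrite !lt_min r0 r20 t0.
  move=> h; rewrite /ball /= sub0r normrN !lt_min => /and3P[hr hr2 ht] h0.
  rewrite /GRing.scale /= mulr1.
  have ht0 : 0 < h + t by move: ht; rewrite ltr_norml => /andP[]; lra.
  have -> : Num.max (h + t) 0 = h + t by apply/max_idPl; exact: ltW.
  case: (ltgtP h 0) h0 => // hh _.
    have := H (- h) (h + t); rewrite oppr_gt0 hh -(ltr0_norm hh) hr => /(_ isT (ltW ht0)).
    rewrite (ltr0_norm hh) (_ : h + t + - h = t); last by ring.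
    have := H2 (h + t); rewrite /ball /= opprD addrCA subrr addr0 normrN => /(_ hr2).
    have -> : Num.max (h + t) 0 = h + t by apply/max_idPl; exact: ltW.
    move=> D1 D2.
    have -> : D t - h^-1 * (f (h + t) - f t) = (D t - D (h + t)) +
       (- h)^-1 * - (f t - f (h + t) - - h * D (h + t)) by field; rewrite lt_eqF.
    apply: le_trans (ler_normD _ _) _; rewrite [leRHS](splitr e); apply: lerD; first exact: ltW.
    rewrite normrM normrN normfV normrN (ltr0_norm hh) mulrC ler_pdivrMr ?oppr_gt0 //.
    by rewrite [leRHS]mulrC.
  have := H h t; rewrite hh -(gtr0_norm hh) hr => /(_ isT (ltW t0)).
  rewrite (gtr0_norm hh) (addrC t) => D1.
  have -> : D t - h^-1 * (f (h + t) - f t) = h^-1 * - (f (h + t) - f t - h * D t).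
    by field; rewrite gt_eqF.
  rewrite normrM normrN normfV (gtr0_norm hh) mulrC ler_pdivrMr // [leRHS]mulrC.
  apply: le_trans D1 _; rewrite ler_wpM2l ?(ltW hh) //; lra.
by apply: DeriveDef; [apply/cvg_ex; exists (D t)|apply/cvg_lim].
Qed.

End RightIncrements.

(** * Uniqueness for the moment equations *)

Section GeneratorBound.
Variables (R : realType) (N : nat).
Implicit Types (L : seq 'I_N).

(** A crude operator norm on lists of length [n]: at most N^2 pairs, each with at most [2 ^+ n]
    substituted lists and the list itself. It grows with [N], but serves only continuity and
    uniqueness at fixed [N]. *)
Definition gen_bound n : R := (N%:R - 1)^-1 * (N%:R * (N%:R * (2 ^+ n + 1))).

Lemma energy_gen_bound (f : seq 'I_N -> R) L (M : R) : (1 < N)%N -> 0 <= M ->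
  (forall A, size A = size L -> `|f A| <= M) ->
  `|energy_gen f L| <= gen_bound (size L) * M.
Proof.
move=> N2 M0 fM; rewrite energy_genE /gen_bound -!mulrA normrM.
have p0 : 0 < N%:R - 1 :> R by rewrite subr_gt0 ltr1n.
rewrite gtr0_norm ?invr_gt0 // ler_wpM2l ?invr_ge0 ?(ltW p0) //.
have sumN (F : 'I_N -> R) (B : R) : (forall i, `|F i| <= B) -> \sum_(i < N) `|F i| <= N%:R * B.
  move=> FB; apply: (@le_trans _ _ (\sum_(i < N) B)); first by apply: ler_sum => i _.
  by rewrite sumr_const card_ord mulr_natl.
apply: le_trans (ler_norm_sum _ _ _) _; apply: (sumN _ _) => i.
apply: le_trans (ler_norm_sum _ _ _) _; rewrite big_mkcond.
apply: (@le_trans _ _ (\sum_(j < N) `|if i != j then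
   mean_weight R i j L * \sum_(A <- substs i j L) f A - f L else 0|)).
  by apply: ler_sum => j _; case: ifP => // _; rewrite normr_ge0.
apply: sumN => j; case: ifP => _; last first.
  by rewrite normr0 mulr_ge0 // addr_ge0 // exprn_ge0.
rewrite mulrDl mul1r; apply: le_trans (ler_normB _ _) _; apply: lerD; last exact: fM.
have /andP[w0 w1] := mean_weight_itv R i j L.
rewrite normrM (ger0_norm w0) -[leRHS]mul1r; apply: ler_pM => //.
apply: le_trans (norm_sum_le (M := M) _ _) _ => //.
  by move=> A AL _; apply: fM; exact: substs_size AL.
rewrite ler_wpM2r // size_substs natrX ler_weXn2l ?ler1n //; exact: count_size.
Qed.

Lemma energy_genB (f g : seq 'I_N -> R) L :
  energy_gen (fun A => f A - g A) L = energy_gen f L - energy_gen g L.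
Proof.
rewrite !energy_genE -mulrBr -sumrB; congr (_ * _); apply: eq_bigr => i _.
rewrite -sumrB; apply: eq_bigr => j _; rewrite sumrB; ring.
Qed.

Lemma continuous_energy_gen (m : R -> seq 'I_N -> R) L :
  (forall A, continuous (fun u => m u A)) -> continuous (fun u => energy_gen (m u) L).
Proof.
move=> cm; under eq_fun do rewrite energy_genE.
apply: continuous_scale; apply: continuous_bigsum => i _; apply: continuous_bigsum => j _ u.
apply: cvgB; last exact: cm.
by apply: (@continuous_scale R R) => {}u; apply: (@continuous_bigsum R R) => A _; exact: cm.
Qed.

(* The moment equations of order [n] form a finite linear system, so their
   solution is determined by its initial value. *)
Lemma moment_uniq (m : R -> seq 'I_N -> R) : (1 < N)%N ->
  (forall L, continuous (fun u => m u L)) ->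
  (forall (t : R) L, 0 < t -> is_derive t 1 (fun u => m u L) (energy_gen (m t) L)) ->
  (forall L, m 0 L = 0) -> forall (t : R) L, 0 <= t -> m t L = 0.
Proof.
move=> N2 mc md m0 t L t0.
(* The added 1 makes [e * expR (K * u)] grow strictly faster than the drift of any solution below
   it; letting [e] tend to 0 gives the claim. *)
pose n := size L; pose K : R := `|gen_bound n| + 1.
have Kb : gen_bound n < K by rewrite /K (le_lt_trans (ler_norm _)) // ltrDl.
suff H (e : R) : 0 < e -> `|m t L| <= e * expR (K * t).
  apply/eqP; rewrite -normr_le0; apply/ler_addgt0Pl => e e0; rewrite addr0.
  have := H (e / expR (K * t)); rewrite divfK ?gt_eqF ?expR_gt0 //.
  by apply; rewrite divr_gt0 ?expR_gt0.
move=> e0; pose sg (b : bool) : R := if b then 1 else - 1.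
pose w (Lb : n.-tuple 'I_N * bool) (u : R) : R := e * expR (K * u) - sg Lb.2 * m u Lb.1.
pose dw (Lb : n.-tuple 'I_N * bool) (u : R) : R :=
  e * (expR (K * u) * K) - sg Lb.2 * energy_gen (m u) Lb.1.
have de (u : R) : is_derive u 1 (fun v => e * expR (K * v)) (e * (expR (K * u) * K)).
  have H1 : is_derive u 1 (fun v : R => K * v) K.
    apply: is_derive_eq (is_deriveZ K (is_derive_id u 1)) _.
    by rewrite /GRing.scale /= mulr1.
  exact: (is_deriveZ e (is_derive1_comp (f := expR) (is_derive_expR (K * u)) H1)).
have wc Lb : continuous (w Lb).
  have ce : continuous (fun v : R => e * expR (K * v)).
    by move=> u; apply/differentiable_continuous/derivable1_diffP; case: (de u).
  move=> u; apply: cvgB; first exact: ce.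
  by apply: (@continuous_scale R R) => {}u; exact: mc.
have w0 Lb : 0 < w Lb 0 by rewrite /w m0 !mulr0 subr0 expR0 mulr1.
have wd Lb (u : R) : 0 < u -> is_derive u 1 (w Lb) (dw Lb u).
  by move=> u0; exact: is_deriveB (de u) (is_deriveZ (sg Lb.2) (md u Lb.1 u0)).
have wpos Lb (u : R) : 0 < u -> w Lb u = 0 -> (forall M, 0 <= w M u) -> 0 < dw Lb u.
  move=> u0 _ wge; rewrite /dw subr_gt0.
  set y := e * expR (K * u).
  have y0 : 0 < y by rewrite mulr_gt0 ?expR_gt0.
  have mb A : size A = n -> `|m u A| <= y.
    move=> An; have := wge (Tuple (introT eqP An), true).
    have := wge (Tuple (introT eqP An), false).
    by rewrite /w /sg /= -/y mul1r mulN1r ler_norml; lra.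
  have := @energy_gen_bound (m u) Lb.1 y N2 (ltW y0).
  rewrite size_tuple => /(_ mb) gb.
  apply: (@le_lt_trans _ _ (gen_bound n * y)); last first.
    by rewrite mulrA -/y [ltRHS]mulrC ltr_pM2r.
  apply: le_trans gb; apply: le_trans (ler_norm _) _.
  by rewrite normrM /sg; case: Lb.2; rewrite ?normrN normr1 mul1r.
have pos := barrier wc w0 wd wpos.
have A1 := pos (in_tuple L, true) t t0; have A2 := pos (in_tuple L, false) t t0.
by move: A1 A2; rewrite /w /sg /= mul1r mulN1r ler_norml; lra.
Qed.

End GeneratorBound.

Section Relabelling.
Variables (R : realType) (N : nat).
Implicit Types (L : seq 'I_N) (f : seq 'I_N -> R) (s : 'S_N).

Lemma substs_map s i j L : substs (s i) (s j) (map s L) = map (map s) (substs i j L).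
Proof.
elim: L => //= x L ->; rewrite !inE !(inj_eq perm_inj); case: ifP => _.
  by rewrite map_cat -!map_comp.
by rewrite -!map_comp.
Qed.

Lemma weight_map s i j (c c' : R) L :
  weight (s i) (s j) c c' (map s L) = weight i j c c' L.
Proof. by elim: L => //= x L ->; rewrite !(inj_eq perm_inj). Qed.

Lemma energy_gen_map s f L :
  energy_gen f (map s L) = energy_gen (fun A => f (map s A)) L.
Proof.
rewrite !energy_genE; congr (_ * _).
rewrite (reindex_inj (@perm_inj _ s)) /=; apply: eq_bigr => i _.
rewrite (reindex_inj (@perm_inj _ s)) /=.
under eq_bigl do rewrite (inj_eq perm_inj).
apply: eq_bigr => j _; rewrite substs_map big_map; congr (_ * _ - _).
by congr angmean; apply/funext => t; rewrite weight_map.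
Qed.

Lemma emon_perm s (v : 'rV[R]_N) L : emon (col_perm s v) L = emon v (map s L).
Proof. by rewrite /emon big_map; apply: eq_bigr => l _; rewrite mxE. Qed.

Lemma sum_emon (v : 'rV[R]_N) L : @sphere R N v ->
  \sum_(i < N) emon v (i :: L) = N%:R * emon v L.
Proof.
by move=> <-; rewrite mulr_suml; apply: eq_bigr => i _; rewrite /emon big_cons.
Qed.

Lemma continuous_col_perm s : continuous (fun v : 'rV[R]_N => col_perm s v).
Proof.
move=> v A /nbhs_ballP[e e0 eA]; apply/nbhs_ballP; exists e => // w [_ vw].
by apply: eA; split => // i j; rewrite !mxE; exact: vw.
Qed.

Lemma measurable_col_perm s :
  measurable_fun [set: borel_rV R N] (fun v : borel_rV R N => col_perm s v : borel_rV R N).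
Proof.
refine (@measurability _ _ (borel_rV R N) (borel_rV R N) setT _ (@open 'rV[R]_N) erefl _).
move=> _ [A oA <-]; rewrite setTI.
apply: sub_sigma_algebra.
by move/continuousP: (@continuous_col_perm s); exact.
Qed.

End Relabelling.

Section SphereMoments.
Variables (R : realType) (N : nat).
Notation Y := (borel_rV R N).
Implicit Types (L : seq 'I_N) (F : probability Y R).

Definition smoment (F : {measure set Y -> \bar R}) L : R :=
  \int[F]_(v in @sphere R N) emon (v : 'rV[R]_N) L.

Lemma smoment_eq (F G : {measure set Y -> \bar R}) L :
  (forall A, measurable A -> F A = G A) -> smoment F L = smoment G L.
Proof.
move=> FG; rewrite /smoment /Rintegral; congr fine.
by apply: eq_measure_integral => A mA _; exact: FG.
Qed.

Lemma smomentE F L : F (~` @sphere R N) = 0%E ->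
  smoment F L = fine (\int[F]_v (emon (v : 'rV[R]_N) L)%:E)%E.
Proof.
move=> FS; rewrite /smoment /Rintegral (integral_sphere (N := N)) //.
  by move=> v; rewrite lee_fin emon_ge0.
by apply/measurable_EFinP; exact: measurable_emon.
Qed.

Lemma smoment_sym F (s : 'S_N) L : F (~` @sphere R N) = 0%E -> symmetric_law F ->
  smoment F (map s L) = smoment F L.
Proof.
move=> FS symF; rewrite !smomentE //; congr fine.
have mE M : measurable_fun [set: Y] (fun v : Y => (emon (v : 'rV[R]_N) M)%:E).
  by apply/measurable_EFinP; exact: measurable_emon.
have pos : {in [set: Y], forall v, 0 <= (emon (v : 'rV[R]_N) L)%:E}%E.
  by move=> v _; rewrite lee_fin emon_ge0.
have := ge0_integral_pushforward (@measurable_col_perm R N s) F measurableT (mE L) pos.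
rewrite preimage_setT => E.
transitivity (\int[F]_v (emon (col_perm s (v : 'rV[R]_N)) L)%:E)%E.
  by apply: eq_integral => v _; rewrite emon_perm.
rewrite -[LHS]E.
apply: eq_measure_integral => [|mc A mA _]; first exact: measurable_col_perm.
exact: symF.
Qed.

Variables (d : measure_display) (Omega : measurableType d).
Variables (P : probability Omega R) (X : {RV P >-> borel_rV R N}).
Hypothesis XS : forall w, @sphere R N (X w).

Lemma smoment_distribution L :
  smoment (distribution P X) L = \int[P]_w emon (X w : 'rV[R]_N) L.
Proof.
rewrite /smoment /Rintegral; congr fine.
have mS := @measurable_sphere R N.
have := ge0_integral_pushforward (measurable_funPT X) P mS
  (f := fun v : Y => (emon (v : 'rV[R]_N) L)%:E).
move=> ->.
- have -> : X @^-1` @sphere R N = setT by apply/seteqP; split => w // _; exact: XS.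
  by [].
- by apply: measurable_funTS; apply/measurable_EFinP; exact: measurable_emon.
- by move=> v _; rewrite lee_fin emon_ge0.
Qed.

End SphereMoments.

Section KacMoments.
Variables (R : realType) (N : nat).
Variables (d : measure_display) (Omega : measurableType d).
Variables (P : probability Omega R) (X : R -> {RV P >-> borel_rV R N}).
Hypothesis N2 : (1 < N)%N.
Hypothesis kacX : kac_process X.
Implicit Types (L : seq 'I_N) (t : R).

Lemma kac_sphere t w : 0 <= t -> @sphere R N (X t w).
Proof. by move=> t0; case: kacX => p [_ _ [H _ _ _]]; exact: H. Qed.

(* Frozen at its initial value for negative times, to be continuous on all of R. *)
Definition cmoment t L : R := moment X (Num.max t 0) L.

Lemma cmomentE t L : 0 <= t -> cmoment t L = smoment (distribution P (X t)) L.
Proof.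
move=> t0; rewrite smoment_distribution; last by move=> w; exact: kac_sphere.
by rewrite /cmoment /moment (_ : Num.max t 0 = t) //; apply/max_idPl.
Qed.

Let max0 t : 0 <= Num.max t 0. Proof. by rewrite le_max lexx orbT. Qed.

Lemma cmoment_nil t : cmoment t [::] = 1.
Proof.
rewrite /cmoment /moment; under eq_Rintegral do rewrite /emon big_nil.
exact: mean_cst.
Qed.

Lemma cmoment_incr L (e : R) : 0 < e -> \forall h \near 0^'+, forall t, 0 <= t ->
  `|moment X (t + h) L - moment X t L - h * energy_gen (moment X t) L| <= h * e.
Proof.
case: kacX => p [[pS _ _] pgen [XS _ _ Mk]].
apply: (moment_increment N2 pS pgen XS) => s t A s0 t0 mA.
rewrite -Mk //; first by rewrite setTI.
exact: (@measurableT _ (g_sigma_algebraType _)).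
Qed.

Lemma moment_le t L : 0 <= t -> `|moment X t L| <= N%:R ^+ size L.
Proof.
move=> t0; apply: mean_bound; first by apply: bounded_emon => // u w u0; exact: kac_sphere.
by move=> w; rewrite ger0_norm ?emon_ge0 // emon_le //; exact: kac_sphere.
Qed.

Lemma cmoment_continuous L : continuous (fun t => cmoment t L).
Proof.
apply: (continuous_clamp (@cmoment_incr L) (K := gen_bound R N (size L) * N%:R ^+ size L)).
move=> s s0; apply: energy_gen_bound => //.
by move=> A <-; exact: moment_le.
Qed.

Lemma cmoment_derive t L : 0 < t ->
  is_derive t 1 (fun u => cmoment u L) (energy_gen (cmoment t) L).
Proof.
move=> t0.
have mt : Num.max t 0 = t by apply/max_idPl; exact: ltW.
have -> : cmoment t = moment X t by apply/funext => A; rewrite /cmoment mt.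
apply: (is_derive_clamp (@cmoment_incr L)) => //.
by apply: continuous_energy_gen => A; exact: cmoment_continuous.
Qed.

(** Relabelled and original moments solve the same linear system, since [energy_gen] commutes with
    permutations, and they agree at time 0; [moment_uniq] applies to their difference. *)
Lemma cmoment_sym : symmetric_law (distribution P (X 0)) ->
  forall t, 0 <= t -> forall (s : 'S_N) L, cmoment t (map s L) = cmoment t L.
Proof.
move=> sym0 t t0 s L; apply/eqP; rewrite -subr_eq0; apply/eqP.
apply: (@moment_uniq R N (fun u A => cmoment u (map s A) - cmoment u A) N2) => //.
- by move=> A u; apply: cvgB; exact: cmoment_continuous.
- move=> u A u0; rewrite energy_genB -energy_gen_map.
  by apply: is_deriveB; exact: cmoment_derive.
move=> A; rewrite !cmomentE // smoment_sym ?subrr //.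
have S0 : X 0 @^-1` (~` @sphere R N) = set0.
  by apply/seteqP; split => w //; apply; exact: kac_sphere.
by rewrite -[LHS]/(P (X 0 @^-1` (~` @sphere R N))) S0 measure0.
Qed.

Lemma cmoment_cons t : 0 <= t ->
  forall L, \sum_(i < N) cmoment t (i :: L) = N%:R * cmoment t L.
Proof.
move=> t0 L; have bX A := bounded_emon (fun u w u0 => @kac_sphere u w u0) A (max0 t).
rewrite /cmoment /moment -(meanZ P _ (bX L)) -mean_sum; last by move=> i; exact: bX.
by apply: eq_Rintegral => w _; rewrite sum_emon //; exact: kac_sphere.
Qed.

End KacMoments.


Lemma is_derive_scaled_exp (R : realType) (a b h : R) :
  is_derive h 1 (fun u : R => a * expR (u * b)) (a * (expR (h * b) * b)).
Proof.
have H1 : is_derive h 1 (fun u : R => u * b) b.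
  have -> : (fun u : R => u * b) = (fun u => b * u) by apply/funext => u; rewrite mulrC.
  apply: is_derive_eq (is_deriveZ b (is_derive_id h 1)) _.
  by rewrite /GRing.scale /= mulr1.
have H2 := (is_derive1_comp (f := expR) (g := fun u => u * b) (is_derive_expR (h * b)) H1).
exact: (is_deriveZ a H2).
Qed.

(** * Cumulants as logarithmic derivatives *)

Section TiltedMoments.
Variables (R : realType) (N : nat) (F : probability (borel_rV R N) R).
Notation Y := (borel_rV R N).
Notation S := (@sphere R N).
Hypothesis FS : F S = 1%E.
Implicit Types (L : seq 'I_N) (xi : 'rV[R]_N) (i : 'I_N).

(** Exponential tilting: derivatives of the cumulant generating function at [xi] are cumulants of
    the law with density proportional to [tilt xi]. As [energy_cumulant] iterates derivatives of
    functions of [xi], a recursion at [xi = 0] alone would not suffice. *)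
Definition tilt xi (v : 'rV[R]_N) : R := expR (\sum_i xi 0 i * v 0 i ^+ 2).

Definition tmass xi L : R := \int[F]_(v in S) (emon v L * tilt xi v).

Definition tmoment xi L : R := tmass xi L / tmass xi [::].

Let mS := @measurable_sphere R N.

Lemma continuous_tilt xi : continuous (tilt xi).
Proof.
move=> v; apply: (@continuous_comp _ _ _ (fun v : 'rV[R]_N => \sum_i xi 0 i * v 0 i ^+ 2)).
  apply: continuous_bigsum => i _; apply: continuous_scale; exact: continuous_energy.
exact: continuous_expR.
Qed.

Lemma tilt_le xi v : S v -> tilt xi v <= expR (\sum_i `|xi 0 i| * N%:R).
Proof.
move=> Sv; rewrite ler_expR; apply: ler_sum => i _.
apply: le_trans (_ : `|xi 0 i| * v 0 i ^+ 2 <= _).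
  by rewrite ler_wpM2r ?sqr_ge0 // ler_norm.
by rewrite ler_wpM2l // energy_le.
Qed.

Lemma sphere_integrable (f : 'rV[R]_N -> R) (M : R) : continuous f ->
  (forall v, S v -> `|f v| <= M) -> F.-integrable S (EFin \o (f : Y -> R)).
Proof.
move=> cf fM; apply: measurable_bounded_integrable.
- exact: mS.
- by rewrite [ltLHS]FS ltry.
- by apply: measurable_funTS; exact: (continuous_measurable_rV cf).
exists M; split; first exact: num_real.
by move=> M' MM v Sv; exact: le_trans (fM v Sv) (ltW MM).
Qed.

Lemma continuous_emon_tilt xi L : continuous (fun v : 'rV[R]_N => emon v L * tilt xi v).
Proof. by apply: continuous_mul; [exact: continuous_emon|exact: continuous_tilt]. Qed.

Lemma emon_tilt_le xi L v : S v ->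
  `|emon v L * tilt xi v| <= N%:R ^+ size L * expR (\sum_i `|xi 0 i| * N%:R).
Proof.
move=> Sv; rewrite normrM ger0_norm ?emon_ge0 // ger0_norm ?expR_ge0 //.
by apply: ler_pM; rewrite ?emon_ge0 ?expR_ge0 ?emon_le ?tilt_le.
Qed.

Lemma tmass_gt0 xi : 0 < tmass xi [::].
Proof.
pose a : R := expR (- \sum_i `|xi 0 i| * N%:R).
apply: (@lt_le_trans _ _ a); first exact: expR_gt0.
apply: (@le_trans _ _ (\int[F]_(v in S) a)).
  by rewrite Rintegral_cst // [X in fine X]FS mulr1.
apply: le_Rintegral => //.
- by apply: (@sphere_integrable (fun=> a) `|a|) => //; exact: continuous_const.
- by apply: sphere_integrable (@continuous_emon_tilt xi [::]) (@emon_tilt_le xi [::]).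
move=> v Sv; rewrite /emon big_nil mul1r ler_expR -sumrN; apply: ler_sum => i _.
have e0 := sqr_ge0 (v 0 i); have e1 := energy_le i Sv.
have : - `|xi 0 i| * v 0 i ^+ 2 <= xi 0 i * v 0 i ^+ 2.
  by rewrite ler_wpM2r // lerNl -normrN ler_norm.
apply: le_trans; rewrite mulNr lerN2 ler_wpM2l //.
Qed.

Lemma tilt_line xi i (h : R) v :
  tilt (h *: delta_mx 0 i + xi) v = tilt xi v * expR (h * v 0 i ^+ 2).
Proof.
rewrite /tilt -expRD; congr expR; rewrite addrC.
under eq_bigr do rewrite !mxE eqxx /= mulrDl.
rewrite big_split /=; congr (_ + _).
rewrite (bigD1 i) //= eqxx mulr1 big1 ?addr0 // => j ji.
by rewrite (negbTE ji) mulr0 mul0r.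
Qed.

Lemma is_derive_line (f : 'rV[R]_N -> R) x v (D : R) :
  is_derive (0 : R) 1 (fun h : R => f (h *: v + x)) D -> is_derive x v f D.
Proof.
have E : (fun h : R => h^-1 *: ((fun u : R => f (u *: v + x)) (h *: 1 + 0) -
    (fun u : R => f (u *: v + x)) 0)) = (fun h : R => h^-1 *: (f (h *: v + x) - f x)).
  by apply/funext => h; rewrite addr0 scale0r add0r /GRing.scale /= mulr1.
move=> [dg vg]; apply: DeriveDef; first by rewrite /derivable -E.
by rewrite -vg /derive -E.
Qed.

Lemma is_derive_tmass xi i L :
  is_derive (0 : R) 1 (fun h : R => tmass (h *: delta_mx 0 i + xi) L) (tmass xi (i :: L)).
Proof.
pose f (h : R) (v : Y) : R := emon (v : 'rV[R]_N) L * tilt (h *: delta_mx 0 i + xi) v.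
(* Dominates the derivative for |h| < 1, as every energy on the sphere lies between 0 and [N]. *)
pose K : R := N%:R ^+ size L * expR (\sum_j `|xi 0 j| * N%:R) * (N%:R * expR N%:R).
have df (h : R) v : is_derive h 1 (f ^~ v)
    (emon (v : 'rV[R]_N) L * tilt xi v * (expR (h * v 0 i ^+ 2) * v 0 i ^+ 2)).
  have -> : f ^~ v = (fun h => (emon (v : 'rV[R]_N) L * tilt xi v) * expR (h * v 0 i ^+ 2)).
    by apply/funext => u; rewrite /f tilt_line mulrA.
  exact: is_derive_scaled_exp.
have I0 : `](-1 : R), 1[%classic 0 by rewrite /= in_itv /=; apply/andP; split; lra.
have d1 h v : partial1of2 f h v =
    emon (v : 'rV[R]_N) L * tilt xi v * (expR (h * v 0 i ^+ 2) * v 0 i ^+ 2).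
  by rewrite partial1of2E; case: (df h v).
have intf h : `](-1 : R), 1[%classic h -> F.-integrable S (EFin \o f h).
  by move=> _; apply: sphere_integrable (@continuous_emon_tilt _ L) (@emon_tilt_le _ L).
have derf h v : `](-1 : R), 1[%classic h -> S v -> derivable (f ^~ v) h 1.
  by move=> _ _; case: (df h v).
have K0 : 0 <= K by rewrite !mulr_ge0 ?exprn_ge0 ?expR_ge0.
have intK : F.-integrable S (EFin \o (fun _ : Y => K)).
  by apply: (@sphere_integrable (fun=> K) `|K|) => //; exact: continuous_const.
have Kub h v : `](-1 : R), 1[%classic h -> S v -> `|partial1of2 f h v| <= K.
  rewrite /= in_itv /= => /andP[h1 h2] Sv; rewrite d1 normrM.
  apply: ler_pM => //; first exact: emon_tilt_le.
  rewrite normrM ger0_norm ?expR_ge0 // ger0_norm ?sqr_ge0 // mulrC.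
  apply: ler_pM; rewrite ?sqr_ge0 ?expR_ge0 ?energy_le // ler_expR.
  have e0 := sqr_ge0 (v 0 i); have e1 := energy_le i Sv.
  apply: le_trans e1; rewrite ler_piMl //; exact: ltW.
have G0 : forall v : Y, 0 <= (fun _ : Y => K) v by [].
have D1 := derivable_under_integral mS I0 intf derf G0 intK Kub.
have D2 := differentiation_under_integral mS I0 intf derf G0 intK Kub.
apply: DeriveDef; first exact: D1.
rewrite -derive1E [LHS]D2 /tmass; apply: eq_Rintegral => v _.
by rewrite d1 mul0r expR0 mul1r /emon big_cons mulrC mulrA.
Qed.

Lemma is_derive_tmoment xi i L :
  is_derive (0 : R) 1 (fun h : R => tmoment (h *: delta_mx 0 i + xi) L)
    (tmoment xi (i :: L) - tmoment xi [:: i] * tmoment xi L).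
Proof.
have D1 := is_derive_tmass xi i L; have D0 := is_derive_tmass xi i [::].
have n0 : tmass (0 *: delta_mx 0 i + xi) [::] != 0 by rewrite gt_eqF // tmass_gt0.
have DV := is_deriveV n0 D0.
apply: is_derive_eq (is_deriveM D1 DV) _.
rewrite scale0r add0r /tmoment /GRing.scale /=.
by field; rewrite gt_eqF // tmass_gt0.
Qed.

Lemma tmoment_nil xi : tmoment xi [::] = 1.
Proof. by rewrite /tmoment divff // gt_eqF // tmass_gt0. Qed.

(* Differentiating the tilt in direction [i] acts on the cumulant series as
   [der i], up to its constant term. *)
Lemma is_derive_cumulant xi i L : L != [::] ->
  is_derive xi (delta_mx 0 i) (fun x => logm (tmoment x) L) (logm (tmoment xi) (i :: L)).
Proof.
move=> L0; apply: is_derive_line.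
pose m (h : R) := tmoment (h *: delta_mx 0 i + xi).
have m0 : m 0 = tmoment xi by rewrite /m scale0r add0r.
have dm A : is_derive (0 : R) 1 (fun h => m h A)
    (tmoment xi (i :: A) - tmoment xi [:: i] * tmoment xi A) by exact: is_derive_tmoment.
have km u : is_exp (logm (m u)) (m u) by apply: logmP; exact: tmoment_nil.
pose k' := fun A => 'D_1 (fun u : R => logm (m u) A) 0.
have dk A : is_derive (0 : R) 1 (fun u => logm (m u) A) (k' A).
  by apply: DeriveDef => //; apply: derivable_logm => B; case: (dm B).
have k0 : k' [::] = 0 by rewrite /k' derive_cst.
have := is_exp_derive km dm dk k0; rewrite m0 => E.
have kx := logmP (tmoment_nil xi).
suff /(shuffle_cancel (tmoment_nil xi)) E2 : shuffle k' (tmoment xi) =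
    shuffle (fun A => logm (tmoment xi) (i :: A) - tmoment xi [:: i] * sone R A) (tmoment xi).
  have := dk L; rewrite E2 /sone (negbTE L0) mulr0 subr0; exact.
rewrite -E; apply/funext => A.
rewrite (is_exp_cons _ _ kx) /shuffle.
rewrite -[in X in _ - _ * X](shuffle1f (tmoment xi)) /shuffle mulr_sumr -sumrB.
by apply: eq_bigr => p _; rewrite [RHS]mulrBl -[in RHS]mulrA.
Qed.

Lemma is_derive_cgf xi i :
  is_derive xi (delta_mx 0 i) (energy_cgf F) (logm (tmoment xi) [:: i]).
Proof.
apply: is_derive_line.
have -> : logm (tmoment xi) [:: i] = tmoment xi [:: i].
  by rewrite logm_cons /= big_cons big_nil /= subr0.
have E x : energy_cgf F x = ln (tmass x [::]).
  by congr ln; apply: eq_Rintegral => v _; rewrite /emon big_nil mul1r.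
under eq_fun do rewrite E.
have D0 := is_derive_tmass xi i [::].
have p0 : 0 < tmass (0 *: delta_mx 0 i + xi) [::] by exact: tmass_gt0.
apply: is_derive_eq (is_derive1_comp (f := @ln R) (is_derive1_ln p0) D0) _.
by rewrite scale0r add0r mulrC.
Qed.

Lemma energy_cumulant_rec labels : labels != [::] ->
  foldr (fun i (f : 'rV[R]_N -> R) xi => 'D_(delta_mx 0 i) f xi) (energy_cgf F) labels =
  (fun xi => logm (tmoment xi) labels).
Proof.
elim: labels => // i [|j L] IH _; apply/funext => xi /=.
  by case: (is_derive_cgf xi i).
rewrite /= in IH; have -> := IH isT.
by case: (is_derive_cumulant xi i (L := j :: L) isT).
Qed.

Lemma tmoment0 : tmoment 0 = smoment F.
Proof.
have t0 L : tmass 0 L = smoment F L.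
  apply: eq_Rintegral => v _; rewrite /tilt big1 ?expR0 ?mulr1 // => i _.
  by rewrite mxE mul0r.
apply/funext => L; rewrite /tmoment !t0.
have -> : smoment F [::] = 1.
  rewrite /smoment; under eq_Rintegral do rewrite /emon big_nil.
  by rewrite Rintegral_cst // [X in fine X]FS mulr1.
by rewrite divr1.
Qed.

Lemma energy_cumulantE labels : labels != [::] ->
  energy_cumulant F labels = logm (smoment F) labels.
Proof. by move=> l0; rewrite /energy_cumulant energy_cumulant_rec // tmoment0. Qed.

(** An equality valid for all tilts can be differentiated in direction [i]; this is why [xi] stays
    free in the permutation lemmas. *)
Lemma logm_tmoment_cons i L L' : size L = size L' ->
  (forall xi, logm (tmoment xi) L = logm (tmoment xi) L') ->
  forall xi, logm (tmoment xi) (i :: L) = logm (tmoment xi) (i :: L').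
Proof.
move=> sL H xi; case: (eqVneq L [::]) => L0.
  by move: sL; rewrite L0 => /esym/size0nil ->.
have L'0 : L' != [::] by rewrite -size_eq0 -sL size_eq0.
have D1 := is_derive_cumulant xi i L0; have D2 := is_derive_cumulant xi i L'0.
have E : (fun x => logm (tmoment x) L) = (fun x => logm (tmoment x) L') by apply/funext.
by rewrite E in D1; case: D1 => _ <-; case: D2 => _ <-.
Qed.

Lemma logm_tmoment_swap i j L xi :
  logm (tmoment xi) (i :: j :: L) = logm (tmoment xi) (j :: i :: L).
Proof.
apply: is_exp_swap (logmP (tmoment_nil xi)) _ => A.
congr (_ / _); apply: eq_Rintegral => v _; congr (_ * _).
by rewrite /emon !big_cons mulrCA.
Qed.

(** Swaps of the two leading labels, performed behind arbitrary prefixes, generate all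
    permutations. *)
Lemma logm_tmoment_perm L L' : perm_eq L L' ->
  forall xi, logm (tmoment xi) L = logm (tmoment xi) L'.
Proof.
have move1 i s t xi : logm (tmoment xi) (i :: s ++ t) = logm (tmoment xi) (s ++ i :: t).
  elim: s xi => // j s IH xi /=; rewrite logm_tmoment_swap.
  by apply: logm_tmoment_cons => //; rewrite /= !size_cat /= addnS.
have move2 s1 s2 s3 xi :
    logm (tmoment xi) (s1 ++ s2 ++ s3) = logm (tmoment xi) (s2 ++ s1 ++ s3).
  elim: s1 xi => // i s1 IH xi /=; rewrite -move1.
  by apply: logm_tmoment_cons => //; rewrite !size_cat addnCA.
move=> LL'; pose P A := forall xi, logm (tmoment xi) L = logm (tmoment xi) A.
suff : P L' by [].
apply: (catCA_perm_ind _ LL') => // s1 s2 s3 H xi.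
by rewrite H move2.
Qed.

Lemma logm_smoment_perm L L' : perm_eq L L' ->
  logm (smoment F) L = logm (smoment F) L'.
Proof. by move=> LL'; rewrite -tmoment0; exact: logm_tmoment_perm. Qed.

End TiltedMoments.

(** * Partition classifiers and the final estimate *)

Section Classifiers.
Local Open Scope nat_scope.
Variables (N n : nat).
Hypothesis nN : n <= N.
Implicit Types (r : n.-tuple 'I_n.+1) (L : seq 'I_N).

Lemma sum_nth_sumn (f : nat -> nat) (s : seq nat) : f 0 = 0 -> size s <= N ->
  \sum_(k < N) f (nth 0 s k) = sumn (map f s).
Proof.
move=> f0 sN; rewrite sumnE big_map (big_nth 0) big_mkord.
rewrite (big_ord_widen N (fun i => f (nth 0 s i)) sN) [RHS]big_mkcond.
apply: eq_bigr => k _; case: ltnP => // sk; rewrite nth_default //.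
Qed.

Lemma count_classifier_labels r (k : 'I_N) :
  count_mem k (classifier_labels N r) = nth 0 [seq val l | l <- r] k.
Proof.
rewrite /classifier_labels count_flatten -map_comp sumnE big_map big_enum /=.
rewrite (bigD1 k) //= count_nseq /= eqxx mul1n big1 ?addn0 // => j jk.
by rewrite count_nseq /= (negbTE jk).
Qed.

Lemma size_classifier_labels r : r \in classifiers n -> size (classifier_labels N r) = n.
Proof.
rewrite inE => /andP[_ /eqP sr]; rewrite -[RHS]sr -[in RHS](map_id [seq val k | k <- r]).
rewrite -sum_nth_sumn //; last by rewrite size_map size_tuple.
rewrite /classifier_labels size_flatten /shape -map_comp sumnE big_map big_enum /=.
by apply: eq_bigr => k _; rewrite size_nseq.
Qed.

Lemma ndist_classifier_labels r : ndist (classifier_labels N r) = len r.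
Proof.
have -> : len r = sumn [seq (x != 0) : nat | x <- [seq val k | k <- r]].
  by rewrite sumn_count count_map.
rewrite -sum_nth_sumn //; last by rewrite size_map size_tuple.
rewrite /ndist -(card_uniqP (undup_uniq _)) -sum1_card big_mkcond.
apply: eq_bigr => k _; rewrite mem_undup -count_classifier_labels -lt0n -has_count has_pred1.
by case: (k \in _).
Qed.

Lemma sum_count_mem L : \sum_(i < N) count_mem i L = size L.
Proof.
elim: L => [|a L IH]; first by rewrite big1.
rewrite /= big_split /= IH (bigD1 a) //= eqxx big1 ?addn0 ?add1n // => i ia.
by rewrite eq_sym (negbTE ia).
Qed.

(** Sort the particles by decreasing multiplicity in [L]: the leading multiplicities form [r], and
    [s] sends each particle to its rank. *)
Lemma classifier_of_labels L : 0 < n -> size L = n ->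
  exists2 r, r \in classifiers n &
  exists s : 'S_N, perm_eq (map s L) (classifier_labels N r).
Proof.
move=> n0 Ln; have N0 : 0 < N by exact: leq_trans n0 nN.
pose x0 : 'I_N := Ordinal N0.
pose cnt x := count_mem x L.
pose t := sort (fun a b => cnt b <= cnt a) (enum 'I_N).
have tot : total (fun a b : 'I_N => cnt b <= cnt a) by move=> a b; exact: leq_total.
have tr : transitive (fun a b : 'I_N => cnt b <= cnt a).
  by move=> a b c ab ac; exact: leq_trans ac ab.
have tsorted : sorted (fun a b => cnt b <= cnt a) t by exact: sort_sorted.
have tperm : perm_eq t (enum 'I_N) by rewrite perm_sort.
have tsize : size t = N by rewrite (perm_size tperm) size_enum_ord.
have tuniq : uniq t by rewrite (perm_uniq tperm) enum_uniq.
have tmem x : x \in t by rewrite (perm_mem tperm) mem_enum.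
have mono i j : i <= j -> j < N -> cnt (nth x0 t j) <= cnt (nth x0 t i).
  move=> ij jN; apply: (sorted_leq_nth tr _ x0 tsorted) => //; rewrite ?inE ?tsize //.
  exact: leq_ltn_trans ij jN.
(* A positive count at rank [k] would put the first [k + 1] particles of [t] into [L], more than its
   [n] entries allow. *)
have zero k : n <= k -> k < N -> cnt (nth x0 t k) = 0.
  move=> nk kN; apply/eqP; rewrite -leqn0 leqNgt; apply/negP => ck.
  have : size (take k.+1 t) <= size L.
    apply: uniq_leq_size; first exact: take_uniq.
    move=> x /(nthP x0)[i]; rewrite size_take tsize => ik <-.
    have ik' : i < k.+1 by move: ik; case: (ltnP k.+1 N) => // Nk ik; exact: leq_trans ik Nk.
    rewrite nth_take // -has_pred1 has_count; apply: leq_trans ck _.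
    by apply: mono.
  by rewrite size_takel ?tsize // Ln ltnNge nk.
pose f (i : 'I_n) : 'I_n.+1 := inord (cnt (nth x0 t i)).
have fE (i : 'I_n) : val (f i) = cnt (nth x0 t i).
  rewrite /= inordK // ltnS; have := count_size (pred1 (nth x0 t i)) L.
  by rewrite [X in _ <= X -> _]Ln.
pose r := [tuple f i | i < n].
have rnth k : k < N -> nth 0 [seq val l | l <- r] k = cnt (nth x0 t k).
  move=> kN; case: (ltnP k n) => kn; last first.
    by rewrite nth_default ?zero // size_map size_tuple.
  rewrite (nth_map ord0) ?size_tuple // -[k in LHS]/(val (Ordinal kn)) -tnth_nth tnth_mktuple.
  exact: fE.
have rE : [seq val l | l <- r] = take n (map cnt t).
  apply: (@eq_from_nth _ 0); first by rewrite size_map size_tuple size_takel // size_map tsize.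
  move=> k; rewrite size_map size_tuple => kn.
  have kN := leq_trans kn nN.
  by rewrite rnth // nth_take // (nth_map x0) // tsize.
have rcl : r \in classifiers n.
  rewrite inE; apply/andP; split; first by rewrite rE take_sorted // sorted_map.
  have sr : size [seq val l | l <- r] <= N by rewrite size_map size_tuple.
  have -> : sumn [seq val l | l <- r] = \sum_(k < N) nth 0 [seq val l | l <- r] k.
    by rewrite (sum_nth_sumn (f := id)) // map_id.
  rewrite -[X in _ == X]Ln -sum_count_mem.
  have -> : \sum_(i < N) count_mem i L = \sum_(i <- t) count_mem i L.
    by rewrite (perm_big _ tperm) /= big_enum.
  rewrite [X in _ == X](big_nth x0) tsize big_mkord.
  by apply/eqP; apply: eq_bigr => k _; rewrite rnth.
exists r => //.
have ti (x : 'I_N) : index x t < N by have := index_mem x t; rewrite tmem tsize.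
have sinj : injective (fun x : 'I_N => Ordinal (ti x)).
  by move=> x y [xy]; rewrite -(nth_index x0 (tmem x)) xy nth_index.
exists (perm sinj); rewrite /perm_eq; apply/allP => k _ /=; apply/eqP.
rewrite count_classifier_labels rnth // count_map; apply: eq_count => x /=.
rewrite permE; apply/eqP/eqP => [<-|->] /=; first by rewrite nth_index.
by apply: val_inj; rewrite /= index_uniq // tsize.
Qed.

End Classifiers.

(** * Choice of the threshold for the number of particles *)

Section LargeN.
Variable R : realType.

Lemma powRD_gt0 (x a b : R) : 0 < x -> x `^ (a + b) = x `^ a * x `^ b.
Proof. by move=> x0; rewrite powRD // (gt_eqF x0) implybT. Qed.

Lemma powR_ge_root (x a T : R) : 0 < a -> 0 <= T -> T `^ a^-1 <= x -> T <= x `^ a.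
Proof.
move=> a0 T0 Tx.
have -> : T = (T `^ a^-1) `^ a by rewrite -powRrM mulVf ?gt_eqF // powRr1.
by apply: ge0_ler_powR => //; rewrite ?nnegrE ?powR_ge0 ?(ltW a0) // (le_trans (powR_ge0 _ _) Tx).
Qed.

(** Both [q^-1], which is [N - 1] to the power [alpha], and [(N - 1) * q], its power [1 - alpha],
    tend to infinity because [0 < alpha < 1]. All conditions hold once both reach [64 * M + 1],
    where [M] dominates the expressions in [n] that occur. *)
Lemma large_N (alpha : R) (nstar : nat) : 0 < alpha < 1 ->
  exists N0 : nat, [/\ (2 <= N0)%N, (nstar <= N0)%N & forall N : nat, (N0 <= N)%N ->
    let q := (N%:R - 1) `^ (- alpha) in
    [/\ 0 < q <= 1,
        forall n, (1 < n <= nstar)%N -> (n%:R - 1) / (N%:R - n%:R + 1) <= q,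
        forall n, (1 < n <= nstar)%N ->
          2 * n%:R * 2 ^+ n * q + 2 * n%:R ^+ 2 * 3 ^+ n / ((N%:R - 1) * q) <= 1 / 32
      & forall n, (1 < n <= nstar)%N -> 7 / 16 <= (N%:R - n%:R) / (2 * (N%:R - 1)) :> R]].
Proof.
move=> /andP[a0 a1].
pose M : R := 2 * nstar%:R * 2 ^+ nstar + 2 * nstar%:R ^+ 2 * 3 ^+ nstar + 2 * nstar%:R.
pose T : R := 64 * M + 1.
have M0 : 0 <= M by rewrite !addr_ge0 // !mulr_ge0 // exprn_ge0.
have T0 : 1 <= T by rewrite /T lerDr mulr_ge0.
have T0' : 0 <= T by exact: le_trans T0.
pose x : R := T `^ alpha^-1 + T `^ (1 - alpha)^-1.
have x0 : 0 <= x by rewrite addr_ge0 // powR_ge0.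
exists ((Num.bound x).+2 + nstar)%N; split; rewrite ?leq_addl // => N NN /=.
set p := N%:R - 1; set q := p `^ _.
have px : x <= p.
  rewrite /p lerBrDr; apply: (@le_trans _ _ ((Num.bound x).+1)%:R).
    by rewrite -natr1 lerD2r ltW // archi_boundP.
  by rewrite ler_nat; apply: leq_trans NN; rewrite addSn leqW // leq_addr.
have p1 : 1 <= p.
  apply: le_trans px; apply: (@le_trans _ _ (T `^ alpha^-1)).
    have -> : 1 = 1 `^ alpha^-1 :> R by rewrite powR1.
    apply: ge0_ler_powR; rewrite ?nnegrE ?invr_ge0 ?(ltW a0) //.
  by rewrite lerDl powR_ge0.
have p0 : 0 < p by exact: lt_le_trans ltr01 p1.
have q0 : 0 < q by exact: powR_gt0.
have qT : T <= q^-1.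
  rewrite /q powRN invrK; apply: powR_ge_root => //; apply: le_trans px.
  by rewrite lerDl powR_ge0.
have pqT : T <= p * q.
  have -> : p * q = p `^ (1 - alpha) by rewrite powRD_gt0 // powRr1 // ltW.
  apply: powR_ge_root => //; first by rewrite subr_gt0.
  by apply: le_trans px; rewrite lerDr powR_ge0.
have q1 : q <= 1.
  by rewrite -[q]invrK invf_le1 ?invr_gt0 // (le_trans T0).
have Tp : T <= p by apply: le_trans pqT _; rewrite ler_piMr // ltW.
have nM n : (n <= nstar)%N -> 2 * n%:R <= M /\ (2 * n%:R * 2 ^+ n <= M /\
    2 * n%:R ^+ 2 * 3 ^+ n <= M).
  move=> nn; have nR : n%:R <= nstar%:R :> R by rewrite ler_nat.
  have h1 : 2 * n%:R * 2 ^+ n <= 2 * nstar%:R * 2 ^+ nstar :> R.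
    by apply: ler_pM; rewrite ?mulr_ge0 ?exprn_ge0 ?ler_wpM2l // ler_weXn2l // ler1n.
  have h2 : 2 * n%:R ^+ 2 * 3 ^+ n <= 2 * nstar%:R ^+ 2 * 3 ^+ nstar :> R.
    apply: ler_pM; rewrite ?mulr_ge0 ?exprn_ge0 ?ler_wpM2l //; last by rewrite ler_weXn2l // ler1n.
    by rewrite lerXn2r ?nnegrE.
  have g1 : 0 <= 2 * nstar%:R * 2 ^+ nstar :> R by rewrite !mulr_ge0 // exprn_ge0.
  have g2 : 0 <= 2 * nstar%:R ^+ 2 * 3 ^+ nstar :> R by rewrite !mulr_ge0 // exprn_ge0.
  have g3 : 0 <= nstar%:R :> R by [].
  by rewrite /M; split; [|split]; lra.
have Np : N%:R = p + 1 :> R by rewrite /p subrK.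
split; first by rewrite q0 q1.
- move=> n /andP[n1 nn]; have [h _] := nM n nn.
  have d0 : 0 < N%:R - n%:R + 1 :> R by rewrite Np; move: Tp; rewrite /T; lra.
  rewrite ler_pdivrMr //.
  have h2 : p / 2 <= N%:R - n%:R + 1 by rewrite Np; move: Tp; rewrite /T; lra.
  apply: le_trans (ler_wpM2l (ltW q0) h2).
  by move: pqT; rewrite [p * q]mulrC mulrA /T; move: (q * p) => z; lra.
- move=> n /andP[n1 nn]; have [_ [h1 h2]] := nM n nn.
  have e1 : 2 * n%:R * 2 ^+ n * q <= 1 / 64.
    apply: le_trans (ler_wpM2r (ltW q0) h1) _.
    rewrite -[q]invrK ler_pdivrMr ?invr_gt0 //; apply: le_trans (ler_wpM2l _ qT) => //.
    by rewrite /T; lra.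
  have e2 : 2 * n%:R ^+ 2 * 3 ^+ n / (p * q) <= 1 / 64.
    rewrite ler_pdivrMr ?mulr_gt0 //; apply: le_trans h2 _.
    by apply: le_trans (ler_wpM2l _ pqT) => //; rewrite /T; lra.
  by lra.
- move=> n /andP[n1 nn]; have [h _] := nM n nn.
  rewrite ler_pdivlMr ?mulr_gt0 // Np; move: Tp; rewrite /T.
  have : 1 <= n%:R :> R by rewrite ler1n ltnW.
  by lra.
Qed.

End LargeN.

Theorem theorem2p14 (R : realType) :
  exists C : R -> R,
  forall (c alpha : R) (nstar : nat),
    0 <= c -> 0 < alpha < 1 -> (1 <= nstar)%N ->
  exists N0 : nat, [/\ (2 <= N0)%N, (nstar <= N0)%N &
    forall (N : nat) (F0 : probability (borel_rV R N) R),
      (N0 <= N)%N ->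
      F0 (@sphere R N) = 1%E -> radon F0 -> symmetric_law F0 ->
    forall (d : measure_display) (Omega : measurableType d)
      (P : probability Omega R) (X : R -> {RV P >-> borel_rV R N}),
      kac_process X ->
      (forall A : set (borel_rV R N), measurable A ->
        distribution P (X 0) A = F0 A) ->
    forall B : R, 1 <= B ->
      \big[Num.max/0]_(1 <= n < nstar.+1)
        \big[Num.max/0]_(r in classifiers n)
          (`|classifier_cumulant F0 r|
             * N%:R `^ (alpha * ((len r)%:R - 1) - c * (n%:R - 1))
           / (n.-1)`!%:R) `^ (n%:R^-1)
        <= B ->
    forall (n : nat) (t : R), (1 <= n <= nstar)%N -> 0 <= t ->
      cumulant_norm alpha N
        (fun r : n.-tuple 'I_n.+1 =>
           classifier_cumulant (distribution P (X t)) r)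
      <= C B ^+ (n ^ 2) * n`!%:R
         * (N%:R `^ gamma c n * expR (- t / 4) + 1)].
Proof.
(* 100 serves the partition sums, and the factor [B] lets [C ^+ (n ^ 2)] dominate the [B ^+ n] of
   the initial bound. *)
exists (fun B => 100 * B) => c alpha nstar c0 alpha01 nstar1.
have [N0 [N02 nN0 HN]] := @large_N R alpha nstar alpha01.
exists N0; split => // N F0 NN0 F0S _ symF0 d Omega P X kacX X0 B B1 Bbound.
have [q01 Nuniq Nsmall Nrate] := HN N NN0.
set q := (N%:R - 1) `^ (- alpha) in q01 Nuniq Nsmall.
have N2 : (1 < N)%N by exact: leq_trans N02 NN0.
have nN : (nstar <= N)%N by exact: leq_trans nN0 NN0.
have p0 : 0 < N%:R - 1 :> R by rewrite subr_gt0 ltr1n.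
have NR1 : 1 <= N%:R :> R by rewrite ler1n ltnW.
(* With [n.-1] in place of [n%:R - 1] the value [Gam 0] is 1, so that [1 <= Gam n] holds for every
   [n]. *)
pose Gam n : R := N%:R `^ (c * n.-1%:R).
have GamE n : (0 < n)%N -> N%:R `^ gamma c n = Gam n.
  by move=> n0; rewrite /gamma /Gam -subn1 natrB.
have Gam1 n : 1 <= Gam n.
  by rewrite -(powRr0 (N%:R : R)); apply: ler_powR => //; rewrite mulr_ge0.
have GamM l n : (0 < l)%N -> (0 < n)%N -> Gam l * Gam n <= Gam (l + n)%N.
  move=> l0 n0; rewrite /Gam -powRD_gt0 ?(lt_le_trans ltr01) //.
  apply: ler_powR => //; rewrite -mulrDr ler_wpM2l // -natrD ler_nat.
  by case: l l0 => // l _; case: n n0 => // n _; rewrite addnS /= addSn leqnSn.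
have C100 : 100 <= 100 * B by rewrite ler_peMr.
have XSt t : 0 <= t -> distribution P (X t) (@sphere R N) = 1%E.
  move=> t0; rewrite -[LHS]/(P (X t @^-1` @sphere R N)).
  have -> : X t @^-1` @sphere R N = setT.
    by apply/seteqP; split => w // _; exact: kac_sphere.
  exact: probability_setT.
have symX0 : symmetric_law (distribution P (X 0)).
  move=> s A mA; rewrite X0 //; last first.
    have := @measurable_col_perm R N s measurableT A mA; rewrite setTI; exact.
  by rewrite symF0 // X0.
have qE k : q ^+ k = (N%:R - 1) `^ (- (alpha * k%:R)).
  by rewrite /q -powR_mulrn ?powR_ge0 // -powRrM mulNr.
have msym := cmoment_sym N2 kacX symX0.
have sm0 : cmoment X 0 = smoment F0.
  by apply/funext => L; rewrite cmomentE //; apply: smoment_eq => A mA; exact: X0.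
have k0 L : (1 < size L <= nstar)%N -> `|logm (cmoment X 0) L| <
    growth (100 * B) (decay Gam 0) (size L) * q ^+ (ndist L).-1.
  set n := size L => /andP[n1 nn].
  have n0 : (0 < n)%N by exact: ltnW.
  (* The initial hypothesis speaks of classifiers only; exchangeability, and symmetry of cumulants
     in their arguments, reduce every list to one. *)
  have [r rcl [s Ls]] := classifier_of_labels (leq_trans nn nN) (L := L) n0 erefl.
  have lr : ndist L = len r.
    rewrite -(ndist_classifier_labels (leq_trans nn nN)) -(ndist_perm Ls).
    by rewrite /ndist undup_map_inj ?size_map //; exact: perm_inj.
  have L'0 : classifier_labels N r != [::].
    by rewrite -size_eq0 (size_classifier_labels (leq_trans nn nN)) // -lt0n.
  have kE : logm (cmoment X 0) L = classifier_cumulant F0 r.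
    rewrite -(logm_relabel (msym 0 (lexx 0)) s).
    by rewrite sm0 (logm_smoment_perm F0S Ls) -energy_cumulantE.
  have len0 : (0 < len r)%N by rewrite -lr ndist_gt0 // -size_eq0 -lt0n.
  pose z : R := `|classifier_cumulant F0 r|
     * N%:R `^ (alpha * ((len r)%:R - 1) - c * (n%:R - 1)) / (n.-1)`!%:R.
  have z0 : 0 <= z by rewrite /z !mulr_ge0 ?powR_ge0 ?invr_ge0.
  have zB : z `^ n%:R^-1 <= B.
    apply: le_trans Bbound.
    pose G i := \big[Num.max/0]_(r in classifiers i)
          ((`|classifier_cumulant F0 r|
             * N%:R `^ (alpha * ((len r)%:R - 1) - c * (i%:R - 1))
           / (i.-1)`!%:R) `^ (i%:R^-1)).
    have := @le_bigmax_seq _ R _ (index_iota 1 nstar.+1) 0 n xpredT G.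
    rewrite mem_index_iota n0 ltnS nn => /(_ isT isT); apply: le_trans.
    exact: (@le_bigmax_cond _ R _ 0 r (fun r => r \in classifiers n)
      (fun r => (`|classifier_cumulant F0 r|
             * N%:R `^ (alpha * ((len r)%:R - 1) - c * (n%:R - 1))
           / (n.-1)`!%:R) `^ (n%:R^-1)) rcl).
  have zBn : z <= B ^+ n.
    have nR0 : n%:R != 0 :> R by rewrite pnatr_eq0 -lt0n.
    rewrite -(powRr1 z0) -(mulVf nR0) powRrM -powR_mulrn ?(le_trans ler01) //.
    by apply: ge0_ler_powR; rewrite ?nnegrE ?powR_ge0 // (le_trans ler01).
  have lenE : (len r)%:R - 1 = (len r).-1%:R :> R by rewrite -subn1 natrB.
  have nE : n%:R - 1 = n.-1%:R :> R by rewrite -subn1 natrB.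
  have NR0 : 0 < N%:R :> R by exact: lt_le_trans ltr01 NR1.
  have f0 : 0 < (n.-1)`!%:R :> R by rewrite ltr0n fact_gt0.
  have kz : `|classifier_cumulant F0 r| =
      z * (n.-1)`!%:R * Gam n * N%:R `^ (- (alpha * (len r).-1%:R)).
    rewrite /z lenE nE powRD_gt0 // !powRN -/(Gam n).
    have G0 : Gam n != 0 by rewrite gt_eqF // (lt_le_trans ltr01).
    have P0 : N%:R `^ (alpha * (len r).-1%:R) != 0 :> R by rewrite gt_eqF // powR_gt0.
    by field; rewrite G0 P0 gt_eqF.
  (* The initial bound is normalised by powers of [N], the norm by powers of [N - 1]; the exponent
     is nonpositive, so the comparison goes the right way. *)
  have qk : N%:R `^ (- (alpha * (len r).-1%:R)) <= q ^+ (len r).-1.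
    rewrite qE !powRN lef_pV2 ?posrE ?powR_gt0 //.
    case/andP: alpha01 => a0 _.
    apply: ge0_ler_powR; rewrite ?nnegrE ?(ltW p0) ?(ltW NR0) ?mulr_ge0 ?(ltW a0) //.
    by rewrite gerBl.
  have q0 : 0 < q by case/andP: q01.
  have Gp : 0 < Gam n by exact: lt_le_trans ltr01 (Gam1 n).
  rewrite kE kz lr; apply: (@le_lt_trans _ _ (B ^+ n * (n.-1)`!%:R * Gam n * q ^+ (len r).-1)).
    by apply: ler_pM; rewrite ?powR_ge0 ?mulr_ge0 ?(ltW f0) ?(ltW Gp) // ler_wpM2r ?ler_wpM2r ?(ltW Gp) ?(ltW f0).
  rewrite ltr_pM2r ?exprn_gt0 // /growth /decay oppr0 mul0r expR0 mulr1.
  (* The summand 1 in [decay] makes the initial inequality strict, as the barrier argument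
     requires. *)
  apply: (@le_lt_trans _ _ ((100 * B) ^+ (n ^ 2) * n`!%:R * Gam n)).
    have B0 : 0 <= B by exact: le_trans ler01 B1.
    rewrite ler_wpM2r ?(ltW Gp) //; apply: ler_pM; [exact: exprn_ge0|exact: ltW| |].
      apply: (@le_trans _ _ ((100 * B) ^+ n)).
        by apply: lerXn2r; rewrite ?nnegrE ?mulr_ge0 // ler_peMl // ler1n.
      apply: ler_weXn2l; first by apply: le_trans C100; rewrite ler1n.
      by rewrite -[leqLHS]expn1 leq_pexp2l.
    by rewrite ler_nat leq_fact // leq_pred.
  rewrite ltr_pM2l ?ltrDl // mulr_gt0 ?exprn_gt0 ?ltr0n ?fact_gt0 //.
  exact: lt_le_trans C100.
move=> n t /andP[n1 nn] t0.
have main := @cumulant_decay_order R N nstar (cmoment X) (100 * B) q Gam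
  (cmoment_nil X) (cmoment_continuous N2 kacX) (fun t t0 L => @cmoment_derive R N d Omega P X N2 kacX t L t0)
  msym (cmoment_cons kacX) C100 q01 Gam1 GamM N2 nN Nuniq Nsmall Nrate k0 n.
rewrite n1 nn in main; have {}main := main isT t t0.
rewrite (GamE n n1) -/(decay Gam t n) -/(growth (100 * B) (decay Gam t) n).
have g0 : 0 <= growth (100 * B) (decay Gam t) n.
  by apply: growth_ge0 => // l; exact: le_trans ler01 (decay_ge1 Gam1 t l).
apply: bigmax_le => // r; rewrite in_setD1 => /andP[_ rcl].
have nN' := leq_trans nn nN.
have sz := size_classifier_labels nN' rcl.
have L0 : classifier_labels N r != [::] by rewrite -size_eq0 sz -lt0n.
have -> : classifier_cumulant (distribution P (X t)) r = logm (cmoment X t) (classifier_labels N r).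
  rewrite /classifier_cumulant energy_cumulantE //; last exact: XSt.
  by congr logm; apply/funext => A; rewrite cmomentE.
have len0 : (0 < len r)%N by rewrite -(ndist_classifier_labels nN') ndist_gt0.
have lenE : (len r)%:R - 1 = (len r).-1%:R :> R by rewrite -subn1 natrB.
have := main _ sz; rewrite ndist_classifier_labels // qE lenE powRN.
by rewrite ler_pdivlMr ?powR_gt0.
Qed.
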